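(* Let $X$ be a compact metric space, $T\colon X\to X$ a continuous onto map, $\varphi\in C(X)$, and let $\nu$ be a weak Gibbs measure for $\varphi$. 1. If $G\subset M_1(X)$ is open, then for any ergodic ($T$-invariant) probability measure $\rho\in G$ $$\liminf_{m\to\infty}\frac{1}{m}\ln\nu\big(\{x\in X\colon \mathcal{E}_m(x)\in G\}\big)\geq h(T,\rho)+\int\varphi\,d\rho\,.$$ 2. If $F\subset M_1(X)$ is convex and closed, then $$\limsup_{m\to\infty}\frac{1}{m}\ln\nu\big(\{x\in X\colon \mathcal{E}_m(x)\in F\}\big)\leq \sup_{\rho\in F\cap M_1(X,T)}\Big(h(T,\rho)+\int\varphi\,d\rho\Big)\,.$$
   Context: $(X,d)$ is a compact metric space and $T\colon X\to X$ is continuous and onto. $C(X)$ is the set of continuous real-valued functions on $X$. $M_1(X)$ is the set of Borel probability measures on $X$ with the weak convergence topology, and $M_1(X,T)\subset M_1(X)$ is the subset of $T$-invariant probability measures. For $\rho\in M_1(X,T)$, $h(T,\rho)$ is the metric (Kolmogorov–Sinai) entropy. The empirical measure is $\mathcal{E}_n(x):=\frac{1}{n}\sum_{k=0}^{n-1}\delta_{T^kx}$, and the dynamical ball is $B_m(x,\varepsilon):=\{y\in X\colon d(T^kx,T^ky)\leq\varepsilon,\ k=0,\ldots,m-1\}$. Definition. Let $\varphi\in C(X)$. A Borel probability measure $\nu$ on $X$ (not assumed $T$-invariant) is a weak Gibbs measure for $\varphi$ if for every $\delta>0$ there exists $\varepsilon_\delta>0$ such that for every $0<\varepsilon\leq\varepsilon_\delta$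 there exists $N_{\delta,\varepsilon}<\infty$ such that for all $m\geq N_{\delta,\varepsilon}$ and all $x\in X$, $$-\delta\leq\frac{1}{m}\ln\nu(B_m(x,\varepsilon))-\int\varphi\,d\mathcal{E}_m(x)\leq\delta\,.$$ Standard conventions: $\ln 0=-\infty$ and $\sup\emptyset=-\infty$. *)

(* Defs.v *)
From HB Require Import structures.
From mathcomp Require Import all_boot all_order all_algebra.
From mathcomp Require Import all_classical all_reals all_analysis.

Set Implicit Arguments.
Unset Strict Implicit.
Unset Printing Implicit Defensive.

Import Order.TTheory GRing.Theory Num.Theory.
Import numFieldNormedType.Exports.

Local Open Scope classical_set_scope.
Local Open Scope ring_scope.

Section measurable_dynamics.
Context d (Y : measurableType d) (R : realType).
Implicit Types (T : Y -> Y) (rho : probability Y R).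

Definition invariant_measure T rho : Prop :=
  forall A : set Y, measurable A -> pushforward rho T A = rho A.

Definition ergodic_measure T rho : Prop :=
  invariant_measure T rho /\
  forall A : set Y, measurable A -> T @^-1` A = A ->
    rho A = 0%E \/ rho A = 1%E.

Definition orbit_measure T (n : nat) (x : Y) : {measure set Y -> \bar R} :=
  msum (fun k => \d_(iter k T x)) n.

(* For n = 0 the normalization defaults to \d_x; see empiricalE for n > 0. *)
Definition empirical T (n : nat) (x : Y) : probability Y R :=
  mnormalize (orbit_measure T n x) (\d_x).

Lemma empiricalE T n x (A : set Y) : (0 < n)%N ->
  empirical T n x A = ((n%:R^-1)%:E * \sum_(k < n) \d_(iter k T x) A)%E.
Proof.
move=> n0; rewrite /empirical /= /mnormalize.
have -> : orbit_measure T n x [set: Y] = n%:R%:E.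
  rewrite /= /msum (eq_bigr (fun=> 1%E)) => [|k _]; last exact: diracT.
  by rewrite sumEFin sumr_const card_ord.
by rewrite eqe pnatr_eq0 eqn0Ngt n0 /= muleC.
Qed.

(* Finite measurable partitions indexed by 'I_k; atoms may be empty. *)
Definition measurable_partition (k : nat) (A : 'I_k -> set Y) : Prop :=
  [/\ forall i, measurable (A i), trivIset [set: 'I_k] A
    & \bigcup_i A i = [set: Y]].

(* The atom with itinerary w of the join of the T^-i A, i < n. *)
Definition join_atom T (k : nat) (A : 'I_k -> set Y) (n : nat)
    (w : {ffun 'I_n -> 'I_k}) : set Y :=
  \bigcap_(i : 'I_n) (iter i T @^-1` A (w i)).

(* No convention is needed for empty atoms: p * ln p = 0 at p = 0. *)
Definition join_entropy T rho (k : nat) (A : 'I_k -> set Y) (n : nat) : R :=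
  - \sum_(w : {ffun 'I_n -> 'I_k})
      fine (rho (join_atom T A w)) * ln (fine (rho (join_atom T A w))).

Definition partition_entropy T rho (k : nat) (A : 'I_k -> set Y) : \bar R :=
  limn (fun n => (n%:R^-1 * join_entropy T rho A n)%:E).

Definition ks_entropy T rho : \bar R :=
  ereal_sup [set h | exists k (A : 'I_k -> set Y),
                       measurable_partition A /\ h = partition_entropy T rho A].

End measurable_dynamics.

(* Measurable types are pointed in the library. The base point carries no
   information here: a space with a probability measure is nonempty. *)
#[short(type="pointedMetricType")]
HB.structure Definition PointedMetric (R : numDomainType) :=
  {M of Metric R M & isPointed M}.

Definition borel (R : realType) (X : pointedMetricType R) :
    measurableType (@open X).-sigma :=
  g_sigma_algebraType (@open X).

Definition Cont (R : realType) (X : pointedMetricType R) :=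
  {f : X -> R | continuous f}.

Definition integrals (R : realType) (X : pointedMetricType R)
    (mu : probability (borel X) R) : prod_topology (fun _ : Cont X => R) :=
  fun f => \int[mu]_x (sval f x).

(* The Borel probability measures with the weak convergence topology, i.e. the
   coarsest topology making mu |-> \int f dmu continuous for all f in C(X). *)
Definition M1 (R : realType) (X : pointedMetricType R) : topologicalType :=
  initial_topology (@integrals R X).

Section metric_dynamics.
Context (R : realType) (X : pointedMetricType R).
Implicit Types (T : X -> X) (nu : probability (borel X) R).

Definition M1_inv T : set (M1 X) :=
  [set rho : probability (borel X) R |
    @invariant_measure _ (borel X) R T rho].

(* Convex combinations are specified by their values on Borel sets because a
   library measure also takes values, without meaning, on other sets. *)
Definition convex_measures (F : set (M1 X)) : Prop :=
  forall (mu1 mu2 mu : probability (borel X) R) (t : R),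
    F mu1 -> F mu2 -> 0 <= t <= 1 ->
    (forall A : set (borel X), measurable A ->
      mu A = t%:E * mu1 A + (1 - t)%:E * mu2 A)%E ->
    F mu.

Definition dyn_ball T (m : nat) (x : X) (eps : R) : set X :=
  [set y | forall k, (k < m)%N -> mdist (iter k T x) (iter k T y) <= eps].

Definition weak_gibbs T (phi : X -> R) nu : Prop :=
  forall delta : R, 0 < delta ->
  exists2 eps_delta : R, 0 < eps_delta &
  forall eps : R, 0 < eps <= eps_delta ->
  exists N : nat, forall m, (N <= m)%N -> forall x : X,
    (- delta%:E <= (m%:R^-1)%:E * lne (nu (dyn_ball T m x eps))
        - (\int[@empirical _ (borel X) R T m x]_y phi y)%:E
      <= delta%:E)%E.

(* lne 0 = -oo, as needed here. *)
Definition ldp_rate T nu (C : set (M1 X)) (m : nat) : \bar R :=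
  ((m%:R^-1)%:E *
   lne (nu [set x | C (@empirical _ (borel X) R T m x)]))%E.

End metric_dynamics.

(* Main.v *)
(* Upper bound: the Gibbs balls around a maximal (m, e)-separated set cover the
   points whose empirical measure lies in F, so the rate is bounded by the
   logarithm of the total weight of this set for the weights exp (S_m phi),
   which is an entropy plus an energy. By convexity the weighted average of the
   empirical measures is in F. Misiurewicz's argument bounds the entropy of the
   weights by block entropies of this average with respect to a partition with
   null boundaries; a limit along an ultrafilter then gives the invariant
   measure in F.
   Lower bound: by ergodicity most points have an empirical measure near rho,
   and a Katok-type estimate shows that such a set of points contains about
   exp (m h) points whose Gibbs balls are disjoint and stay in G.
   Both entropy estimates, as well as the subadditivity of the entropy of a
   partition, are single applications of Gibbs' inequality
   - sum p ln p <= - sum p ln Q to suitable product or mixture measures Q on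
   words, so neither the Shannon-McMillan-Breiman theorem nor conditional
   entropies are needed. *)

Require Import Defs.
From HB Require Import structures.
From mathcomp Require Import all_boot all_order all_algebra.
From mathcomp Require Import all_classical all_reals all_analysis.
From mathcomp Require Import measurable_realfun ring lra zify.

Set Implicit Arguments.
Unset Strict Implicit.
Unset Printing Implicit Defensive.

Import Order.TTheory GRing.Theory Num.Theory.
Import numFieldNormedType.Exports.

Local Open Scope classical_set_scope.
Local Open Scope ring_scope.

(** * Gibbs' inequality and words *)

(** An ultrafilter limit exists on every Borel set at once and preserves finite sums, block laws and
    asymptotic invariance; the price is that it is only finitely additive. Two objects therefore
    coexist in the upper bound: the limit [lam], which carries the invariance and the block
    probabilities, and a genuine measure, which carries the integrals. They agree on continuity
    sets, hence the condition on boundaries. One scale is enough there: for a given delta the weak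
    Gibbs property fixes e, and as the entropy is a supremum over partitions, a single partition of
    mesh at most e bounds it from below. In the lower bound the partition is arbitrary, so nearby
    points may have different letters. Inner regularity confines this to a set of small measure,
    which typical orbits visit rarely. Typical points of one dynamical ball then have itineraries
    that are close in Hamming distance, and the noise th in the comparison measure pays for the
    mismatches. Ergodicity enters through the convergence of Birkhoff averages in probability,
    derived from the maximal inequality. *)

Section gibbs.
Context {R : realType}.

(** Termwise [ln t <= t - 1] at [t = q i / p i]. The total mass of [q] may be below 1 because [q]
    will be a measure on all words, summed over the words that occur. Real [ln] vanishes at 0, so
    zeros of [q] where [p] is positive are excluded by hypothesis. *)
Lemma gibbs_inequality (I : finType) (p q : I -> R) :
  (forall i, 0 <= p i) -> \sum_i p i = 1 ->
  (forall i, 0 <= q i) -> \sum_i q i <= 1 ->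
  (forall i, 0 < p i -> 0 < q i) ->
  - \sum_i p i * ln (p i) <= - \sum_i p i * ln (q i).
Proof.
move=> p0 p1 q0 q1 pq; rewrite lerN2 -subr_le0 -sumrB.
apply: (@le_trans _ _ (\sum_i (q i - p i))); last by rewrite sumrB p1 subr_le0.
apply: ler_sum => i _.
have := p0 i; rewrite le_eqVlt => /predU1P[<-|pi0].
  by rewrite !mul0r subrr subr0.
have qi0 := pq _ pi0.
rewrite -mulrBr -ln_div ?posrE//.
have t0 : 0 < q i / p i by rewrite divr_gt0.
have : ln (q i / p i) <= q i / p i - 1.
  have := expR_ge1Dx (ln (q i / p i)).
  by rewrite lnK ?posrE// => h; rewrite lerBrDl.
move=> /(ler_wpM2l (ltW pi0)) /le_trans; apply.
by rewrite mulrBr mulr1 mulrCA divff ?mulr1// gt_eqF.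
Qed.

End gibbs.

(** * Words and block product measures *)

Section words.
Context {R : realType} {L : finType} (a0 : L).
Implicit Types (u : nat -> L).

(** Padding by [a0] turns a word into a sequence, so that windows at any offset are read without
    arithmetic on ordinal types. *)
Definition extend_word n (w : {ffun 'I_n -> L}) : nat -> L :=
  fun i => if insub i is Some j then w j else a0.

Definition word_at s n u : {ffun 'I_n -> L} := [ffun i : 'I_n => u (s + i)%N].

Definition cat_words q n (v : {ffun 'I_q -> L}) (w : {ffun 'I_n -> L}) :
    {ffun 'I_(q + n) -> L} :=
  [ffun i => match fintype.split i with inl j => v j | inr j => w j end].

Lemma extend_wordE n (w : {ffun 'I_n -> L}) (i : 'I_n) : extend_word w i = w i.
Proof. by rewrite /extend_word valK. Qed.

Lemma extend_cat_words_l q n (v : {ffun 'I_q -> L}) (w : {ffun 'I_n -> L}) i :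
  (i < q)%N -> extend_word (cat_words v w) i = extend_word v i.
Proof.
move=> iq; rewrite /extend_word.
have iqn : (i < q + n)%N by exact: ltn_addr.
rewrite !insubT ffunE; case: splitP => /= j ij.
  by congr (v _); apply: val_inj.
by exfalso; move: (iq); rewrite ij ltnNge leq_addr.
Qed.

Lemma extend_cat_words_r q n (v : {ffun 'I_q -> L}) (w : {ffun 'I_n -> L}) i :
  (i < n)%N -> extend_word (cat_words v w) (q + i) = extend_word w i.
Proof.
move=> i_n; rewrite /extend_word.
have iqn : (q + i < q + n)%N by rewrite ltn_add2l.
rewrite !insubT ffunE; case: splitP => /= j.
  by move=> ij; have := ltn_ord j; rewrite -ij ltnNge leq_addr.
by move=> /addnI ij; congr (w _); apply: val_inj.
Qed.

Lemma sum_cat_words q n (F : {ffun 'I_(q + n) -> L} -> R) :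
  \sum_w F w = \sum_v \sum_w F (cat_words v w).
Proof.
rewrite pair_bigA /=.
rewrite (reindex (fun p : {ffun 'I_q -> L} * {ffun 'I_n -> L} =>
  cat_words p.1 p.2)) //=.
exists (fun w => ([ffun i => w (lshift n i)], [ffun i => w (rshift q i)])).
- move=> [v w] _ /=; congr pair; apply/ffunP => i; rewrite !ffunE.
    by rewrite -[lshift n i]/(unsplit (inl i)) unsplitK.
  by rewrite -[rshift q i]/(unsplit (inr i)) unsplitK.
- move=> w _ /=; apply/ffunP => i; rewrite ffunE.
  rewrite -{2}[i]splitK; case: fintype.split => j /=; by rewrite ffunE.
Qed.

Definition word_sum n (F : (nat -> L) -> R) : R :=
  \sum_(w : {ffun 'I_n -> L}) F (extend_word w).

(* The product measure with marginal P on consecutive blocks of length q,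
   completed by the uniform measure on the last n %% q letters. *)
Definition block_prob q (P : {ffun 'I_q -> L} -> R) n u : R :=
  (#|L|%:R^-1) ^+ (n %% q) * \prod_(r < n %/ q) P (word_at (r * q) q u).

Lemma card_letters_gt0 : 0 < #|L|%:R :> R.
Proof. by rewrite ltr0n; apply/card_gt0P; exists a0. Qed.

Section block.
Variables (q : nat) (P : {ffun 'I_q -> L} -> R).
Hypotheses (q0 : (0 < q)%N) (P0 : forall v, 0 <= P v) (P1 : \sum_v P v = 1).

Let c0 := card_letters_gt0.

Lemma block_prob_small n u : (n < q)%N -> block_prob P n u = #|L|%:R^-1 ^+ n.
Proof. by move=> nq; rewrite /block_prob modn_small// divn_small// big_ord0 mulr1. Qed.

Lemma block_probD n u : block_prob P (q + n) u =
  P (word_at 0 q u) * block_prob P n (fun i => u (q + i)%N).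
Proof.
rewrite /block_prob modnDl divnDl ?dvdnn// divnn q0 add1n big_ord_recl /=.
rewrite mul0n mulrCA; congr (_ * (_ * _)).
apply: eq_bigr => r _; congr P; apply/ffunP => i; rewrite !ffunE.
by rewrite /bump /= add1n mulSn addnA.
Qed.

Lemma eq_block_prob n u u' : (forall i, (i < n)%N -> u i = u' i) ->
  block_prob P n u = block_prob P n u'.
Proof.
move=> uu'; rewrite /block_prob; congr (_ * _).
apply: eq_bigr => r _; congr P; apply/ffunP => i; rewrite !ffunE uu'//.
rewrite (@leq_trans (r.+1 * q))//; first by rewrite mulSn addnC ltn_add2r.
by rewrite (leq_trans _ (leq_divM n q))// leq_mul2r ltn_ord orbT.
Qed.

Lemma block_prob_ge0 n u : 0 <= block_prob P n u.
Proof.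
apply: mulr_ge0; first by apply: exprn_ge0; rewrite invr_ge0 ltW.
by apply: prodr_ge0 => r _; exact: P0.
Qed.

Lemma word_sum_block_prob n : word_sum n (block_prob P n) = 1.
Proof.
elim/ltn_ind: n => n ih; have [nq|qn] := ltnP n q.
  rewrite /word_sum (eq_bigr (fun=> #|L|%:R^-1 ^+ n)); last first.
    by move=> w _; rewrite block_prob_small.
  rewrite sumr_const card_ffun card_ord -[LHS]mulr_natr natrX -exprMn mulVf ?gt_eqF//.
  by rewrite expr1n.
rewrite -(subnKC qn) /word_sum sum_cat_words.
rewrite -[RHS]P1; apply: eq_bigr => v _.
rewrite (eq_bigr (fun w => P v * block_prob P (n - q) (extend_word w))).
  rewrite -mulr_sumr -/(word_sum _ _) ih ?mulr1//.
  by rewrite ltn_subrL q0 (leq_trans q0 qn).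
move=> w _; rewrite block_probD; congr (P _ * _).
  by apply/ffunP => i; rewrite ffunE add0n extend_cat_words_l// extend_wordE.
by apply: eq_block_prob => i ?; rewrite extend_cat_words_r.
Qed.

(** Uniform on the first [j] and the last [d] letters, block measure on the [n] letters between. The
    last [d] letters help to identify a word, but no window of the statistics starts there. *)
Definition shifted_block_prob j n d u : R :=
  #|L|%:R^-1 ^+ (j + d) * block_prob P n (fun i => u (j + i)%N).

Lemma shifted_block_prob_ge0 j n d u : 0 <= shifted_block_prob j n d u.
Proof.
apply: mulr_ge0; last exact: block_prob_ge0.
by apply: exprn_ge0; rewrite invr_ge0 ltW.
Qed.

Lemma word_sum_shifted_block_prob j n d :
  word_sum (j + (n + d)) (shifted_block_prob j n d) = 1.
Proof.
rewrite /word_sum sum_cat_words.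
have h (w : {ffun 'I_j -> L}) : \sum_(x : {ffun 'I_(n + d) -> L})
    shifted_block_prob j n d (extend_word (cat_words w x)) = #|L|%:R^-1 ^+ j.
  rewrite sum_cat_words.
  rewrite (eq_bigr (fun v => #|L|%:R^-1 ^+ j * block_prob P n (extend_word v))).
    by rewrite -mulr_sumr -/(word_sum _ _) word_sum_block_prob mulr1.
  move=> v _; rewrite (eq_bigr (fun=> #|L|%:R^-1 ^+ (j + d) *
      block_prob P n (extend_word v))).
    rewrite sumr_const card_ffun card_ord -[LHS]mulr_natl natrX exprD -mulrA mulrCA.
    by rewrite [X in _ * X]mulrA -exprMn divff ?gt_eqF// expr1n mul1r.
  move=> x _; rewrite /shifted_block_prob; congr (_ * _).
  apply: eq_block_prob => i ni.
  by rewrite extend_cat_words_r ?ltn_addr// extend_cat_words_l.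
rewrite (eq_bigr _ (fun w _ => h w)) sumr_const card_ffun card_ord.
by rewrite -[LHS]mulr_natl natrX -exprMn divff ?gt_eqF// expr1n.
Qed.

Lemma block_prob_gt0 n u :
  (forall s, (s + q <= n)%N -> 0 < P (word_at s q u)) -> 0 < block_prob P n u.
Proof.
move=> h; apply: mulr_gt0; first by rewrite exprn_gt0// invr_gt0.
apply: prodr_gt0 => r _; apply: h.
by rewrite addnC -mulSn (leq_trans _ (leq_divM n q))// leq_mul2r ltn_ord orbT.
Qed.

(** Telescoping in [m]: moving [u] by one letter turns the shifts 1..q into 0..q-1, so the sum
    changes by the term of shift 0 minus that of shift [q], which is [- ln P] of the first window.
    The incomplete blocks cost at most [q] uniform letters for each of the [q] shifts. *)
Lemma sum_ln_block_prob m u :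
  (forall s, (s < m)%N -> 0 < P (word_at s q u)) ->
  \sum_(j < q) - ln (block_prob P (m - j) (fun i => u (j + i)%N)) <=
  (\sum_(s < m) - ln (P (word_at s q u))) + (q * q)%:R * ln #|L|%:R.
Proof.
have L1 : 0 <= ln (#|L|%:R : R).
  by apply: ln_ge0; rewrite ler1n; apply/card_gt0P; exists a0.
have P_le1 v : P v <= 1.
  by rewrite -P1 (bigD1 v)//= lerDl sumr_ge0.
elim: m u => [|m ih] u Ppos.
  rewrite big_ord0 add0r (@le_trans _ _ 0)//; last by rewrite mulr_ge0.
  by rewrite big1// => j _; rewrite sub0n block_prob_small// expr0 ln1 oppr0.
have Psh s : (s < m)%N -> 0 < P (word_at s q (fun i => u i.+1)).
  move=> sm; have -> : word_at s q (fun i => u i.+1) = word_at s.+1 q u.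
    by apply/ffunP => i; rewrite !ffunE.
  exact: Ppos.
have {}ih := ih _ Psh.
have [mq|qm] := ltnP m.+1 q.
  apply: (@le_trans _ _ ((q * q)%:R * ln #|L|%:R)); last first.
    by rewrite lerDr sumr_ge0// => s _; rewrite oppr_ge0 ln_le0.
  have -> : (q * q)%:R * ln (#|L|%:R : R) = \sum_(j < q) q%:R * ln #|L|%:R.
    by rewrite sumr_const card_ord natrM -[RHS]mulr_natl mulrA.
  apply: ler_sum => j _.
  have jq : (m.+1 - j < q)%N by rewrite (leq_ltn_trans (leq_subr _ _)).
  rewrite block_prob_small// exprVn lnV ?posrE ?exprn_gt0// opprK lnXn//.
  by rewrite -[leLHS]mulr_natl ler_wpM2r// ler_nat ltnW.
rewrite big_ord_recl -addrA.
have {}ih : \sum_(j < q) - ln (block_prob P (m - j) (fun i => u (j + i).+1)) <=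
    \sum_(i < m) - ln (P (word_at (lift ord0 i) q u)) + (q * q)%:R * ln #|L|%:R.
  exact: ih.
apply: le_trans (lerD (lexx _) ih).
set g := fun j => - ln (block_prob P (m.+1 - j) (fun i => u (j + i)%N)).
have -> : \sum_(i < q) - ln (block_prob P (m - i) (fun j => u (i + j).+1)) =
    \sum_(i < q) g i.+1.
  by apply: eq_bigr => j _; rewrite /g subSS.
have eqg : \sum_(j < q) g j + g q = g 0%N + \sum_(i < q) g i.+1.
  by rewrite -(big_ord_recr q (fun i : 'I_q.+1 => g i)) big_ord_recl /=.
have -> : \sum_(j < q) g j = (- g q + g 0%N) + \sum_(i < q) g i.+1.
  by rewrite -addrA -eqg addrC addrK.
rewrite lerD2r /g subn0.
have -> : (fun i : nat => u (0 + i)%N) = u by apply/funext.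
rewrite -{2}(subnKC qm) block_probD lnM ?posrE//; first last.
- apply: block_prob_gt0 => s sn.
  have -> : word_at s q (fun i => u (q + i)%N) = word_at (q + s) q u.
    by apply/ffunP => i; rewrite !ffunE addnA.
  by apply: Ppos; lia.
- exact: Ppos.
- by rewrite opprK opprD addrCA subrr addr0.
Qed.

Lemma sum_ln_shifted_block_prob m M u : (q <= m)%N -> (m <= M)%N ->
  (forall s, (s < m)%N -> 0 < P (word_at s q u)) ->
  \sum_(j < q) - ln (shifted_block_prob j (m - j) (M - m) u) <=
  (\sum_(s < m) - ln (P (word_at s q u))) +
    q%:R * (2 * q%:R + (M - m)%:R) * ln #|L|%:R.
Proof.
move=> qm mM Ppos.
have L1 : 0 <= ln (#|L|%:R : R).
  by apply: ln_ge0; rewrite ler1n; apply/card_gt0P; exists a0.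
have := sum_ln_block_prob Ppos.
have -> : \sum_(j < q) - ln (shifted_block_prob j (m - j) (M - m) u) =
  \sum_(j < q) (j + (M - m))%:R * ln #|L|%:R +
  \sum_(j < q) - ln (block_prob P (m - j) (fun i => u (j + i)%N)).
  rewrite -big_split /=; apply: eq_bigr => j _; rewrite /shifted_block_prob lnM.
  - by rewrite opprD exprVn lnV ?posrE ?exprn_gt0// lnXn// opprK mulr_natl.
  - by rewrite posrE exprn_gt0// invr_gt0.
  - rewrite posrE; apply: block_prob_gt0 => s sn.
    have -> : word_at s q (fun i => u (j + i)%N) = word_at (j + s) q u.
      by apply/ffunP => i; rewrite !ffunE addnA.
    by apply: Ppos; have := ltn_ord j; lia.
have : \sum_(j < q) (j + (M - m))%:R * ln #|L|%:R <=
   q%:R * (q%:R + (M - m)%:R) * ln (#|L|%:R : R).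
  rewrite -mulr_suml ler_wpM2r//.
  have -> : q%:R * (q%:R + (M - m)%:R) = \sum_(j < q) (q + (M - m))%:R :> R.
    by rewrite sumr_const card_ord natrD -[RHS]mulr_natl.
  by apply: ler_sum => j _; rewrite ler_nat leq_add2r ltnW.
rewrite natrM; nra.
Qed.

End block.

(* Gibbs' inequality against the q shifted block measures, averaged over the
   shift: every window of length q then occurs once with weight 1/q. *)
Lemma block_entropy (I : finType) (p : I -> R) (u_ : I -> nat -> L) (m M q : nat)
    (P : {ffun 'I_q -> L} -> R) :
  (0 < q)%N -> (q <= m)%N -> (m <= M)%N ->
  (forall i, 0 <= p i) -> \sum_i p i = 1 ->
  (forall i i', (forall s, (s < M)%N -> u_ i s = u_ i' s) -> i = i') ->
  (forall v, P v = m%:R^-1 * \sum_(s < m) \sum_(i | word_at s q (u_ i) == v) p i) ->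
  - \sum_i p i * ln (p i) <=
  m%:R / q%:R * (- \sum_v P v * ln (P v)) +
    (2 * q%:R + (M - m)%:R) * ln #|L|%:R.
Proof.
move=> q0 qm mM p0 p1 uinj PE.
have m0 : (0 < m)%N by exact: leq_trans qm.
have mR0 : 0 < m%:R :> R by rewrite ltr0n.
have qR0 : 0 < q%:R :> R by rewrite ltr0n.
have P0 v : 0 <= P v.
  by rewrite PE mulr_ge0 ?invr_ge0// sumr_ge0// => s _; rewrite sumr_ge0.
(* Integrating against [P] is averaging over a random index and a uniform window start. *)
have avg (h : {ffun 'I_q -> L} -> R) :
    \sum_v P v * h v = m%:R^-1 * \sum_i p i * \sum_(s < m) h (word_at s q (u_ i)).
  under eq_bigr do rewrite PE -mulrA mulr_suml.
  rewrite -mulr_sumr; congr (_ * _); rewrite exchange_big /=.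
  under [RHS]eq_bigr do rewrite mulr_sumr.
  rewrite [RHS]exchange_big /=; apply: eq_bigr => s _.
  rewrite [RHS](partition_big (fun i => word_at s q (u_ i)) predT)//=.
  apply: eq_bigr => v _; rewrite mulr_suml.
  by apply: eq_bigr => i /eqP ->.
have P1 : \sum_v P v = 1.
  have := avg (fun=> 1).
  rewrite (eq_bigr P) => [->|v _]; last by rewrite mulr1.
  rewrite sumr_const card_ord -mulr_suml p1 mul1r mulVf// gt_eqF//.
have Ppos i s : 0 < p i -> (s < m)%N -> 0 < P (word_at s q (u_ i)).
  move=> pi0 sm; rewrite PE mulr_gt0 ?invr_gt0//.
  rewrite (bigD1 (Ordinal sm))//= ltr_pwDl//; last first.
    by rewrite sumr_ge0// => *; rewrite sumr_ge0.
  by rewrite (bigD1 i)//= ltr_pwDl// sumr_ge0.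
have gibbs_j (j : 'I_q) : - \sum_i p i * ln (p i) <=
    - \sum_i p i * ln (shifted_block_prob P j (m - j) (M - m) (u_ i)).
  have Meq : (j + ((m - j) + (M - m)) = M)%N by have := ltn_ord j; lia.
  apply: gibbs_inequality => //.
  - by move=> i; exact: shifted_block_prob_ge0.
  - rewrite -(@word_sum_shifted_block_prob q P q0 P1 j (m - j) (M - m)).
    rewrite Meq /word_sum.
    (* Distinct indices give distinct words of length [M], so the sum over indices is part of the
       total mass 1 of the word measure. *)
    pose f (i : I) : {ffun 'I_M -> L} := word_at 0 M (u_ i).
    have finj : injective f.
      move=> i i' /ffunP ff; apply: uinj => s sM.
      by have := ff (Ordinal sM); rewrite !ffunE.
    rewrite [leRHS](bigID [in f @: [set: I]]%SET) /= ler_wpDr//.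
      by apply: sumr_ge0 => w _; exact: shifted_block_prob_ge0.
    rewrite big_imset/=; last by move=> ? ? _ _; exact: finj.
    rewrite [leRHS](eq_bigl predT); last by move=> i; rewrite inE.
    apply: ler_sum => i _; rewrite /shifted_block_prob.
    rewrite (@eq_block_prob _ _ _ _ (fun k => extend_word (f i) (j + k)))//.
    move=> k km; have jk : (j + k < M)%N by lia.
    by rewrite -[(j + k)%N]/(nat_of_ord (Ordinal jk)) extend_wordE ffunE.
  - move=> i pi0; apply: mulr_gt0.
      by rewrite exprn_gt0// invr_gt0 card_letters_gt0.
    apply: block_prob_gt0 => s sn.
    have -> : word_at s q (fun k => u_ i (j + k)%N) = word_at (j + s) q (u_ i).
      by apply/ffunP => k; rewrite !ffunE addnA.
    by apply: Ppos => //; lia.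
have : q%:R * (- \sum_i p i * ln (p i)) <=
    \sum_i p i * \sum_(j < q) - ln (shifted_block_prob P j (m - j) (M - m) (u_ i)).
  under [leRHS]eq_bigr do rewrite mulr_sumr.
  have -> : q%:R * (- \sum_i p i * ln (p i)) = \sum_(j < q) (- \sum_i p i * ln (p i)).
    by rewrite sumr_const card_ord -[RHS]mulr_natl.
  rewrite exchange_big /=; apply: ler_sum => j _; apply: (le_trans (gibbs_j j)).
  by rewrite -sumrN; apply: ler_sum => i _; rewrite mulrN.
have : \sum_i p i * \sum_(j < q) - ln (shifted_block_prob P j (m - j) (M - m) (u_ i)) <=
    m%:R * (- \sum_v P v * ln (P v)) + q%:R * (2 * q%:R + (M - m)%:R) * ln #|L|%:R.
  rewrite -sumrN; under [X in _ <= _ * X + _]eq_bigr do rewrite -mulrN.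
  rewrite avg mulrA divff ?gt_eqF// mul1r.
  set C := (X in _ <= _ + X).
  have -> : C = \sum_i p i * C by rewrite -mulr_suml p1 mul1r.
  rewrite -big_split /=; apply: ler_sum => i _.
  rewrite -mulrDr; have := p0 i; rewrite le_eqVlt => /predU1P[<-|pi0].
    by rewrite !mul0r.
  rewrite ler_wpM2l//; apply: sum_ln_shifted_block_prob => // s sm.
  exact: Ppos.
move=> /[swap] /le_trans /[apply].
rewrite -ler_pdivlMl// => /le_trans; apply.
rewrite mulrDr mulrA [_^-1 * _]mulrC lerD2l !mulrA mulVf ?gt_eqF// mul1r//.
Qed.

End words.

(** * Itineraries and the entropy of a partition *)

Section finite_probability.
Context d (Y : measurableType d) {R : realType} (rho : probability Y R).

Definition prob (A : set Y) : R := fine (rho A).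

Lemma probE A : measurable A -> rho A = (prob A)%:E.
Proof. by move=> mA; rewrite /prob fineK// fin_num_measure. Qed.

Lemma prob_ge0 A : 0 <= prob A.
Proof. by rewrite /prob fine_ge0. Qed.

Lemma prob_setT : prob setT = 1.
Proof. by rewrite /prob probability_setT. Qed.

Lemma prob_set0 : prob set0 = 0.
Proof. by rewrite /prob measure0. Qed.

Lemma le_prob A B : measurable A -> measurable B -> A `<=` B -> prob A <= prob B.
Proof.
by move=> mA mB AB; rewrite -lee_fin -!probE// le_measure ?inE.
Qed.

Lemma prob_le1 A : measurable A -> prob A <= 1.
Proof. by move=> mA; rewrite -prob_setT; exact: le_prob. Qed.

Lemma prob_setC A : measurable A -> prob (~` A) = 1 - prob A.
Proof.
move=> mA; apply: EFin_inj; rewrite -probE; last exact: measurableC.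
by rewrite probability_setC// EFinB probE.
Qed.

Lemma prob_setU A B : measurable A -> measurable B ->
  prob (A `|` B) <= prob A + prob B.
Proof.
move=> mA mB; rewrite -lee_fin EFinD -!probE//; last exact: measurableU.
exact: measureU2.
Qed.

Lemma prob_fibers (I : finType) (f : Y -> I) (Q : pred I) :
  (forall i, measurable (f @^-1` [set i])) ->
  prob [set x | Q (f x)] = \sum_(i | Q i) prob (f @^-1` [set i]).
Proof.
move=> mf; apply: EFin_inj; rewrite -sumEFin.
under eq_bigr do rewrite -probE//.
have QE : [set x | Q (f x)] = \bigcup_(i in [set` Q]) f @^-1` [set i].
  by apply/seteqP; split=> [x Qx|x [i Qi /= ->]//]; exists (f x).
have finQ : finite_set [set` Q].
  exact: finite_finset.
rewrite -probE; last by rewrite QE; apply: fin_bigcup_measurable.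
rewrite QE measure_fin_bigcup//.
  by apply/esym/bigfs; [exact: index_enum_uniq|move=> i _; rewrite mem_index_enum].
by move=> i j _ _ [x [/= -> ->]].
Qed.

Lemma measurable_fibers (I : finType) (f : Y -> I) (Q : pred I) :
  (forall i, measurable (f @^-1` [set i])) -> measurable [set x | Q (f x)].
Proof.
move=> mf.
have -> : [set x | Q (f x)] = \bigcup_(i in [set` Q]) f @^-1` [set i].
  by apply/seteqP; split=> [x Qx|x [i Qi /= ->]//]; exists (f x).
exact: fin_bigcup_measurable.
Qed.

End finite_probability.

Section itineraries.
Context (Y : Type) (L : finType) (a : Y -> L) (T : Y -> Y).

Definition itinerary (x : Y) : nat -> L := fun i => a (iter i T x).

Lemma word_at_itinerary s n x :
  word_at s n (itinerary x) = word_at 0 n (itinerary (iter s T x)).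
Proof. by apply/ffunP => i; rewrite !ffunE /itinerary addnC iterD. Qed.

End itineraries.

Section measurable_itineraries.
Context d (Y : measurableType d) (L : finType) (a : Y -> L) (T : Y -> Y).
Hypotheses (ma : forall l, measurable (a @^-1` [set l]))
  (mT : measurable_fun setT T).

Lemma measurable_iter n : measurable_fun setT (iter n T).
Proof.
elim: n => [|n ih]; first exact: measurable_id.
by rewrite (_ : iter n.+1 T = T \o iter n T)//; exact: measurableT_comp.
Qed.

Lemma measurable_word n (w : {ffun 'I_n -> L}) :
  measurable [set x | word_at 0 n (itinerary a T x) = w].
Proof.
have -> : [set x | word_at 0 n (itinerary a T x) = w] =
    \bigcap_(i in [set: 'I_n]) iter i T @^-1` (a @^-1` [set w i]).
  apply/seteqP; split=> [x /= <- i _|x xw /=]; first by rewrite /= ffunE.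
  by apply/ffunP => i; rewrite ffunE; exact: xw.
apply: fin_bigcap_measurable => // i _.
by rewrite -[X in measurable X]setTI; exact: measurable_iter.
Qed.

End measurable_itineraries.

(** * Convergence of the entropy of a partition *)

Section invariant_entropy.
Context d (Y : measurableType d) {R : realType} (rho : probability Y R).
Context (T : Y -> Y) (mT : measurable_fun setT T) (invT : invariant_measure T rho).

Lemma prob_preimage_iter n A : measurable A -> prob rho (iter n T @^-1` A) = prob rho A.
Proof.
move=> mA; elim: n => // n ih.
rewrite -{}ih (_ : iter n.+1 T @^-1` A = T @^-1` (iter n T @^-1` A)); last first.
  by apply/seteqP; split => x /=; rewrite -iterSr.
have mnA : measurable (iter n T @^-1` A).
  by rewrite -[X in measurable X]setTI; exact: measurable_iter.
by rewrite /prob -[in RHS](invT mnA).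
Qed.

Variables (k : nat) (A : 'I_k -> set Y).
Hypothesis partA : measurable_partition A.

Lemma partition_letter : exists a : Y -> 'I_k, forall i, A i = a @^-1` [set i].
Proof.
have [_ tA cA] := partA.
have h x : exists i, A i x.
  by have : [set: Y] x by []; rewrite -cA => -[i _ ?]; exists i.
have [a aE] := choice h; exists a => i.
apply/seteqP; split=> [x Aix|x /= <-//].
by apply: (tA _ _ I I); exists x.
Qed.

Lemma join_atomE (a : Y -> 'I_k) n (w : {ffun 'I_n -> 'I_k}) :
  (forall i, A i = a @^-1` [set i]) ->
  join_atom T A w = [set x | word_at 0 n (itinerary a T x) = w].
Proof.
move=> aE; apply/seteqP; split=> [x xw /=|x /= <- i _].
  apply/ffunP => i; rewrite ffunE add0n.
  by have := xw i I; rewrite /= aE.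
by rewrite /= aE /= ffunE add0n.
Qed.

(** [block_entropy] for the law of the itinerary: by invariance every window has law [p q]. The
    words have [m + q] letters so that every window starting before [m] fits; this makes
    [2 q + q = 3 q] error letters. *)
Lemma join_entropy_block m q : (0 < q)%N -> (q <= m)%N ->
  join_entropy T rho A (m + q) <=
  m%:R / q%:R * join_entropy T rho A q + 3 * q%:R * ln k%:R.
Proof.
move=> q0 qm; have [a aE] := partition_letter.
have mA i : measurable (a @^-1` [set i]) by rewrite -aE; case: partA.
pose p n (w : {ffun 'I_n -> 'I_k}) :=
  prob rho [set x | word_at 0 n (itinerary a T x) = w].
have HE n : join_entropy T rho A n = - \sum_w p n w * ln (p n w).
  rewrite /join_entropy; congr (- _); apply: eq_bigr => w _.
  by rewrite (join_atomE _ aE).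
pose a0 := a point.
have := @block_entropy R _ a0 _ (p (m + q)%N) (@extend_word _ a0 _) m (m + q) q (p q) q0 qm.
rewrite !HE addKn card_ord (_ : 2 * q%:R + q%:R = 3 * q%:R); last first.
  by ring.
move=> /(_ (leq_addr _ _)); apply.
- by move=> w; exact: prob_ge0.
- have := @prob_fibers _ _ _ rho _ (fun x => word_at 0 (m + q) (itinerary a T x)) predT.
  rewrite /p => <-; last by move=> i; exact: measurable_word.
  by rewrite (_ : [set x | _] = setT) ?prob_setT//; apply/seteqP; split.
- move=> w w' ww'; apply/ffunP => i.
  by have := ww' _ (ltn_ord i); rewrite !extend_wordE.
- move=> v.
  have m0 : m%:R != 0 :> R by rewrite pnatr_eq0 -lt0n (leq_trans q0).
  apply: (mulfI m0); rewrite mulrA divff// mul1r mulr_natl.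
  rewrite -[in LHS](card_ord m) -sumr_const; apply: eq_bigr => s _.
  rewrite /p -(@prob_fibers _ _ _ rho _ (fun x => word_at 0 (m + q) (itinerary a T x))
    (fun w => word_at s q (extend_word a0 w) == v)); last first.
    by move=> i; exact: measurable_word.
  rewrite -(@prob_preimage_iter s); last exact: measurable_word.
  congr (prob _ _); apply/seteqP; split=> x /=; rewrite -word_at_itinerary.
    move=> <-; apply/eqP/ffunP => i; rewrite !ffunE.
    have h : (s + i < m + q)%N by have := ltn_ord s; have := ltn_ord i; lia.
    by rewrite -[(s + i)%N]/(nat_of_ord (Ordinal h)) extend_wordE ffunE.
  move=> /eqP <-; apply/ffunP => i; rewrite !ffunE.
  have h : (s + i < m + q)%N by have := ltn_ord s; have := ltn_ord i; lia.
  by rewrite -[(s + i)%N]/(nat_of_ord (Ordinal h)) extend_wordE ffunE.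
Qed.

Lemma join_entropy_ge0 n : 0 <= join_entropy T rho A n.
Proof.
have [a aE] := partition_letter.
have mA i : measurable (a @^-1` [set i]) by rewrite -aE; case: partA.
rewrite /join_entropy oppr_ge0; apply: sumr_le0 => w _.
apply: mulr_ge0_le0; first exact: prob_ge0.
by apply: ln_le0; apply: prob_le1; rewrite (join_atomE _ aE); exact: measurable_word.
Qed.

Lemma letters_gt0 : (0 < k)%N.
Proof. by have [a _] := partition_letter; case: (a point) => i; case: k. Qed.

(** Fekete's argument, with [join_entropy_block] in place of subadditivity: the limit is the
    infimum. The upper bound uses the convergence, the lower bound that the limit is below every
    term. *)
Lemma partition_entropy_cvg : exists l : R,
  [/\ partition_entropy T rho A = l%:E,
    (fun n => n%:R^-1 * join_entropy T rho A n) @ \oo --> l &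
    forall q, (0 < q)%N -> l <= q%:R^-1 * join_entropy T rho A q].
Proof.
set u := fun n => n%:R^-1 * join_entropy T rho A n.
(* At [q = 0] the quotient is 0 by convention and would spoil the infimum. *)
pose E := [set u q | q in [set q | (0 < q)%N]].
have u0 n : 0 <= u n by rewrite /u mulr_ge0// ?join_entropy_ge0.
have lbE : has_lbound E by exists 0 => _ [q _ <-].
have infE q : (0 < q)%N -> inf E <= u q by move=> q0; apply: ge_inf => //; exists q.
suff cu : u @ \oo --> inf E.
  exists (inf E); split=> //.
  rewrite /partition_entropy; apply/cvg_lim => //.
  exact: (cvg_EFin (nearW _ _) cu).
have lnk : 0 <= ln (k%:R : R) by apply: ln_ge0; rewrite ler1n letters_gt0.
apply/cvgrPdist_le => e e0.
have [||_ [q q0 <-] uq] := @inf_adherent _ E (e / 2).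
- by rewrite divr_gt0.
- by split=> //; exists (u 1%N); exists 1%N.
have q0R : 0 < q%:R :> R by rewrite ltr0n.
near=> n.
have n2q : (2 * q <= n)%N by near: n; exists (2 * q)%N.
have n0 : (0 < n)%N by rewrite (leq_trans _ n2q)// muln_gt0.
have n0R : 0 < n%:R :> R by rewrite ltr0n.
have nC : 3 * q%:R * ln k%:R * (e / 2)^-1 <= n%:R :> R.
  near: n; exists (Num.Def.truncn (3 * q%:R * ln k%:R * (e / 2)^-1)).+1 => // n /= hn.
  apply: le_trans (ltW (truncnS_gt _)) _; by rewrite ler_nat.
rewrite ler0_norm; last by rewrite subr_le0 infE.
rewrite opprB lerBlDl.
have qm : (q <= n - q)%N by lia.
have := join_entropy_block q0 qm.
rewrite subnK; last by lia.
have -> : join_entropy T rho A n = n%:R * u n by rewrite /u mulVKf// gt_eqF.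
have -> : join_entropy T rho A q = q%:R * u q by rewrite /u mulVKf// gt_eqF.
rewrite mulrA divfK ?gt_eqF// => h.
have h2 : n%:R * u n <= n%:R * u q + n%:R * (e / 2).
  apply: (le_trans h); apply: lerD.
    by rewrite ler_wpM2r// ler_nat leq_subr.
  by rewrite -ler_pdivrMr// divr_gt0.
have {h2}h3 : u n <= u q + e / 2 by rewrite -(ler_pM2l n0R) mulrDr.
rewrite (splitr e); lra.
Unshelve. all: by end_near. Qed.

End invariant_entropy.

(** * Means of bounded functions *)

Section bounded_mean.
Context d (Y : measurableType d) {R : realType}.
Implicit Types (mu : probability Y R) (f g : Y -> R).

Definition bounded_mfun f :=
  measurable_fun [set: Y] f /\ exists M, forall x, `|f x| <= M.

Lemma bounded_mfun_integrable mu f : bounded_mfun f -> mu.-integrable setT (EFin \o f).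
Proof.
move=> [mf [M fM]]; apply: measurable_bounded_integrable => //.
  by rewrite (le_lt_trans (probability_le1 _ _))// ltry.
exists M; split; first exact: num_real.
by move=> N MN x _; exact: le_trans (fM x) (ltW MN).
Qed.

Lemma bounded_mfun_cst c : bounded_mfun (fun=> c).
Proof. by split; [exact: measurable_cst|exists `|c|]. Qed.

Lemma bounded_mfunD f g : bounded_mfun f -> bounded_mfun g ->
  bounded_mfun (fun x => f x + g x).
Proof.
move=> [mf [M fM]] [mg [N gN]]; split; first exact: measurable_funD.
by exists (M + N) => x; rewrite (le_trans (ler_normD _ _))// lerD.
Qed.

Lemma bounded_mfunZ c f : bounded_mfun f -> bounded_mfun (fun x => c * f x).
Proof.
move=> [mf [M fM]]; split; first exact: measurable_funM.
by exists (`|c| * M) => x; rewrite normrM ler_wpM2l.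
Qed.

Lemma bounded_mfun_sum (I : Type) (r : seq I) (F : I -> Y -> R) :
  (forall i, bounded_mfun (F i)) -> bounded_mfun (fun x => \sum_(i <- r) F i x).
Proof.
move=> bF; elim: r => [|i r ih].
  by under eq_fun do rewrite big_nil; exact: bounded_mfun_cst.
by under eq_fun do rewrite big_cons; exact: bounded_mfunD.
Qed.

Lemma bounded_mfun_indic (A : set Y) : measurable A ->
  bounded_mfun (\1_A : Y -> R).
Proof.
move=> mA; split; first exact: measurable_indic.
by exists 1 => x; rewrite indicE; case: (_ \in _); rewrite ?normr1 ?normr0.
Qed.

Lemma mean_cst mu c : \int[mu]_x c = c.
Proof. by rewrite Rintegral_cst// -[fine _]/(prob mu setT) prob_setT mulr1. Qed.

Lemma meanD mu f g : bounded_mfun f -> bounded_mfun g ->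
  \int[mu]_x (f x + g x) = \int[mu]_x f x + \int[mu]_x g x.
Proof. by move=> bf bg; apply: RintegralD => //; exact: bounded_mfun_integrable. Qed.

Lemma meanZ mu c f : bounded_mfun f -> \int[mu]_x (c * f x) = c * \int[mu]_x f x.
Proof. by move=> bf; apply: RintegralZl => //; exact: bounded_mfun_integrable. Qed.

Lemma mean_sum mu (I : Type) (r : seq I) (F : I -> Y -> R) :
  (forall i, bounded_mfun (F i)) ->
  \int[mu]_x (\sum_(i <- r) F i x) = \sum_(i <- r) \int[mu]_x F i x.
Proof.
move=> bF; elim: r => [|i r ih].
  by under eq_Rintegral do rewrite big_nil; rewrite mean_cst big_nil.
under eq_Rintegral do rewrite big_cons.
by rewrite meanD ?big_cons ?ih//; exact: bounded_mfun_sum.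
Qed.

Lemma le_mean mu f g : bounded_mfun f -> bounded_mfun g ->
  (forall x, f x <= g x) -> \int[mu]_x f x <= \int[mu]_x g x.
Proof.
by move=> bf bg fg; apply: le_Rintegral => //; exact: bounded_mfun_integrable.
Qed.

Lemma mean_indic mu (A : set Y) : measurable A -> \int[mu]_x (\1_A x : R) = prob mu A.
Proof.
move=> mA; rewrite /Rintegral (_ : (fun x => _) = (fun x => (\1_A x)%:E))//.
by rewrite integral_indic// setIT.
Qed.

(** Integer part by counting: the positive integers up to [t] number at most [t] and at least
    [t - 1]. *)
Lemma count_thresholds (N : nat) (t : R) : 0 <= t <= N%:R ->
  \sum_(i < N) (i.+1%:R <= t)%R%:R <= t <= 1 + \sum_(i < N) (i.+1%:R <= t)%R%:R.
Proof.
elim: N t => [|N ih] t /andP[t0 tN].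
  by rewrite big_ord0 addr0 t0 (le_trans tN).
rewrite big_ord_recr /=; have [tN'|Nt] := leP t N%:R.
  have -> : (N.+1%:R <= t) = false.
    by apply/negbTE; rewrite -ltNge (le_lt_trans tN')// ltr_nat.
  by rewrite addr0; apply: ih; rewrite t0.
have -> : \sum_(i < N) (i.+1%:R <= t)%R%:R = N%:R :> R.
  rewrite (eq_bigr (fun=> 1)) ?sumr_const ?card_ord// => i _.
  by rewrite (le_trans _ (ltW Nt))// ler_nat.
have := @natr1 R N; case: (leP N.+1%:R t) => /= h;
  rewrite ?addr0; lra.
Qed.

Definition threshold_set f a c N i : set Y := [set x | a + c * (i.+1%:R / N%:R) <= f x].

Lemma measurable_threshold_set f a c N i :
  measurable_fun [set: Y] f -> measurable (threshold_set f a c N i).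
Proof.
move=> mf; rewrite /threshold_set.
have -> : [set x | a + c * (i.+1%:R / N%:R) <= f x] =
    f @^-1` `[a + c * (i.+1%:R / N%:R), +oo[%classic.
  by apply/seteqP; split=> x /=; rewrite in_itv/= andbT.
rewrite -[X in measurable X]setTI; exact: mf.
Qed.

(* Means are determined, up to c / N, by the measures of finitely many
   superlevel sets: this reduces statements on means to statements on sets. *)
Lemma mean_thresholds mu f a c N : measurable_fun [set: Y] f -> (0 < N)%N -> 0 < c ->
  (forall x, a <= f x <= a + c) ->
  a + c / N%:R * \sum_(i < N) prob mu (threshold_set f a c N i) <= \int[mu]_x f x <=
  a + c / N%:R + c / N%:R * \sum_(i < N) prob mu (threshold_set f a c N i).
Proof.
move=> mf N0 c0 fac.
have NR : 0 < N%:R :> R by rewrite ltr0n.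
have bf : bounded_mfun f.
  split=> //; exists (`|a| + c) => x; have := fac x.
  have := ler_norm a; have := ler_norm (- a); rewrite normrN ler_norml; lra.
have mA i := measurable_threshold_set a c N i mf.
have bs : bounded_mfun (fun x => \sum_(i < N) (\1_(threshold_set f a c N i) x : R)).
  by apply: bounded_mfun_sum => i; exact: bounded_mfun_indic.
have bs' : bounded_mfun (fun x => c / N%:R *
    \sum_(i < N) (\1_(threshold_set f a c N i) x : R)) by exact: bounded_mfunZ.
have key x : \sum_(i < N) (\1_(threshold_set f a c N i) x : R) <= (f x - a) / (c / N%:R) <=
    1 + \sum_(i < N) (\1_(threshold_set f a c N i) x : R).
  have -> : \sum_(i < N) (\1_(threshold_set f a c N i) x : R) =
      \sum_(i < N) (i.+1%:R <= (f x - a) / (c / N%:R))%R%:R.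
    apply: eq_bigr => i _; rewrite indicE; congr ((nat_of_bool _)%:R); apply/idP/idP.
      rewrite inE /threshold_set /= => h.
      by rewrite ler_pdivlMr ?divr_gt0// lerBrDl mulrCA.
    rewrite ler_pdivlMr ?divr_gt0// lerBrDl mulrCA => h.
    by rewrite inE /threshold_set /=.
  apply: count_thresholds; have /andP[fa fc] := fac x; apply/andP; split.
    by rewrite divr_ge0// ?subr_ge0// divr_ge0// ltW.
  rewrite ler_pdivrMr ?divr_gt0// mulrCA mulfV ?gt_eqF// mulr1; lra.
have mE : \int[mu]_x (c / N%:R * \sum_(i < N) (\1_(threshold_set f a c N i) x : R)) =
    c / N%:R * \sum_(i < N) prob mu (threshold_set f a c N i).
  rewrite meanZ// mean_sum; last by move=> i; exact: bounded_mfun_indic.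
  by congr (_ * _); apply: eq_bigr => i _; rewrite mean_indic.
have cN : 0 < c / N%:R by rewrite divr_gt0.
rewrite -mE -{1}(mean_cst mu a) -{1}(mean_cst mu (a + c / N%:R)) -!meanD//; last 2 first.
- exact: bounded_mfun_cst.
- exact: bounded_mfun_cst.
apply/andP; split; apply: le_mean => //.
- by apply: bounded_mfunD => //; exact: bounded_mfun_cst.
- move=> x; have /andP[+ _] := key x; rewrite ler_pdivlMr// mulrC; lra.
- by apply: bounded_mfunD => //; exact: bounded_mfun_cst.
- move=> x; have /andP[_ +] := key x; rewrite ler_pdivrMr// mulrC mulrDr mulr1; lra.
Qed.

(** The mixture is known on measurable sets only; [mean_thresholds] transfers this to means up to an
    error [c / N <= e], and [e] is arbitrary. *)
Lemma mean_mix (I : finType) (p : I -> R) (mu_ : I -> probability Y R) mu f :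
  bounded_mfun f -> (forall i, 0 <= p i) -> \sum_i p i = 1 ->
  (forall A, measurable A -> prob mu A = \sum_i p i * prob (mu_ i) A) ->
  \int[mu]_x f x = \sum_i p i * \int[mu_ i]_x f x.
Proof.
move=> [mf [M fM]] p0 p1 muE.
have M0 : 0 <= M by rewrite (le_trans _ (fM point)).
(* The margin 1 on either side keeps the width [c] positive even if [M = 0]. *)
have fac x : - M - 1 <= f x <= - M - 1 + (2 * M + 2).
  have := fM x; rewrite ler_norml; lra.
set c := 2 * M + 2 in fac; set a := - M - 1 in fac.
have c0 : 0 < c by rewrite /c; lra.
apply/eqP; rewrite -subr_eq0 -normr_le0; apply/ler_addgt0Pl => e e0.
rewrite addr0.
pose N := (Num.Def.truncn (c / e)).+1.
have NR : 0 < N%:R :> R by rewrite ltr0n.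
have cN : c / N%:R <= e.
  rewrite ler_pdivrMr// mulrC -ler_pdivrMr//.
  exact: ltW (truncnS_gt _).
pose S (nu : probability Y R) := \sum_(i < N) prob nu (threshold_set f a c N i).
have h nu : a + c / N%:R * S nu <= \int[nu]_x f x <= a + c / N%:R + c / N%:R * S nu.
  exact: mean_thresholds.
have SE : S mu = \sum_i p i * S (mu_ i).
  rewrite /S; under [RHS]eq_bigr do rewrite mulr_sumr.
  rewrite exchange_big /=; apply: eq_bigr => j _; apply: muE.
  exact: measurable_threshold_set.
have pE x : x = \sum_i p i * x by rewrite -mulr_suml p1 mul1r.
have hl : a + c / N%:R * S mu <= \sum_i p i * \int[mu_ i]_x f x.
  rewrite SE mulr_sumr [X in X + _]pE -big_split /=.
  apply: ler_sum => i _; rewrite mulrCA -mulrDr ler_wpM2l//.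
  by have /andP[] := h (mu_ i).
have hr : \sum_i p i * \int[mu_ i]_x f x <= a + c / N%:R + c / N%:R * S mu.
  rewrite SE mulr_sumr [X in _ <= X + _]pE -big_split /=.
  apply: ler_sum => i _; rewrite mulrCA -mulrDr ler_wpM2l//.
  by have /andP[] := h (mu_ i).
have := h mu; rewrite ler_norml; lra.
Qed.

Lemma mean_dirac f (x : Y) : measurable_fun [set: Y] f ->
  \int[\d_x : probability Y R]_y f y = f x.
Proof.
move=> mf; rewrite /Rintegral integral_dirac//; last exact/measurable_EFinP.
by rewrite diracT mul1e.
Qed.

End bounded_mean.

(** * Weak limits of measures *)

Section weak_topology.
Context {R : realType} (X : pointedMetricType R).

Lemma cvg_M1 (F : set_system (M1 X)) (FF : Filter F) (rho : M1 X) :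
  (forall f : Cont X, integrals mu f @[mu --> F] --> integrals rho f) ->
  F --> rho.
Proof.
move=> h A; rewrite nbhsE => -[B [[C oC CB] Brho] BA].
apply: filterS BA _; rewrite -CB.
suff : (@integrals R X) @ F --> integrals rho.
  apply; apply: open_nbhs_nbhs; split => //; by rewrite -CB in Brho.
apply/cvg_sup => f D; rewrite nbhsE => -[E [[U oU UE] Er] ED].
apply: (filterS ED); rewrite -UE.
apply: (h f); apply: open_nbhs_nbhs; split => //; by rewrite -UE in Er.
Qed.

End weak_topology.

Section borel_sets.
Context {R : realType} (X : pointedMetricType R).

Lemma measurable_open (U : set X) : open U -> measurable (U : set (borel X)).
Proof. by move=> oU; apply: sub_sigma_algebra. Qed.

Lemma measurable_closed (C : set X) : closed C -> measurable (C : set (borel X)).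
Proof.
move=> cC; rewrite -[C]setCK; apply: measurableC.
by apply: measurable_open; exact: closed_openC.
Qed.

End borel_sets.
#[local] Hint Resolve measurable_open measurable_closed : core.

(** * Measures from finitely additive set functions *)

Section regular_extension.
Context {R : realType} (X : pointedMetricType R) (Xcompact : compact [set: X]).
Variable lam : set (borel X) -> R.
Hypotheses (lam_ge0 : forall A, measurable A -> 0 <= lam A) (lamT : lam setT = 1)
  (lamU : forall A B : set (borel X), measurable A -> measurable B -> A `&` B = set0 ->
    lam (A `|` B) = lam A + lam B).

Let mO := @measurable_open R X.
Let mC := @measurable_closed R X.

Lemma le_lam (A B : set (borel X)) :
  measurable A -> measurable B -> A `<=` B -> lam A <= lam B.
Proof.
move=> mA mB AB; rewrite -(setDUK AB) lamU ?setDIK//; last exact: measurableD.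
rewrite lerDl lam_ge0//.
exact: measurableD.
Qed.

Lemma lam_set0 : lam set0 = 0.
Proof.
have := lamU measurable0 measurable0 (setI0 _).
rewrite setU0; lra.
Qed.

Lemma lam_subU (A B : set (borel X)) :
  measurable A -> measurable B -> lam (A `|` B) <= lam A + lam B.
Proof.
move=> mA mB.
have -> : A `|` B = A `|` (B `\` A).
  apply/seteqP; split=> x [Ax|]; [by left| |by left|by case; right].
  by move=> Bx; have [?|?] := pselect (A x); [left|right].
rewrite lamU ?setDIK//; last exact: measurableD.
by rewrite lerD2l le_lam//; exact: measurableD.
Qed.

(* A limit of probabilities along an ultrafilter is only finitely additive.
   Its inner closed content on open sets nevertheless induces an outer measure
   for which open sets are measurable, and the resulting measure satisfies the
   portmanteau inequalities with respect to lam. *)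
Definition open_content (U : set X) : \bar R :=
  ereal_sup [set (lam K)%:E | K in [set K | closed K /\ K `<=` U]].

Definition outer_content (A : set X) : \bar R :=
  ereal_inf [set open_content U | U in [set U | open U /\ A `<=` U]].

Local Open Scope ereal_scope.

Lemma open_content_le U (x : \bar R) :
  (forall K, closed K -> K `<=` U -> (lam K)%:E <= x) -> open_content U <= x.
Proof. by move=> h; apply: ge_ereal_sup => _ [K [cK KU] <-]; exact: h. Qed.

Lemma le_lam_open_content U K : closed K -> K `<=` U -> (lam K)%:E <= open_content U.
Proof. by move=> cK KU; apply: ereal_sup_ubound; exists K. Qed.

Lemma open_content_lam U : open U -> open_content U <= (lam U)%:E.
Proof.
move=> oU; apply: open_content_le => K cK KU; rewrite lee_fin le_lam//.
- exact: mC.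
- exact: mO.
Qed.

Lemma open_content_ge0 U : 0 <= open_content U.
Proof.
rewrite -[0]/(0%R%:E) -lam_set0; apply: le_lam_open_content => //; exact: closed0.
Qed.

Lemma le_open_content U V : U `<=` V -> open_content U <= open_content V.
Proof.
move=> UV; apply: open_content_le => K cK KU; apply: le_lam_open_content => //.
exact: subset_trans UV.
Qed.

Lemma open_content_fin U : open U -> open_content U \is a fin_num.
Proof.
move=> oU; rewrite ge0_fin_numE ?open_content_ge0//.
by rewrite (le_lt_trans (open_content_lam oU))// ltry.
Qed.

(** Normality separates the disjoint closed sets K minus W and the complement of V by open [V1] and
    [V2]. Then K minus V2 lies in V, K minus V1 lies in W, and together they cover K. *)
Lemma open_contentU2 K V W : closed K -> open V -> open W -> K `<=` V `|` W ->
  (lam K)%:E <= open_content V + open_content W.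
Proof.
move=> cK oV oW KVW.
have [V1 [V2 [oV1 oV2 KV1 VV2 V12]]] : exists V1 V2 : set X,
    [/\ open V1, open V2, K `\` W `<=` V1, ~` V `<=` V2 & V1 `&` V2 = set0].
  have := @pseudometric_normal R X; move=> /(@normal_openP R X); apply.
  - by rewrite setDE; apply: closedI => //; exact: open_closedC.
  - exact: open_closedC.
  - by apply/seteqP; split=> // x [[Kx nWx] nVx]; case: (KVW x Kx).
have cKV1 : closed (K `&` ~` V1) by apply: closedI => //; exact: open_closedC.
have cKV2 : closed (K `&` ~` V2) by apply: closedI => //; exact: open_closedC.
apply: (@le_trans _ _ ((lam (K `&` ~` V2))%:E + (lam (K `&` ~` V1))%:E)).
  rewrite -EFinD lee_fin; apply: le_trans (lam_subU _ _); [|exact: mC|exact: mC].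
  apply: le_lam; [exact: mC|apply: measurableU; exact: mC|].
  move=> x Kx; have [V1x|nV1x] := pselect (V1 x); last by right.
  by left; split=> // V2x; have : set0 x by rewrite -V12.
apply: leeD; apply: le_lam_open_content => // x [Kx nVx].
- by apply: contrapT => /VV2.
- by apply: contrapT => nWx; apply: nVx; apply: KV1.
Qed.

Lemma open_content_bigU (U : (set X)^nat) N K : (forall n, open (U n)) -> closed K ->
  K `<=` \bigcup_(n < N) U n -> (lam K)%:E <= \sum_(n < N) open_content (U n).
Proof.
move=> oU; elim: N K => [|N ih] K cK KU.
  rewrite big_ord0 (_ : K = set0) ?lam_set0//.
  by apply/seteqP; split=> // x /KU[].
rewrite big_ord_recr/=.
have oUN : open (\bigcup_(n < N) U n) by exact: bigcup_open.
apply: le_trans (open_contentU2 cK oUN (oU N) _) _.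
  move=> x /KU[n /= nN Unx]; have [<-|nN'] := eqVneq n N; first by right.
  by left; exists n => //=; rewrite ltn_neqAle nN'.
by rewrite leeD2r//; apply: open_content_le => K' cK' K'U; exact: ih.
Qed.

(** The closed sets tested from inside are compact, which reduces a countable union to a finite
    one. *)
Lemma open_content_bigcup (U : (set X)^nat) : (forall n, open (U n)) ->
  open_content (\bigcup_n U n) <= \sum_(n <oo) open_content (U n).
Proof.
move=> oU; apply: open_content_le => K cK KU.
have cptK : compact K by exact: (subclosed_compact cK Xcompact).
have [D _ KD] : finite_subset_cover [set: nat] U K.
  by rewrite compact_cover in cptK; exact: cptK.
pose N := (\max_(i <- finmap.enum_fset D) i).+1.
apply: (@le_trans _ _ (\sum_(n < N) open_content (U n))).
  apply: open_content_bigU => // x /KD[n nD Unx]; exists n => //=.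
  by rewrite ltnS; apply: leq_bigmax_seq.
rewrite -(big_mkord xpredT (fun n => open_content (U n))).
by apply: nneseries_lim_ge => n _ _; exact: open_content_ge0.
Qed.

Lemma outer_content_open U : open U -> outer_content U = open_content U.
Proof.
move=> oU; apply/eqP; rewrite eq_le; apply/andP; split.
  by apply: ereal_inf_lbound; exists U => //; split.
by apply: le_ereal_inf_tmp => _ [V [oV UV] <-]; exact: le_open_content.
Qed.

Lemma outer_content_le A U : open U -> A `<=` U -> outer_content A <= open_content U.
Proof. by move=> oU AU; apply: ereal_inf_lbound; exists U. Qed.

Lemma outer_content_ge0 A : 0 <= outer_content A.
Proof. by apply: le_ereal_inf_tmp => _ [V _ <-]; exact: open_content_ge0. Qed.

Lemma outer_content_fin A : outer_content A \is a fin_num.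
Proof.
rewrite ge0_fin_numE ?outer_content_ge0//.
apply: le_lt_trans (outer_content_le openT (@subsetT _ _)) _.
by rewrite -ge0_fin_numE ?open_content_ge0// open_content_fin//; exact: openT.
Qed.

Lemma outer_content_adherent A (e : R) : (0 < e)%R ->
  exists U, [/\ open U, A `<=` U & open_content U <= outer_content A + e%:E].
Proof.
move=> e0; have [_ [U [oU AU] <-] h] :=
  lb_ereal_inf_adherent e0 (outer_content_fin A).
by exists U; split=> //; exact: ltW.
Qed.

Lemma outer_content0 : outer_content set0 = 0.
Proof.
apply/eqP; rewrite eq_le outer_content_ge0 andbT.
apply: le_trans (outer_content_le open0 (@subset_refl _ _)) _.
by apply: le_trans (open_content_lam open0) _; rewrite lam_set0.
Qed.

Lemma le_outer_content : {homo outer_content : A B / A `<=` B >-> A <= B}.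
Proof.
move=> A B AB; apply: le_ereal_inf_tmp => _ [V [oV BV] <-].
by apply: outer_content_le => //; exact: subset_trans BV.
Qed.

Lemma outer_content_sigma_subadditive : sigma_subadditive outer_content.
Proof.
move=> F; apply/lee_addgt0Pr => e e0.
have h n : exists U, [/\ open U, F n `<=` U &
    open_content U <= outer_content (F n) + (e / (2 ^ n.+1)%:R)%:E].
  by apply: outer_content_adherent; rewrite divr_gt0// ltr0n expn_gt0.
have [U UP] := choice h.
apply: le_trans (epsilon_trick _ _ (ltW e0)) => //; last by move=> n; exact: outer_content_ge0.
apply: (@le_trans _ _ (open_content (\bigcup_n U n))).
  apply: outer_content_le; first by apply: bigcup_open => n _; case: (UP n).
  by apply: subset_bigcup => n _; case: (UP n).
apply: le_trans (open_content_bigcup _) _; first by move=> n; case: (UP n).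
apply: lee_nneseries => n _; first by move=> _; exact: open_content_ge0.
by case: (UP n).
Qed.

HB.instance Definition _ := isOuterMeasure.Build R X outer_content
  outer_content0 outer_content_ge0 le_outer_content outer_content_sigma_subadditive.

Lemma caratheodory_open C : open C -> outer_content.-caratheodory C.
Proof.
move=> oC; apply: le_caratheodory_measurable => A.
apply/lee_addgt0Pr => e e0.
have e30 : (0 < e / 3)%R by rewrite divr_gt0.
have [G [oG AG hG]] := outer_content_adherent A e30.
have oGC : open (G `&` C) by exact: openI.
have [_ [K [cK KGC] <-] hK] := ub_ereal_sup_adherent e30 (open_content_fin oGC).
have oGK : open (G `&` ~` K) by apply: openI => //; exact: closed_openC.
(* [K] nearly exhausts G inside C, and [K'] nearly exhausts the rest of G, which still contains A
   minus C because K is inside C. As K and K' are disjoint closed subsets of G, additivity of [lam]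
   closes the estimate. *)
have [_ [K' [cK' K'GK] <-] hK'] := ub_ereal_sup_adherent e30 (open_content_fin oGK).
have cKK' : closed (K `|` K') by exact: closedU.
have KK'G : K `|` K' `<=` G by move=> x [/KGC[]|/K'GK[]].
have h1 : (lam K + lam K')%:E <= outer_content A + (e / 3)%:E.
  apply: le_trans hG; rewrite -lamU.
  - exact: le_lam_open_content.
  - exact: mC.
  - exact: mC.
  - by apply/seteqP; split=> // x [Kx /K'GK[]].
have h2 : outer_content (A `&` C) <= (lam K)%:E + (e / 3)%:E.
  apply: (@le_trans _ _ (open_content (G `&` C))).
    by apply: outer_content_le => //; exact: setSI.
  by rewrite -leeBlDr//; exact: ltW.
have h3 : outer_content (A `&` ~` C) <= (lam K')%:E + (e / 3)%:E.
  apply: (@le_trans _ _ (open_content (G `&` ~` K))).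
    apply: outer_content_le => // x [Ax nCx]; split; first exact: AG.
    by move=> /KGC[].
  by rewrite -leeBlDr//; exact: ltW.
apply: le_trans (leeD h2 h3) _.
rewrite -[leRHS]/(outer_content A + e%:E); move: h1.
rewrite -(fineK (outer_content_fin A)) -!EFinD !lee_fin; lra.
Qed.

Lemma caratheodory_borel (A : set (borel X)) :
  measurable A -> outer_content.-cara.-measurable A.
Proof.
apply: smallest_sub; first exact: sigma_algebra_measurable.
by move=> U oU; exact: caratheodory_open.
Qed.

Definition regular_extension : set (borel X) -> \bar R := outer_content.

Let regular_extension_sigma_additive : semi_sigma_additive regular_extension.
Proof.
move=> F mF tF mUF; apply: caratheodory_measure_sigma_additive => //.
- by move=> i; exact: caratheodory_borel.
- exact: caratheodory_borel.
Qed.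

HB.instance Definition _ := isMeasure.Build _ (borel X) R regular_extension
  outer_content0 outer_content_ge0 regular_extension_sigma_additive.

Let regular_extension_setT : regular_extension setT = 1.
Proof.
rewrite /regular_extension outer_content_open; last exact: openT.
apply/eqP; rewrite eq_le; apply/andP; split.
  by rewrite -[1]/(1%R%:E) -lamT; apply: open_content_lam; exact: openT.
by rewrite -[1]/(1%R%:E) -lamT; apply: le_lam_open_content => //; exact: closedT.
Qed.

HB.instance Definition _ := Measure_isProbability.Build _ (borel X) R
  regular_extension regular_extension_setT.

(** Applied to an ultrafilter limit, this gives the limit measure; applied to a probability itself,
    it gives the regularity of that probability. *)
Lemma exists_regular_extension : exists mu : probability (borel X) R,
  [/\ forall U : set X, open U -> mu U = open_content U,
    forall K : set X, closed K -> (lam K)%:E <= mu K &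
    forall (A : set X) (e : R), (0 < e)%R ->
      exists U, [/\ open U, A `<=` U & mu U <= mu A + e%:E]].
Proof.
exists regular_extension; split=> [U oU|K cK|A e e0]; first exact: outer_content_open.
  apply: le_ereal_inf_tmp => _ [U [oU KU] <-].
  exact: le_lam_open_content.
have [U [oU AU h]] := outer_content_adherent A e0.
exists U; split=> //; rewrite -outer_content_open// in h.
Qed.

End regular_extension.

Section continuous_functions.
Context {R : realType} (X : pointedMetricType R) (Xcompact : compact [set: X]).

Lemma continuous_borel_measurable (f : X -> R) : continuous f ->
  measurable_fun [set: borel X] (f : borel X -> R).
Proof.
move=> cf; apply: (measurability _ (RGenOpens.measurableE R)).
move=> _ [_ [a [b ->]] <-]; rewrite setTI; apply: measurable_open.
by apply: open_comp; [move=> x _; exact: cf|exact: interval_open].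
Qed.

Lemma continuous_self_measurable (T : X -> X) : continuous T ->
  measurable_fun [set: borel X] (T : borel X -> borel X).
Proof.
move=> cT; apply: (@measurability _ _ (borel X) (borel X) _ _ open) => //.
move=> _ [U oU <-]; rewrite setTI; apply: measurable_open.
by apply: open_comp => // x _; exact: cT.
Qed.

Lemma continuous_bounded (f : X -> R) : continuous f -> exists M, forall x, `|f x| <= M.
Proof.
move=> cf.
have /compact_bounded[M [_ fM]] : compact (f @` [set: X]).
  by apply: continuous_compact => //; exact: continuous_subspaceT.
by exists (M + 1) => x; apply: fM; [rewrite ltrDl|exists x].
Qed.

Lemma continuous_bounded_mfun (f : X -> R) : continuous f ->
  bounded_mfun (f : borel X -> R).
Proof.
by move=> cf; split; [exact: continuous_borel_measurable|exact: continuous_bounded].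
Qed.

Lemma continuous_iter (T : X -> X) n : continuous T -> continuous (iter n T).
Proof.
move=> cT; elim: n => [|n ih] x; first exact: cvg_id.
by apply: (@continuous_comp _ _ _ (iter n T) T); [exact: ih|exact: cT].
Qed.

End continuous_functions.

Lemma ultra_cvg_bounded {R : realType} (T : Type) (W : set_system T) (UW : UltraFilter W)
  (u : T -> R) (a b : R) : (forall n, a <= u n <= b) -> exists l : R, u @ W --> l.
Proof.
move=> uab.
have FW : ProperFilter W := @ultra_proper _ W UW.
have [|l [_ lc]] := @segment_compact R a b (u @ W) (fmap_proper_filter u FW).
  by apply: (@filterE _ W) => n; rewrite /= in_itv/=.
exists l => V lV.
have [//|WC] := in_ultra_setVsetC (u @^-1` V) UW.
have /lc : (u @ W) (~` V) by exact: WC.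
by move=> /(_ _ lV)[x []].
Qed.

Lemma cvg_bigsum {R : realType} (T : Type) (W : set_system T) (FW : Filter W)
    (I : Type) (r : seq I) (P : pred I) (u : I -> T -> R) (l : I -> R) :
  (forall i, P i -> u i @ W --> l i) ->
  \sum_(i <- r | P i) u i n @[n --> W] --> \sum_(i <- r | P i) l i.
Proof.
move=> ul; elim: r => [|i r ih].
  by under eq_fun do rewrite big_nil; rewrite big_nil; exact: cvg_cst.
under eq_fun do rewrite big_cons; rewrite big_cons.
by case: ifPn => // Pi; apply: cvgD => //; exact: ul.
Qed.

(** * Limits of measures along an ultrafilter *)

Section limit_measure.
Context {R : realType} (X : pointedMetricType R) (Xcompact : compact [set: X]).
Variables (W : set_system nat) (mu_ : nat -> probability (borel X) R).
Hypothesis UW : UltraFilter W.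

Lemma exists_limit_measure : exists (lam : set (borel X) -> R) (mu : probability (borel X) R),
  [/\ forall A, measurable A -> prob (mu_ n) A @[n --> W] --> lam A,
    forall U : set X, open U -> mu U = open_content lam U &
    forall K : set X, closed K -> lam K <= prob mu K].
Proof.
(* The implication inside the existential lets [choice] pick a value on every set, measurable or
   not. *)
have h (A : set (borel X)) : exists l : R, measurable A -> prob (mu_ n) A @[n --> W] --> l.
  have [mA|nmA] := pselect (measurable A); last by exists 0.
  have [|l hl] := @ultra_cvg_bounded R _ W UW (fun n => prob (mu_ n) A) 0 1.
    by move=> n; rewrite prob_ge0 prob_le1.
  by exists l.
have [lam lamP] := choice h.
have FW : ProperFilter W := @ultra_proper _ W UW.
have [|||mu [muO muK _]] := @exists_regular_extension R X Xcompact lam.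
- move=> A mA.
  apply: (ler_cvg_to (@cvg_cst _ (0:R) _ W _) (lamP A mA)).
  by apply: nearW => n; exact: prob_ge0.
- apply: (@cvg_unique _ (@Rhausdorff R) (prob (mu_ n) setT @[n --> W]) _ _ _ (lamP _ _)) => //.
  by rewrite (_ : (fun n => prob (mu_ n) setT) = fun=> 1); [exact: cvg_cst|
    apply/funext => n; exact: prob_setT].
- move=> A B mA mB AB.
  apply: (@cvg_unique _ (@Rhausdorff R) (prob (mu_ n) (A `|` B) @[n --> W])) => //.
    by apply: lamP; exact: measurableU.
  rewrite (_ : (fun n => prob (mu_ n) (A `|` B)) =
    (fun n => prob (mu_ n) A + prob (mu_ n) B)).
    by apply: cvgD; exact: lamP.
  apply/funext => n; apply: EFin_inj; rewrite EFinD -!probE//; last exact: measurableU.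
  by rewrite measureU.
exists lam, mu; split=> // K cK.
by rewrite -lee_fin -probE ?muK//; exact: measurable_closed.
Qed.

Variables (lam : set (borel X) -> R) (mu : probability (borel X) R).
Hypotheses (lamP : forall A, measurable A -> prob (mu_ n) A @[n --> W] --> lam A)
  (muO : forall U : set X, open U -> mu U = open_content lam U)
  (muK : forall K : set X, closed K -> lam K <= prob mu K).

Let FW : ProperFilter W := @ultra_proper _ W UW.

Lemma limit_open (U : set X) : open U -> prob mu U <= lam U.
Proof.
move=> oU; have cU : closed (~` U) by exact: open_closedC.
have mU : measurable (U : set (borel X)) by exact: measurable_open.
have := muK cU; rewrite prob_setC//.
suff -> : lam (~` U) = 1 - lam U by lra.
apply: (@cvg_unique _ (@Rhausdorff R) (prob (mu_ n) (~` U) @[n --> W])) => //.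
  by apply: lamP; exact: measurableC.
rewrite (_ : (fun n => prob (mu_ n) (~` U)) = (fun n => 1 - prob (mu_ n) U)).
  by apply: cvgB; [exact: cvg_cst|exact: lamP].
by apply/funext => n; rewrite prob_setC.
Qed.

(** Superlevel sets of a continuous function are closed, and there [lam] is at most [mu]; the
    threshold sums carry this to integrals. The opposite inequality is the same statement for the
    negative of [f]. *)
Lemma limit_integral_le (f : X -> R) (e : R) : continuous f -> 0 < e ->
  \forall n \near W, \int[mu_ n]_x f x <= \int[mu]_x f x + e.
Proof.
move=> cf e0; have [M fM] := continuous_bounded Xcompact cf.
have mf := continuous_borel_measurable cf.
have M0 : 0 <= M by rewrite (le_trans _ (fM point)).
have fac x : - M - 1 <= f x <= - M - 1 + (2 * M + 2).
  have := fM x; rewrite ler_norml; lra.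
set c := 2 * M + 2 in fac; set a := - M - 1 in fac.
have c0 : 0 < c by rewrite /c; lra.
pose N := (Num.Def.truncn (c / (e / 2))).+1.
have NR : 0 < N%:R :> R by rewrite ltr0n.
have cN : c / N%:R <= e / 2.
  rewrite ler_pdivrMr// mulrC -ler_pdivrMr ?divr_gt0//.
  exact: ltW (truncnS_gt _).
pose A i : set (borel X) := threshold_set (f : borel X -> R) a c N i.
have mA i : measurable (A i) by exact: measurable_threshold_set.
have cA i : closed (A i : set X).
  rewrite (_ : A i = f @^-1` [set y | a + c * (i.+1%:R / N%:R) <= y])//.
  by apply: closed_comp => [x _|]; [exact: cf|exact: closed_ge].
pose S (nu : probability (borel X) R) := \sum_(i < N) prob nu (A i).
have h (nu : probability (borel X) R) : a + c / N%:R * S nu <= \int[nu]_x f x <=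
    a + c / N%:R + c / N%:R * S nu by exact: mean_thresholds.
have cS : a + c / N%:R + c / N%:R * S (mu_ n) @[n --> W] -->
    a + c / N%:R + c / N%:R * \sum_(i < N) lam (A i).
  apply: cvgD; first exact: cvg_cst.
  apply: cvgM; first exact: cvg_cst.
  by apply: cvg_bigsum => i _; exact: lamP.
have lamS : \sum_(i < N) lam (A i) <= S mu by apply: ler_sum => i _; exact: muK.
have cN0 : 0 < c / N%:R by rewrite divr_gt0.
have lt_lim : a + c / N%:R + c / N%:R * \sum_(i < N) lam (A i) < \int[mu]_x f x + e.
  have /andP[+ _] := h mu; have := ler_wpM2l (ltW cN0) lamS; lra.
near=> n.
have /andP[_ +] := h (mu_ n); move=> /le_trans; apply; apply: ltW.
by near: n; exact: (cvgr_lt _ cS).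
Unshelve. all: by end_near. Qed.

Lemma limit_integral (f : X -> R) : continuous f ->
  \int[mu_ n]_x f x @[n --> W] --> \int[mu]_x f x.
Proof.
move=> cf; apply/cvgrPdist_le => e e0.
have cNf : continuous (fun x => -1 * f x).
  by move=> x; apply: cvgM; [exact: cvg_cst|exact: cf].
have bf := continuous_bounded_mfun Xcompact cf.
have h1 := limit_integral_le cf e0.
have h2 := limit_integral_le cNf e0.
near=> n.
have : \int[mu_ n]_x f x <= \int[mu]_x f x + e by near: n.
have : \int[mu_ n]_x (-1 * f x) <= \int[mu]_x (-1 * f x) + e by near: n.
rewrite !meanZ// ler_norml; lra.
Unshelve. all: by end_near. Qed.

(** On open sets [mu] is the inner closed content of [lam], so it suffices to move closed sets: K
    inside the preimage of U goes to its image, compact and hence closed in U, and K inside U goes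
    to its preimage. Open sets form a pi-system generating the Borel sets. *)
Lemma limit_invariant (T : X -> X) : continuous T ->
  (forall A : set (borel X), measurable A -> lam (T @^-1` A) = lam A) ->
  @invariant_measure _ (borel X) R T mu.
Proof.
move=> cT lamT.
have mT := continuous_self_measurable cT.
have le_lam' : forall A B : set (borel X), measurable A -> measurable B ->
    A `<=` B -> lam A <= lam B.
  move=> A B mA mB AB; apply: (ler_cvg_to (lamP mA) (lamP mB)).
  by apply: nearW => n; exact: le_prob.
have muTO (U : set X) : open U -> mu (T @^-1` U) = mu U.
  move=> oU; have oTU : open (T @^-1` U) by apply: open_comp => // x _; exact: cT.
  rewrite muO// muO//; apply/eqP; rewrite eq_le; apply/andP; split.
    apply: ge_ereal_sup => _ [K [cK KTU] <-].
    have cTK : closed (T @` K).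
      apply: compact_closed; first exact: metric_hausdorff.
      apply: continuous_compact; last exact: (subclosed_compact cK Xcompact).
      exact: continuous_subspaceT.
    apply: (@le_trans _ _ (lam (T @` K))%:E).
      rewrite lee_fin -(lamT _ (measurable_closed cTK)).
      apply: le_lam'; [exact: measurable_closed| |by move=> x Kx; exists x].
      apply: measurable_closed; apply: closed_comp => // x _; exact: cT.
    by apply: ereal_sup_ubound; exists (T @` K) => //; split => // _ [x Kx <-]; exact: KTU.
  apply: ge_ereal_sup => _ [K [cK KU] <-]; rewrite -lamT; last exact: measurable_closed.
  apply: ereal_sup_ubound; exists (T @^-1` K) => //; split; last by move=> x /KU.
  by apply: closed_comp => // x _; exact: cT.
pose nuT : {measure set (borel X) -> \bar R} := pushforward mu (T : borel X -> borel X).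
move=> A mA.
suff : nuT mT A = mu A by [].
apply: (@measure_unique _ R (borel X) open (fun=> setT)) => //.
- by move=> U V; exact: openI.
- by move=> _; exact: openT.
- by rewrite bigcup_const.
- by move=> _; rewrite /= /pushforward preimage_setT probability_setT ltry.
Qed.

End limit_measure.

(** * Empirical measures, separated sets and rates *)

Section finite_unions.
Context d (Y : measurableType d) {R : realType} (rho : probability Y R).

Lemma prob_bigcup_le n (B : 'I_n -> set Y) : (forall i, measurable (B i)) ->
  prob rho (\bigcup_i B i) <= \sum_i prob rho (B i).
Proof.
elim: n B => [|n ih] B mB.
  by rewrite big_ord0 (_ : \bigcup_i B i = set0) ?prob_set0// -subset0 => x [[]].
rewrite big_ord_recl /=.
have -> : \bigcup_i B i = B ord0 `|` \bigcup_i B (lift ord0 i).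
  apply/seteqP; split=> x.
    move=> [i _ Bix]; have [j ij|i0] := unliftP ord0 i; last by left; rewrite -i0.
    by right; exists j => //; rewrite -ij.
  by move=> [B0|[i _ Bi]]; [exists ord0|exists (lift ord0 i)].
apply: le_trans (prob_setU _ _ _) _ => //; first exact: fin_bigcup_measurable.
by rewrite lerD2l; exact: ih.
Qed.

Lemma sum_prob_le n (B : 'I_n -> set Y) (S : set Y) : (forall i, measurable (B i)) ->
  measurable S -> (forall i, B i `<=` S) ->
  (forall i j, i != j -> B i `&` B j = set0) ->
  \sum_i prob rho (B i) <= prob rho S.
Proof.
elim: n B S => [|n ih] B S mB mS BS tB; first by rewrite big_ord0 prob_ge0.
rewrite big_ord_recl /=.
have mSB : measurable (S `\` B ord0) by exact: measurableD.
have h : \sum_i prob rho (B (lift ord0 i)) <= prob rho (S `\` B ord0).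
  apply: ih => //.
  - move=> i x Bx; split; first exact: (BS _ _ Bx).
    move=> B0; have : (B ord0 `&` B (lift ord0 i)) x by [].
    by rewrite tB// neq_lift.
  - by move=> i j ij; apply: tB; rewrite (inj_eq (@lift_inj _ ord0)).
apply: le_trans (lerD (lexx _) h) _.
rewrite -lee_fin EFinD -!probE// -measureU// ?setDIK//.
by rewrite setDUK//; exact: BS.
Qed.

End finite_unions.

Section empirical_measures.
Context {R : realType} (X : pointedMetricType R) (Xcompact : compact [set: X]).
Context (T : X -> X) (Tcont : continuous T).

Definition birkhoff_sum (f : X -> R) n x := \sum_(k < n) f (iter k T x).

Lemma prob_empirical n x (A : set (borel X)) : (0 < n)%N ->
  prob (@empirical _ (borel X) R T n x) A =
  n%:R^-1 * \sum_(k < n) \1_A (iter k T x).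
Proof.
move=> n0; rewrite /prob empiricalE//.
rewrite (eq_bigr (fun i : 'I_n => (\1_A (iter i T x))%:E)).
  by rewrite sumEFin.
by move=> i _; rewrite diracE indicE.
Qed.

Lemma integral_empirical (f : X -> R) n x : continuous f -> (0 < n)%N ->
  \int[@empirical _ (borel X) R T n x]_y f y = n%:R^-1 * birkhoff_sum f n x.
Proof.
move=> cf n0; have bf := continuous_bounded_mfun Xcompact cf.
rewrite (@mean_mix _ (borel X) R _ (fun=> n%:R^-1)
  (fun i : 'I_n => (\d_(iter i T x : borel X) : probability (borel X) R)))//.
- rewrite mulr_sumr; apply: eq_bigr => i _.
  by rewrite mean_dirac//; exact: continuous_borel_measurable.
- rewrite sumr_const card_ord -[LHS]mulr_natl divff//.
  by rewrite pnatr_eq0 -lt0n.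
- move=> A mA; rewrite prob_empirical// mulr_sumr.
  exact: eq_bigr.
Qed.

Lemma continuous_birkhoff_sum (f : X -> R) n : continuous f ->
  continuous (birkhoff_sum f n).
Proof.
move=> cf x; rewrite /birkhoff_sum; apply: cvg_bigsum => i _.
exact: (@continuous_comp _ _ _ (iter i T) f x (@continuous_iter R X T i Tcont x) (cf _)).
Qed.

Lemma continuous_empirical n : (0 < n)%N ->
  continuous (fun x => @empirical _ (borel X) R T n x : M1 X).
Proof.
move=> n0 x; apply: cvg_M1 => f.
have h : (fun y => integrals (@empirical _ (borel X) R T n y) f) =
    (fun y => n%:R^-1 * birkhoff_sum (sval f) n y).
  by apply/funext => y; rewrite /integrals integral_empirical//; exact: (svalP f).
suff : (fun y => integrals (@empirical _ (borel X) R T n y) f) @ x -->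
    integrals (@empirical _ (borel X) R T n x) f by [].
rewrite h (_ : integrals _ f = n%:R^-1 * birkhoff_sum (sval f) n x); last first.
  by rewrite /integrals integral_empirical//; exact: (svalP f).
apply: cvgM; first exact: cvg_cst.
by apply: continuous_birkhoff_sum; exact: (svalP f).
Qed.

Lemma continuous_mdist (x : X) : continuous (mdist x : X -> R).
Proof.
move=> y; apply/cvgrPdist_lt => e e0.
near=> z.
have : mdist y z < e.
  have : ball y e z by near: z; exact: nbhsx_ballx.
  by rewrite ballEmdist.
have := metric_triangle x y z; have := metric_triangle x z y.
rewrite (metric_sym z y) ltr_norml; lra.
Unshelve. all: by end_near. Qed.

Lemma closed_dyn_ball m x e : closed (dyn_ball T m x e).
Proof.
have -> : dyn_ball T m x e =
    \bigcap_(k in [set k | (k < m)%N]) (iter k T @^-1` [set z | mdist (iter k T x) z <= e]).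
  by [].
apply: closed_bigI => k _; apply: closed_comp.
  by move=> y _; exact: continuous_iter.
rewrite (_ : [set z | _] = mdist (iter k T x) @^-1` [set r | r <= e])//.
by apply: closed_comp => [y _|]; [exact: continuous_mdist|exact: closed_le].
Qed.

(** Greedy choice by induction on a finite cover by sets of mutually close points: if U meets S, a
    point is taken there and all points close to it are discarded. These include U, which thus
    leaves the cover. *)
Lemma exists_separated_seq (close : X -> X -> Prop) (l : seq (set X)) (S : set X) :
  (forall U x y, List.In U l -> U x -> U y -> close x y) ->
  (forall x, S x -> exists2 U, List.In U l & U x) ->
  exists s : seq X,
  [/\ forall i, (i < size s)%N -> S (nth point s i),
    forall i j, (i < j < size s)%N -> ~ close (nth point s i) (nth point s j) &
    forall y, S y -> exists2 i, (i < size s)%N & close (nth point s i) y].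
Proof.
elim: l S => [|U l ih] S lclose Sl.
  by exists [::]; split=> // [i j /andP[]//|y /Sl[U []]].
have [[x [Sx Ux]]|SU] := pselect (exists x, S x /\ U x).
  have [||s [sS sep cov]] := ih (S `&` [set y | ~ close x y]).
  - by move=> V y z Vl; apply: lclose; right.
  - move=> y [/Sl[V [<- Uy []|Vl Vy _]]]; last by exists V.
    exact: (lclose U x y (or_introl erefl)).
  exists (x :: s); split.
  - by case=> [//|i]; rewrite /= ltnS => /sS[].
  - case=> [|i] [|j]//=; last by rewrite !ltnS => /sep.
    by rewrite ltnS => /sS[].
  - move=> y Sy; have [xy|nxy] := pselect (close x y); first by exists 0%N.
    by have [//|i si sy] := cov y _; exists i.+1.
apply: ih => [V y z Vl|y Sy]; first by apply: lclose; right.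
have [V [<- Uy|Vl Vy]] := Sl y Sy; last by exists V.
by exfalso; apply: SU; exists y.
Qed.

Lemma dyn_ball_cover m (e : R) : 0 < e -> exists l : seq (set X),
  (forall U x y, List.In U l -> U x -> U y -> dyn_ball T m x e y) /\
  (forall x, exists2 U, List.In U l & U x).
Proof.
move=> e0.
pose V x := [set y | forall k : 'I_m, ball (iter k T x) (e / 2) (iter k T y)].
have nbhsV x : nbhs x (V x).
  apply: filter_forall => k; have := @continuous_iter R X T k Tcont x; apply.
  by apply: nbhsx_ballx; rewrite divr_gt0.
have := Xcompact; rewrite compact_cover => /(_ _ setT (fun x => interior (V x))).
case=> [x _|x _|D _ cD]; first exact: open_interior.
  by exists x => //; exact: nbhsV.
exists [seq V x | x <- finmap.enum_fset D]; split.
  move=> U x y /List.in_map_iff[z [<- _]] Vx Vy k km.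
  have := Vx (Ordinal km); have := Vy (Ordinal km); rewrite !ballEmdist /=.
  have := metric_triangle (iter k T x) (iter k T z) (iter k T y).
  rewrite (metric_sym _ (iter k T z)); lra.
move=> x; have [z zD Vx] := cD x I.
exists (V z); last exact: interior_subset Vx.
have : z \in finmap.enum_fset D by exact: zD.
elim: (finmap.enum_fset D) => // w s ih; rewrite inE => /predU1P[->|/ih]; first by left.
by right.
Qed.

Lemma exists_separated_set (S : set X) m (e : R) : 0 < e ->
  exists n (x : 'I_n -> X), [/\ forall i, S (x i),
    forall i j, i != j -> ~ dyn_ball T m (x i) e (x j) &
    forall y, S y -> exists i, dyn_ball T m (x i) e y].
Proof.
move=> e0; have [l [lball lcov]] := dyn_ball_cover m e0.
have [|s [sS sep cov]] := @exists_separated_seq (fun x y => dyn_ball T m x e y) l S lball.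
  by move=> x _; exact: lcov.
exists (size s), (fun i => nth point s i); split.
- by move=> i; exact: sS.
- move=> i j; rewrite neq_ltn => /orP[ij|ji]; first by apply: sep; rewrite ij ltn_ord.
  move=> b; apply: (sep j i); first by rewrite ji ltn_ord.
  by move=> k km; rewrite metric_sym; exact: b.
- by move=> y /cov[i si b]; exists (Ordinal si).
Qed.

End empirical_measures.

(** * Exponential form of the Gibbs bounds and of the rates *)

Section rates.
Context {R : realType} (X : pointedMetricType R) (Xcompact : compact [set: X]).
Context (T : X -> X) (Tcont : continuous T).
Context (phi : X -> R) (phicont : continuous phi).
Context (nu : probability (borel X) R).

Lemma weak_gibbs_bounds : weak_gibbs T phi nu -> forall delta : R, 0 < delta ->
  exists2 e0 : R, 0 < e0 & forall e : R, 0 < e <= e0 ->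
  exists N, forall m, (N <= m)%N -> forall x,
    expR (birkhoff_sum T phi m x - m%:R * delta) <= prob nu (dyn_ball T m x e) <=
    expR (birkhoff_sum T phi m x + m%:R * delta).
Proof.
move=> wg delta d0; have [e0 e00 H] := wg delta d0.
exists e0 => // e ee0; have [N HN] := H e ee0.
(* The successor forces [0 < m], so that multiplying by [m] undoes the normalization. *)
exists N.+1 => m Nm x.
have m0 : (0 < m)%N by exact: leq_trans Nm.
have mR : 0 < m%:R :> R by rewrite ltr0n.
have mball : measurable (dyn_ball T m x e : set (borel X)).
  by apply: measurable_closed; exact: closed_dyn_ball.
have := HN m (ltnW Nm) x.
rewrite integral_empirical// (probE nu mball).
have := prob_ge0 nu (dyn_ball T m x e); rewrite le_eqVlt => /predU1P[<-|p0].
  (* A null ball has logarithm [-oo], which the lower Gibbs bound excludes. *)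
  by rewrite le0_lneNy// gt0_muleNy ?lte_fin ?invr_gt0//= => /andP[].
rewrite lne_EFin// -!EFinM -EFinB !lee_fin => /andP[h1 h2].
set p := prob _ _ in p0 h1 h2 *; set s := birkhoff_sum _ _ _ _ in h1 h2 *.
have -> : p = expR (ln p) by rewrite lnK.
have hln : ln p = m%:R * (m%:R^-1 * ln p) by rewrite mulVKf// gt_eqF.
have hs : s = m%:R * (m%:R^-1 * s) by rewrite mulVKf// gt_eqF.
rewrite !ler_expR hln hs -mulrBr -mulrDr !ler_pM2l//; lra.
Qed.

Lemma ldp_rate_ge (C : set (M1 X)) m (c : R) : (0 < m)%N ->
  measurable ([set x | C (@empirical _ (borel X) R T m x)] : set (borel X)) ->
  expR (m%:R * c) <= prob nu [set x | C (@empirical _ (borel X) R T m x)] ->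
  (c%:E <= ldp_rate T nu C m)%E.
Proof.
move=> m0 mC h; have mR : 0 < m%:R :> R by rewrite ltr0n.
rewrite /ldp_rate (probE nu mC).
have p0 : 0 < prob nu [set x | C (@empirical _ (borel X) R T m x)].
  exact: lt_le_trans (expR_gt0 _) h.
rewrite lne_EFin// -EFinM lee_fin ler_pdivlMl//.
by rewrite -ler_expR lnK.
Qed.

Lemma lt_ldp_rate (C : set (M1 X)) m (c : R) : (0 < m)%N ->
  measurable ([set x | C (@empirical _ (borel X) R T m x)] : set (borel X)) ->
  (c%:E < ldp_rate T nu C m)%E ->
  expR (m%:R * c) <= prob nu [set x | C (@empirical _ (borel X) R T m x)].
Proof.
move=> m0 mC; have mR : 0 < m%:R :> R by rewrite ltr0n.
rewrite /ldp_rate (probE nu mC).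
have := prob_ge0 nu [set x | C (@empirical _ (borel X) R T m x)].
rewrite le_eqVlt => /predU1P[<-|p0].
  by rewrite le0_lneNy// gt0_muleNy ?lte_fin ?invr_gt0.
rewrite lne_EFin// -EFinM lte_fin => h.
by rewrite -[leRHS]lnK// ler_expR -ler_pdivlMl// ltW.
Qed.

Lemma limn_einf_ge (u : (\bar R)^nat) (c : \bar R) :
  (\forall n \near \oo, (c <= u n)%E) -> (c <= limn_einf u)%E.
Proof.
move=> cu; rewrite -[limn_einf u]/(limf_einf u \oo) limf_einfE.
apply: le_trans (ereal_sup_ubound _); last by exists [set n | (c <= u n)%E].
by apply: le_ereal_inf_tmp => _ [n /= cn <-].
Qed.

Lemma lt_limn_esup (u : (\bar R)^nat) (c : \bar R) : (c < limn_esup u)%E ->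
  forall N, exists2 n, (N <= n)%N & (c < u n)%E.
Proof.
move=> cu N.
have : (c < ereal_sup (u @` [set n | (N <= n)%N]))%E.
  apply: lt_le_trans cu _; rewrite /limn_esup /limf_esup.
  by apply: ereal_inf_lbound; exists [set n | (N <= n)%N] => //; exists N.
by move=> /ereal_sup_gt[_ [n Nn <-] h]; exists n.
Qed.

End rates.

(** * Mixtures and continuity sets *)

Section mixtures.
Context {R : realType} (X : pointedMetricType R).

Lemma exists_probD (mu1 mu2 : probability (borel X) R) (t : R) : 0 <= t <= 1 ->
  exists mu : probability (borel X) R, forall A : set (borel X), measurable A ->
    (mu A = t%:E * mu1 A + (1 - t)%:E * mu2 A)%E.
Proof.
move=> /andP[t0 t1].
have t10 : 0 <= 1 - t by rewrite subr_ge0.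
pose m : {measure set (borel X) -> \bar R} :=
  measure_add (mscale (NngNum t0) mu1) (mscale (NngNum t10) mu2).
have mE (A : set (borel X)) : (m A = t%:E * mu1 A + (1 - t)%:E * mu2 A)%E.
  exact: (measure_addE (mscale (NngNum t0) mu1) (mscale (NngNum t10) mu2) A).
have mT : m setT = 1%E.
  by rewrite mE !probability_setT !mule1 -EFinD addrC subrK.
(* The total mass is already 1: the normalization only supplies the structure of a probability, and
   its default [mu1] is never reached. *)
exists (mnormalize m mu1) => A mA.
rewrite -mE /= /mnormalize mT ifF; last by apply/negbTE; rewrite negb_or onee_neq0.
by rewrite /= invr1 mule1.
Qed.

Lemma exists_mixture (F : set (M1 X)) n (E : 'I_n -> probability (borel X) R) (p : 'I_n -> R) :
  convex_measures F -> (forall i, F (E i)) -> (forall i, 0 <= p i) -> \sum_i p i = 1 ->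
  exists2 mu : probability (borel X) R, F mu &
    forall A, measurable A -> prob mu A = \sum_i p i * prob (E i) A.
Proof.
move=> cF; elim: n E p => [|n ih] E p FE p0.
  by rewrite big_ord0 => /esym/eqP; rewrite oner_eq0.
rewrite big_ord_recl; set t := p ord0 => pt.
have t0 : 0 <= t by exact: p0.
have s0 : 0 <= \sum_(i < n) p (lift ord0 i) by exact: sumr_ge0.
(* For [t = 1] the other weights vanish and cannot be renormalized. *)
have [t1|t1] := eqVneq t 1.
  have pz i : p (lift ord0 i) = 0.
    have : \sum_(i < n) p (lift ord0 i) = 0 by lra.
    by move=> /psumr_eq0P; apply.
  exists (E ord0) => // A mA; rewrite big_ord_recl -/t t1 mul1r.
  by rewrite big1 ?addr0// => i _; rewrite pz mul0r.
have t1' : 0 < 1 - t by rewrite lt_neqAle subr_ge0 eq_sym subr_eq0 eq_sym t1/=; lra.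
have [|||nu' Fnu nuE] := ih (fun i => E (lift ord0 i)) (fun i => p (lift ord0 i) / (1 - t)).
- by move=> i; exact: FE.
- by move=> i; rewrite divr_ge0// ltW.
- by rewrite -mulr_suml (_ : \sum_(i < n) _ = 1 - t) ?divff ?gt_eqF//; lra.
have t01 : 0 <= t <= 1 by rewrite t0/= -subr_ge0 ltW.
have [mu muE] := exists_probD (E ord0) nu' t01.
exists mu; first exact: (cF _ _ _ _ (FE ord0) Fnu t01 muE).
move=> A mA; apply: EFin_inj; rewrite -probE// muE// !probE// nuE// -!EFinM -EFinD.
congr (_%:E); rewrite big_ord_recl; congr (_ + _).
rewrite mulr_sumr; apply: eq_bigr => i _.
by rewrite mulrA [X in X * _]mulrC divfK// gt_eqF.
Qed.

End mixtures.

Section continuity_sets.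
Context {R : realType} (X : pointedMetricType R) (Xcompact : compact [set: X]).
Variable mu : probability (borel X) R.

(** This says that the boundary is [mu]-null. With [U] and [C] as explicit witnesses, Boolean
    operations and preimages act on the witnesses, and no interior or closure has to be computed. *)
Definition continuity_set (A : set X) := measurable (A : set (borel X)) /\
  exists U C : set X,
  [/\ open U, closed C, U `<=` A, A `<=` C & prob mu (C `\` U) = 0].

Lemma prob_eq0 (A B : set (borel X)) : measurable A -> measurable B -> A `<=` B ->
  prob mu B = 0 -> prob mu A = 0.
Proof.
move=> mA mB AB B0; apply/eqP; rewrite eq_le prob_ge0 andbT -B0.
exact: le_prob.
Qed.

Lemma continuity_setC A : continuity_set A -> continuity_set (~` A).
Proof.
move=> [mA [U [C [oU cC UA AC UC]]]]; split; first exact: measurableC.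
exists (~` C), (~` U); split.
- exact: closed_openC.
- exact: open_closedC.
- exact: subsetC.
- exact: subsetC.
- by rewrite (_ : ~` U `\` ~` C = C `\` U)// !setDE setCK setIC.
Qed.

Lemma continuity_setI A B : continuity_set A -> continuity_set B ->
  continuity_set (A `&` B).
Proof.
move=> [mA [U [C [oU cC UA AC UC]]]] [mB [U' [C' [oU' cC' UA' AC' UC']]]].
split; first exact: measurableI.
exists (U `&` U'), (C `&` C'); split.
- exact: openI.
- exact: closedI.
- exact: setISS.
- exact: setISS.
- have mU := measurable_open oU; have mU' := measurable_open oU'.
  have mC := measurable_closed cC; have mC' := measurable_closed cC'.
  have h : prob mu ((C `\` U) `|` (C' `\` U')) = 0.
    apply/eqP; rewrite eq_le prob_ge0 andbT.
    apply: le_trans (prob_setU _ _ _) _; [exact: measurableD|exact: measurableD|].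
    by rewrite UC UC' addr0.
  apply: prob_eq0 h.
  + by apply: measurableD; exact: measurableI.
  + by apply: measurableU; exact: measurableD.
  + move=> x [[Cx Cx'] nU]; have [Ux|nUx] := pselect (U x); last by left.
    by right; split=> // Ux'; exact: nU.
Qed.

Lemma continuity_setT : continuity_set setT.
Proof.
split; first exact: measurableT.
exists setT, setT; split; [exact: openT|exact: closedT|exact: subset_refl| |].
  exact: subset_refl.
by rewrite setDv prob_set0.
Qed.

Lemma continuity_set_bigcap n (A : 'I_n -> set X) : (forall i, continuity_set (A i)) ->
  continuity_set (\bigcap_i A i).
Proof.
elim: n A => [|n ih] A cA.
  rewrite (_ : \bigcap_i A i = setT); first exact: continuity_setT.
  by apply/seteqP; split=> // x _ [].
rewrite (_ : \bigcap_i A i = A ord0 `&` \bigcap_i A (lift ord0 i)).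
  by apply: continuity_setI => //; exact: ih.
apply/seteqP; split=> [x h|x [h0 h] i _]; first by split=> [|i _]; exact: h.
by have [j ->|->] := unliftP ord0 i; [exact: h|].
Qed.

Lemma continuity_set_preimage (T : X -> X) A : continuous T ->
  @invariant_measure _ (borel X) R T mu ->
  continuity_set A -> continuity_set (T @^-1` A).
Proof.
move=> cT invT [mA [U [C [oU cC UA AC UC]]]]; split.
  rewrite -[X in measurable X]setTI; exact: (continuous_self_measurable cT).
exists (T @^-1` U), (T @^-1` C); split.
- by apply: open_comp => // x _; exact: cT.
- by apply: closed_comp => // x _; exact: cT.
- by move=> x /UA.
- by move=> x /AC.
- rewrite -UC /prob -[in RHS]invT//; apply: measurableD.
    exact: measurable_closed.
  exact: measurable_open.
Qed.

Lemma continuity_set_bounds A : continuity_set A -> exists U C : set X,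
  [/\ open U, closed C, U `<=` A, A `<=` C & prob mu C = prob mu U].
Proof.
move=> [_ [U [C [oU cC UA AC UC]]]]; exists U, C; split=> //.
have mU := measurable_open oU; have mC := measurable_closed cC.
apply/eqP; rewrite eq_le; apply/andP; split; last first.
  by apply: le_prob => //; exact: subset_trans AC.
rewrite -[C](setDUK (subset_trans UA AC)).
apply: le_trans (prob_setU _ _ _) _ => //; first exact: measurableD.
by rewrite UC addr0.
Qed.

(** The distance to [x] is a random variable and has countably many atoms, whereas an interval has
    positive Lebesgue measure. *)
Lemma exists_null_sphere (x : X) (a b : R) : a < b ->
  exists2 r, a < r < b & prob mu [set y | mdist x y = r] = 0.
Proof.
move=> ab.
have md : measurable_fun [set: borel X] (mdist x : borel X -> R).
  exact: (continuous_borel_measurable (@continuous_mdist R X x)).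
pose Z : {RV mu >-> R} := mfun_Sub (mem_set md).
have cZ := pmf_gt0_countable Z.
apply: contrapT => h.
have : (lebesgue_measure `]a, b[%classic <= (0 : \bar R))%E.
  rewrite -(countable_lebesgue_measure0 cZ); apply: le_measure; rewrite ?inE//.
    exact: countable_measurable.
  move=> r /=; rewrite in_itv/= => rab.
  rewrite lt_neqAle; apply/andP; split; last by rewrite fine_ge0.
  by apply/eqP => r0; apply: h; exists r.
by rewrite lebesgue_measure_itv/= lte_fin ab -EFinB lee_fin subr_le0 leNgt ab.
Qed.

Lemma continuity_ball (x : X) (a b : R) : 0 < a < b ->
  exists2 r, a < r < b & continuity_set [set y | mdist x y < r].
Proof.
move=> /andP[a0 ab]; have [r rab r0] := exists_null_sphere x ab.
have oB : open [set y | mdist x y < r].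
  rewrite -[X in open X]/((mdist x : X -> R) @^-1` [set s | s < r]).
  by apply: open_comp => [y _|]; [exact: continuous_mdist|exact: open_lt].
exists r => //; split; first exact: measurable_open.
exists [set y | mdist x y < r], [set y | mdist x y <= r]; split=> //.
- rewrite -[X in closed X]/((mdist x : X -> R) @^-1` [set s | s <= r]).
  by apply: closed_comp => [y _|]; [exact: continuous_mdist|exact: closed_le].
- by move=> y /= /ltW.
- rewrite -r0; congr (prob _ _); apply/seteqP; split=> y /=.
    by move=> [yr /negP]; rewrite -leNgt => ry; apply/eqP; rewrite eq_le yr.
  by move=> ->; rewrite lexx ltxx.
Qed.

Lemma exists_continuity_partition (e : R) : 0 < e ->
  exists k (a : X -> 'I_k), (forall i, continuity_set (a @^-1` [set i])) /\
    forall x y, a x = a y -> mdist x y <= e.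
Proof.
move=> e0.
have h (x : X) : exists V : set X, [/\ continuity_set V, nbhs x V &
    forall y z, V y -> V z -> mdist y z <= e].
  have e4 : 0 < e / 4 < e / 2 by lra.
  (* A radius below [e / 2] makes the diameter at most [e]; the bound [e / 4] keeps the ball a
     neighbourhood of its centre. *)
  have [r /andP[r1 r2] cV] := continuity_ball x e4.
  exists [set y | mdist x y < r]; split=> //.
    have : nbhs x (ball x r) by apply: nbhsx_ballx; lra.
    by rewrite ballEmdist.
  move=> y z /= xy xz; have := metric_triangle y x z; rewrite (metric_sym y x); lra.
have [V VP] := choice h.
have := Xcompact; rewrite compact_cover => /(_ _ setT (fun x => interior (V x))).
case=> [x _|x _|D _ cD]; first exact: open_interior.
  by exists x => //; case: (VP x).
pose s := finmap.enum_fset D.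
have cov x : exists i : 'I_(size s), V (nth point s i) x.
  have [z zD Vx] := cD x I.
  have zs : (index z s < size s)%N by rewrite index_mem; exact: zD.
  exists (Ordinal zs); rewrite /= nth_index; last exact: zD.
  exact: interior_subset Vx.
have first_index x : exists i : 'I_(size s), V (nth point s i) x /\
    forall j : 'I_(size s), (j < i)%N -> ~ V (nth point s j) x.
  have [i Vi] := cov x.
  (* Taking the least index makes the cover disjoint: a cell is one ball minus the earlier ones,
     hence again a continuity set. *)
  pose P n := `[< exists j : 'I_(size s), nat_of_ord j = n /\ V (nth point s j) x >].
  have exP : exists n, P n by exists i; apply/asboolP; exists i.
  case: (ex_minnP exP) => _ /asboolP[j [<- Vj]] jmin.
  exists j; split=> // j' j'j Vj'.
  have : P j' by apply/asboolP; exists j'.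
  by move=> /jmin; rewrite leqNgt j'j.
have [a aP] := choice first_index.
exists (size s), a; split; last first.
  move=> x y axy; have [Vx _] := aP x; have [Vy _] := aP y; rewrite -axy in Vy.
  by have [_ _] := VP (nth point s (a x)); exact.
move=> i.
have -> : a @^-1` [set i] = V (nth point s i) `&`
    \bigcap_(j in [set: 'I_i]) ~` V (nth point s j).
  apply/seteqP; split=> [x /= axi|x [Vi h']].
    have [Vx nV] := aP x; rewrite axi in Vx nV; split=> // j _.
    have js : (j < size s)%N by rewrite (ltn_trans (ltn_ord j)).
    exact: (nV (Ordinal js) (ltn_ord j)).
  have [Vx nV] := aP x; apply: val_inj => /=.
  apply/eqP; rewrite eqn_leq; apply/andP; split; rewrite leqNgt; apply/negP => lt_i.
    exact: (nV i lt_i Vi).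
  exact: (h' (Ordinal lt_i) I Vx).
apply: continuity_setI; first by case: (VP (nth point s i)).
apply: continuity_set_bigcap => j; apply: continuity_setC.
by case: (VP (nth point s j)).
Qed.

End continuity_sets.

(** * The upper bound *)

Lemma finite_entropy_limit {R : realType} (V : finType) (W : set_system nat)
    (FW : Filter W) (P_ : nat -> V -> R) (P : V -> R) (e : R) :
  (forall n v, 0 <= P_ n v) -> (forall n, \sum_v P_ n v = 1) ->
  (forall v, 0 <= P v) -> \sum_v P v = 1 ->
  (forall v, P_ n v @[n --> W] --> P v) -> 0 < e ->
  \forall n \near W, - \sum_v P_ n v * ln (P_ n v) <= - \sum_v P v * ln (P v) + e.
Proof.
move=> P_0 P_1 P0 P1 cP e0.
(* The mass [h * #|V|] added to [P] is then below [e], and it bounds the cost [ln s] of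
   renormalizing. The successor keeps the divisor positive. *)
pose h : R := e / 2 / #|V|.+1%:R.
have K0 : 0 < #|V|.+1%:R :> R by rewrite ltr0n.
have h0 : 0 < h by rewrite !divr_gt0.
pose s := 1 + h * #|V|%:R.
have s1 : 1 <= s by rewrite /s lerDl mulr_ge0// ltW.
have s0 : 0 < s by lra.
have lns : ln s < e.
  apply: (@le_lt_trans _ _ (h * #|V|%:R)).
    by apply: le_ln1Dx; rewrite (@lt_le_trans _ _ 0)// mulr_ge0// ltW.
  apply: (@le_lt_trans _ _ (h * #|V|.+1%:R)); first by rewrite ler_pM2l// ler_nat.
  by rewrite /h divfK ?gt_eqF//; lra.
(* Comparing with a positive perturbation of P makes the bound affine in P_ n,
   which avoids the continuity of x ln x at 0. *)
pose Q v := (P v + h) / s.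
have Q0 v : 0 < Q v by rewrite divr_gt0// ltr_wpDl.
have Q1 : \sum_v Q v <= 1.
  rewrite -mulr_suml big_split/= P1 sumr_const -[h *+ _]mulr_natr.
  by rewrite -/s divff// gt_eqF.
have lnQ v : 0 < P v -> ln (P v) - ln s <= ln (Q v).
  move=> Pv; rewrite ln_div ?posrE// ?ltr_wpDl// lerD2r ler_ln ?posrE ?ltr_wpDl//.
  by rewrite lerDl ltW.
have cQ : - \sum_v P_ n v * ln (Q v) @[n --> W] --> - \sum_v P v * ln (Q v).
  apply: cvgN; apply: cvg_bigsum => v _.
  by apply: cvgM; [exact: cP|exact: cvg_cst].
have QP : - \sum_v P v * ln (Q v) < - \sum_v P v * ln (P v) + e.
  apply: (@le_lt_trans _ _ (- \sum_v P v * ln (P v) + ln s)); last by rewrite ltrD2l.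
  have -> : ln s = \sum_v P v * ln s by rewrite -mulr_suml P1 mul1r.
  rewrite -!sumrN -big_split/=; apply: ler_sum => v _.
  have := P0 v; rewrite le_eqVlt => /predU1P[<-|Pv]; first by rewrite !mul0r oppr0 addr0.
  by have := ler_wpM2l (ltW Pv) (lnQ v Pv); rewrite mulrBr; lra.
near=> n.
apply: (@le_trans _ _ (- \sum_v P_ n v * ln (Q v))).
  by apply: gibbs_inequality => // v; rewrite ltW.
by apply: ltW; near: n; exact: (cvgr_lt _ cQ).
Unshelve. all: by end_near. Qed.

Section word_entropy.
Context {R : realType} (X : pointedMetricType R) (Xcompact : compact [set: X]).
Context (T : X -> X) (Tcont : continuous T).
Context (k : nat) (a : X -> 'I_k).
Hypothesis ma : forall i, measurable (a @^-1` [set i] : set (borel X)).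
Implicit Types mu : probability (borel X) R.

Definition word_prob mu q (v : {ffun 'I_q -> 'I_k}) : R :=
  prob mu [set x | word_at 0 q (itinerary a T x) = v].

Definition word_entropy mu q : R :=
  - \sum_v word_prob mu (q := q) v * ln (word_prob mu v).

Let measT : measurable_fun [set: borel X] (T : borel X -> borel X).
Proof. exact: continuous_self_measurable. Qed.

Let mword q (v : {ffun 'I_q -> 'I_k}) :
  measurable ([set x | word_at 0 q (itinerary a T x) = v] : set (borel X)).
Proof. exact: (@measurable_word _ (borel X)). Qed.

Lemma sum_word_prob mu q : \sum_v word_prob mu (q := q) v = 1.
Proof.
rewrite /word_prob -(@prob_fibers _ (borel X) _ mu _
  (fun x => word_at 0 q (itinerary a T x)) predT); last by move=> v; exact: mword.
by rewrite (_ : [set x | _] = setT) ?prob_setT//; apply/seteqP; split.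
Qed.

Lemma fibers_partition : @measurable_partition _ (borel X) k (fun i => a @^-1` [set i]).
Proof.
split=> //; first by move=> i j _ _ [x [/= -> ->]].
by apply/seteqP; split=> // x _; exists (a x).
Qed.

Lemma join_entropy_fibers mu q :
  @join_entropy _ (borel X) R T mu k (fun i => a @^-1` [set i]) q = word_entropy mu q.
Proof.
rewrite /join_entropy /word_entropy; congr (- _); apply: eq_bigr => w _.
by rewrite (@join_atomE _ (borel X) T k (fun i => a @^-1` [set i]) a).
Qed.

(* On an (m, e)-separated set, the length-m itineraries of a partition finer
   than e are distinct. *)
Lemma separated_entropy (e : R) m q n (x : 'I_n -> X) (p : 'I_n -> R) mu :
  (forall y z, a y = a z -> mdist y z <= e) ->
  (0 < q)%N -> (q <= m)%N ->
  (forall i j, i != j -> ~ dyn_ball T m (x i) e (x j)) ->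
  (forall i, 0 <= p i) -> \sum_i p i = 1 ->
  (forall A, measurable A ->
    prob mu A = \sum_i p i * prob (@empirical _ (borel X) R T m (x i)) A) ->
  - \sum_i p i * ln (p i) <= m%:R / q%:R * word_entropy mu q + 2 * q%:R * ln k%:R.
Proof.
move=> ae q0 qm sep p0 p1 muE.
have m0 : (0 < m)%N by exact: leq_trans qm.
(* Both lengths are [m]: itineraries are infinite, so windows starting before [m] may run past it,
   and the empirical measure counts exactly these windows. *)
have := @block_entropy R _ (a point) _ p (fun i => itinerary a T (x i)) m m q
  (word_prob mu (q := q)) q0 qm (leqnn m) p0 p1.
rewrite subnn addr0 card_ord; apply.
- move=> i j ij; apply/eqP; apply: contrapT => /negP /sep; apply => s sm.
  exact: ae (ij s sm).
- move=> v; rewrite /word_prob muE//.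
  under eq_bigr do rewrite prob_empirical// mulrCA.
  rewrite -mulr_sumr; congr (_ * _).
  under eq_bigr do rewrite mulr_sumr.
  rewrite exchange_big /=; apply: eq_bigr => s _.
  rewrite [RHS]big_mkcond /=; apply: eq_bigr => i _.
  rewrite indicE word_at_itinerary; case: eqP => h.
    by rewrite mem_set ?mulr1.
  by rewrite memNset ?mulr0.
Qed.

End word_entropy.

Lemma exists_between_EFin {R : realType} (x y : \bar R) : (x < y)%E ->
  exists c : R, (x < c%:E < y)%E.
Proof.
move: x y => [r| |] [s| |]//=.
- rewrite lte_fin => rs; exists ((r + s) / 2).
  by rewrite !lte_fin; apply/andP; split; lra.
- by exists (r + 1); rewrite lte_fin ltrDl ltr01 ltry.
- by exists (s - 1); rewrite ltNyr lte_fin; lra.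
- by exists 0; rewrite ltNyr ltry.
Qed.

Section upper.
Context {R : realType} (X : pointedMetricType R) (Xcompact : compact [set: X]).
Context (T : X -> X) (Tcont : continuous T).
Context (phi : X -> R) (phicont : continuous phi).
Context (nu : probability (borel X) R) (nugibbs : weak_gibbs T phi nu).
Context (F : set (M1 X)) (Fconvex : convex_measures F) (Fclosed : closed F).

Lemma closed_empirical_preimage m : (0 < m)%N ->
  closed [set x | F (@empirical _ (borel X) R T m x)].
Proof.
move=> m0; apply: (@closed_comp _ _ (fun x => @empirical _ (borel X) R T m x : M1 X)) => //.
by move=> x _; exact: continuous_empirical.
Qed.

(** Along one orbit the counts for A and for its preimage differ by the first and the last term
    only, hence by at most 1; averaging over the orbits keeps this bound. *)
Lemma mixture_preimage_le m n (x : 'I_n -> X) (p : 'I_n -> R)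
    (mu : probability (borel X) R) (A : set (borel X)) : (0 < m)%N ->
  (forall i, 0 <= p i) -> \sum_i p i = 1 ->
  (forall A, measurable A ->
    prob mu A = \sum_i p i * prob (@empirical _ (borel X) R T m (x i)) A) ->
  measurable A -> `|prob mu (T @^-1` A) - prob mu A| <= m%:R^-1.
Proof.
move=> m0 p0 p1 muE mA.
have measT := continuous_self_measurable Tcont.
have mTA : measurable (T @^-1` A : set (borel X)).
  by rewrite -[X in measurable X]setTI; exact: measT.
rewrite !muE// -sumrB.
apply: le_trans (ler_norm_sum _ _ _) _.
have -> : m%:R^-1 = \sum_i p i * m%:R^-1 :> R by rewrite -mulr_suml p1 mul1r.
apply: ler_sum => i _.
rewrite -mulrBr normrM ger0_norm// ler_wpM2l//.
rewrite !prob_empirical// -mulrBr normrM ger0_norm ?invr_ge0//.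
rewrite -[leRHS]mulr1 ler_wpM2l ?invr_ge0//.
case: m m0 {muE} => // m _; rewrite big_ord_recr big_ord_recl /=.
have -> : \sum_(j < m) \1_(T @^-1` A) (iter j T (x i)) =
    \sum_(j < m) \1_A (iter (bump 0 j) T (x i)) :> R.
  by apply: eq_bigr => j _; rewrite !indicE; congr ((nat_of_bool _)%:R);
    apply/idP/idP; rewrite !inE.
set S := \sum_(j < m) _; set u := \1_(T @^-1` A) _; set v := \1_A (x i).
have -> : S + u - (v + S) = u - v by ring.
rewrite /u /v !indicE.
by case: (_ \in _); case: (_ \in _); rewrite /= ?subrr ?subr0 ?sub0r ?normrN ?normr1 ?normr0.
Qed.

(** The equality case of the finite variational principle, attained at [p i = exp (s i) / Z]. *)
Lemma gibbs_weights n (s : 'I_n -> R) : (0 < n)%N ->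
  exists p : 'I_n -> R, [/\ forall i, 0 <= p i, \sum_i p i = 1 &
    ln (\sum_i expR (s i)) = - \sum_i p i * ln (p i) + \sum_i p i * s i].
Proof.
move=> n0; set Z := \sum_i expR (s i).
have Z0 : 0 < Z.
  rewrite /Z (bigD1 (Ordinal n0))//= ltr_pwDl ?expR_gt0//.
  by apply: sumr_ge0 => i _; exact: expR_ge0.
have p1 : \sum_i expR (s i) / Z = 1 by rewrite -mulr_suml divff// gt_eqF.
exists (fun i => expR (s i) / Z); split=> //.
  by move=> i; rewrite divr_ge0 ?expR_ge0// ltW.
rewrite -sumrN -big_split /=.
rewrite (eq_bigr (fun i => expR (s i) / Z * ln Z)); first by rewrite -mulr_suml p1 mul1r.
move=> i _; rewrite ln_div ?posrE ?expR_gt0// expRK; lra.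
Qed.

(** The partition is quantified after [mu]: its boundaries must be null for the limit of these
    measures, which is known only later. *)
Lemma separated_mixture (c delta e : R) m : (0 < m)%N -> 0 < e ->
  (forall x, prob nu (dyn_ball T m x e) <= expR (birkhoff_sum T phi m x + m%:R * delta)) ->
  (c%:E < ldp_rate T nu F m)%E ->
  exists2 mu : probability (borel X) R, F mu &
    (forall A : set (borel X), measurable A ->
       `|prob mu (T @^-1` A) - prob mu A| <= m%:R^-1) /\
    forall k (a : X -> 'I_k),
      (forall i, measurable (a @^-1` [set i] : set (borel X))) ->
      (forall y z, a y = a z -> mdist y z <= e) ->
      forall q, (0 < q)%N -> (q <= m)%N ->
      c - delta <= q%:R^-1 * word_entropy T a mu q +
        2 * q%:R * ln k%:R / m%:R + \int[mu]_x phi x.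
Proof.
move=> m0 e0 gibbs hc; have mR : 0 < m%:R :> R by rewrite ltr0n.
set S := [set x | F (@empirical _ (borel X) R T m x)].
have mS : measurable (S : set (borel X)).
  by apply: measurable_closed; exact: closed_empirical_preimage.
have hS : expR (m%:R * c) <= prob nu S by exact: lt_ldp_rate.
have [n [x [xS sep cov]]] := exists_separated_set Xcompact Tcont S m e0.
have mB i : measurable (dyn_ball T m (x i) e : set (borel X)).
  by apply: measurable_closed; exact: closed_dyn_ball.
have hZ : expR (m%:R * c) <= expR (m%:R * delta) *
    \sum_i expR (birkhoff_sum T phi m (x i)).
  apply: (le_trans hS); apply: (@le_trans _ _ (\sum_i prob nu (dyn_ball T m (x i) e))).
    apply: le_trans (prob_bigcup_le nu mB).
    apply: le_prob => //; first exact: fin_bigcup_measurable.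
    by move=> y /cov[i yi]; exists i.
  by rewrite mulr_sumr; apply: ler_sum => i _; rewrite -expRD addrC.
have n0 : (0 < n)%N.
  case: n x xS sep cov mB hZ => // x _ _ _ _.
  by rewrite big_ord0 mulr0 leNgt expR_gt0.
have [p [p0 p1 pZ]] := gibbs_weights (fun i => birkhoff_sum T phi m (x i)) n0.
have [mu Fmu muE] := @exists_mixture R X F n _ p Fconvex xS p0 p1.
exists mu => //; split=> [A mA|k a ma ae q q0 qm].
  exact: (mixture_preimage_le m0 p0 p1 muE).
have bphi := continuous_bounded_mfun Xcompact phicont.
have Ephi : \sum_i p i * birkhoff_sum T phi m (x i) = m%:R * \int[mu]_y phi y.
  rewrite (mean_mix bphi p0 p1 muE) mulr_sumr; apply: eq_bigr => i _.
  by rewrite integral_empirical// mulrCA mulVKf// gt_eqF.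
have Z0 : 0 < \sum_i expR (birkhoff_sum T phi m (x i)).
  by rewrite -(pmulr_rgt0 _ (expR_gt0 (m%:R * delta))) (lt_le_trans _ hZ)// expR_gt0.
have h1 : m%:R * (c - delta) <= ln (\sum_i expR (birkhoff_sum T phi m (x i))).
  rewrite -ler_expR lnK// mulrBr expRD expRN ler_pdivrMr ?expR_gt0//.
  by rewrite [leRHS]mulrC.
have h2 := separated_entropy Tcont ma ae q0 qm sep p0 p1 muE.
rewrite -(ler_pM2l mR); move: h1; rewrite pZ Ephi => /le_trans; apply.
rewrite [leRHS]mulrDr lerD2r mulrDr mulrA.
by rewrite [m%:R * (_ / m%:R)]mulrCA divff ?gt_eqF// mulr1.
Qed.

Lemma upper_rate (c delta : R) : (c%:E < limn_esup (ldp_rate T nu F))%E -> 0 < delta ->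
  exists rho : probability (borel X) R, [/\ F rho, @invariant_measure _ (borel X) R T rho &
    ((c - delta)%:E <= @ks_entropy _ (borel X) R T rho + (\int[rho]_x phi x)%:E)%E].
Proof.
move=> hc d0; have [e e0 gibbs] := weak_gibbs_bounds Xcompact Tcont phicont nugibbs d0.
have ee : 0 < e <= e by rewrite e0 lexx.
have [N HN] := gibbs e ee.
(* Only the times at which the rate exceeds [c] give a mixture; [N < m] also ensures [0 < m]. *)
pose good m := (N < m)%N && (c%:E < ldp_rate T nu F m)%E.
pose Pm m (mu : probability (borel X) R) := F mu /\
    (forall A : set (borel X), measurable A ->
       `|prob mu (T @^-1` A) - prob mu A| <= m%:R^-1) /\
    forall k (a : X -> 'I_k),
      (forall i, measurable (a @^-1` [set i] : set (borel X))) ->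
      (forall y z, a y = a z -> mdist y z <= e) ->
      forall q, (0 < q)%N -> (q <= m)%N ->
      c - delta <= q%:R^-1 * word_entropy T a mu q +
        2 * q%:R * ln k%:R / m%:R + \int[mu]_x phi x.
have exP m : exists mu, good m -> Pm m mu.
  have [/andP[Nm hm]|nm] := boolP (good m); last by exists nu.
  have m0 : (0 < m)%N by exact: leq_ltn_trans Nm.
  have [|mu Fmu muP] := @separated_mixture c delta e m m0 e0 _ hm.
    by move=> x; have /andP[] := HN m (ltnW Nm) x.
  by exists mu.
have [mu_ muP] := choice exP.
(* Tails of the good times. This filter is proper because the upper limit exceeds [c], so that good
   times occur arbitrarily late. *)
pose W0 : set_system nat := [set P | exists K, forall m, (K <= m)%N -> good m -> P m].
have W0P : ProperFilter W0.
  split.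
    move=> [K hK]; have [m Km hm] := lt_limn_esup hc (maxn K N.+1).
    apply: (hK m); first exact: leq_trans (leq_maxl _ _) Km.
    by rewrite /good hm andbT (leq_trans (leq_maxr _ _) Km).
  split.
  - by exists 0%N.
  - move=> P Q [K hK] [K' hK']; exists (maxn K K') => m; rewrite geq_max => /andP[Km K'm] gm.
    by split; [exact: hK|exact: hK'].
  - by move=> P Q PQ [K hK]; exists K => m Km gm; apply: PQ; exact: hK.
have [W [UW W0W]] := ultraFilterLemma W0P.
have FW : ProperFilter W := @ultra_proper _ W UW.
have Wgood : \forall m \near W, good m by apply: W0W; exists 0%N.
have Woo K : \forall m \near W, (K <= m)%N by apply: W0W; exists K.
have WP : \forall m \near W, Pm m (mu_ m) by apply: filterS Wgood => m; exact: muP.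
have invm0 (eps : R) : 0 < eps -> \forall m \near W, m%:R^-1 <= eps.
  move=> eps0; apply: filterS (Woo (Num.Def.truncn eps^-1).+1) => m hm.
  have hm' : eps^-1 <= m%:R.
    by apply: le_trans (ltW (truncnS_gt _)) _; rewrite ler_nat.
  by rewrite -[leRHS]invrK lef_pV2 ?posrE ?invr_gt0// (lt_le_trans _ hm')// invr_gt0.
have [lam [rho [lamP rhoO rhoK]]] := exists_limit_measure Xcompact mu_ UW.
have cint (f : X -> R) : continuous f ->
    \int[mu_ n]_x f x @[n --> W] --> \int[rho]_x f x.
  by move=> cf; exact: (limit_integral Xcompact UW lamP rhoK).
have Frho : F rho.
  apply: (@closed_cvg _ (M1 X) W FW mu_ F Fclosed).
    by apply: filterS WP => m [].
  by apply: cvg_M1 => f; apply: cint; exact: (svalP f).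
have measT := continuous_self_measurable Tcont.
have invrho : @invariant_measure _ (borel X) R T rho.
  apply: (limit_invariant Xcompact UW lamP rhoO) => // A mA.
  have mTA : measurable (T @^-1` A : set (borel X)).
    by rewrite -[X in measurable X]setTI; exact: measT.
  apply/eqP; rewrite -subr_eq0; apply/eqP.
  apply: (@cvg_unique _ (@Rhausdorff R)
    ((prob (mu_ n) (T @^-1` A) - prob (mu_ n) A) @[n --> W])).
    by apply: cvgB; exact: lamP.
  apply/cvgr0Pnorm_le => eps eps0; near=> m.
  have /le_trans : `|prob (mu_ m) (T @^-1` A) - prob (mu_ m) A| <= m%:R^-1.
    have [_ [h _]] : Pm m (mu_ m) by near: m.
    exact: h.
  by apply; near: m; exact: invm0.
have [k [a [ca ae]]] := exists_continuity_partition Xcompact rho e0.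
have ma i : measurable (a @^-1` [set i] : set (borel X)) by case: (ca i).
(* Sandwich: [rho U <= lam U <= lam A <= lam C <= rho C], and the two ends coincide. *)
have lam_continuity (A : set X) : continuity_set rho A -> lam A = prob rho A.
  move=> cA; have mA : measurable (A : set (borel X)) by case: cA.
  have [U [C [oU cC UA AC CU]]] := continuity_set_bounds cA.
  have le_lam' (B D : set (borel X)) : measurable B -> measurable D ->
      B `<=` D -> lam B <= lam D.
    move=> mB mD BD; apply: (ler_cvg_to (lamP B mB) (lamP D mD)).
    by apply: nearW => n; exact: le_prob.
  have mU := measurable_open oU; have mC := measurable_closed cC.
  have h1 := limit_open UW lamP rhoK oU; have h2 := rhoK C cC.
  have h3 := le_lam' U A mU mA UA; have h4 := le_lam' A C mA mC AC.
  have h5 := @le_prob _ (borel X) R rho _ _ mU mA UA.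
  have h6 := @le_prob _ (borel X) R rho _ _ mA mC AC.
  lra.
have cword q (v : {ffun 'I_q -> 'I_k}) :
    continuity_set rho [set x | word_at 0 q (itinerary a T x) = v].
  rewrite -(@join_atomE _ (borel X) T k (fun i => a @^-1` [set i]) a)//.
  (* The preimage lemma is applied to an iterate of [T], which has to be shown to preserve [rho] as
     well. *)
  apply: continuity_set_bigcap => i; apply: continuity_set_preimage => //.
    by move=> x; exact: continuous_iter.
  move=> A mA; have := @prob_preimage_iter _ (borel X) R rho T measT invrho i A mA.
  rewrite /prob => h; rewrite /pushforward -[LHS]fineK ?fin_num_measure//.
    by rewrite h fineK// fin_num_measure.
  rewrite -[X in measurable X]setTI.
  exact: (@measurable_iter _ (borel X) T measT i).
(* For fixed [q] three errors vanish along [W]: the block entropy, the boundary term of order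
   [q / m] and the integral. Only afterwards does [q] tend to infinity. *)
have key q : (0 < q)%N ->
    c - delta <= q%:R^-1 * word_entropy T a rho q + \int[rho]_x phi x.
  move=> q0; have qR : 0 < q%:R :> R by rewrite ltr0n.
  apply/ler_addgt0Pr => eps eps0.
  have eps30 : 0 < eps / 3 by rewrite divr_gt0.
  have nearH : \forall m \near W,
      word_entropy T a (mu_ m) q <= word_entropy T a rho q + q%:R * (eps / 3).
    apply: finite_entropy_limit => //.
    - by move=> m v; exact: prob_ge0.
    - by move=> m; exact: (sum_word_prob Tcont ma).
    - by move=> v; exact: prob_ge0.
    - exact: (sum_word_prob Tcont ma).
    - move=> v; rewrite /word_prob -lam_continuity//; apply: lamP.
      by case: (cword q v).
    - by rewrite mulr_gt0.
  have nearC : \forall m \near W, 2 * q%:R * ln k%:R / m%:R <= eps / 3.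
    have C0 : 0 < 2 * q%:R * `|ln (k%:R : R)| + 1.
      by rewrite ltr_wpDl// mulr_ge0// mulr_ge0// ltW.
    have : \forall m \near W, m%:R^-1 <= eps / 3 / (2 * q%:R * `|ln (k%:R : R)| + 1).
      by apply: invm0; rewrite divr_gt0.
    apply: filterS => m; rewrite ler_pdivlMr// [leLHS]mulrC => h; apply: le_trans h.
    rewrite ler_wpM2r ?invr_ge0//.
    have := ler_wpM2l (mulr_ge0 (ler0n R 2) (ltW qR)) (ler_norm (ln (k%:R : R))); lra.
  have nearphi : \forall m \near W, \int[mu_ m]_x phi x <= \int[rho]_x phi x + eps / 3.
    exact: (limit_integral_le Xcompact UW lamP rhoK phicont eps30).
  near W => m.
  have h1 : word_entropy T a (mu_ m) q <= word_entropy T a rho q + q%:R * (eps / 3).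
    by near: m.
  have h2 : 2 * q%:R * ln k%:R / m%:R <= eps / 3 by near: m.
  have h3 : \int[mu_ m]_x phi x <= \int[rho]_x phi x + eps / 3 by near: m.
  have qm : (q <= m)%N by near: m.
  have [_ [_ h]] : Pm m (mu_ m) by near: m.
  have := h k a ma ae q q0 qm.
  have : q%:R^-1 * word_entropy T a (mu_ m) q <=
      q%:R^-1 * word_entropy T a rho q + eps / 3.
    by rewrite ler_pdivrMl// mulrDr mulVKf ?gt_eqF.
  lra.
exists rho; split=> //.
have [l [lE ul _]] := @partition_entropy_cvg _ (borel X) R rho T measT invrho k
  (fun i => a @^-1` [set i]) (fibers_partition ma).
have cl : c - delta - \int[rho]_x phi x <= l.
  apply: (ler_cvg_to (@cvg_cst _ (c - delta - \int[rho]_x phi x) _ \oo _) ul).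
  near=> q.
  rewrite join_entropy_fibers lerBlDr; apply: key.
  by near: q; exists 1%N.
apply: (@le_trans _ _ (l%:E + (\int[rho]_x phi x)%:E)%E).
  by rewrite -EFinD lee_fin -lerBlDr.
rewrite leeD2r// -lE; apply: ereal_sup_ubound.
by exists k, (fun i => a @^-1` [set i]); split=> //; exact: fibers_partition.
Unshelve. all: by end_near. Qed.

Lemma upper_bound : (limn_esup (ldp_rate T nu F) <=
  ereal_sup [set h | exists rho : probability (borel X) R,
    (F `&` M1_inv T) rho /\
    h = @ks_entropy _ (borel X) R T rho + (\int[rho]_x phi x)%:E])%E.
Proof.
rewrite leNgt; apply/negP => lt_sup.
have [c /andP[supc cu]] : exists c : R, (ereal_sup [set h | exists rho : probability (borel X) R,
    (F `&` M1_inv T) rho /\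
    h = (@ks_entropy _ (borel X) R T rho + (\int[rho]_x phi x)%:E)%E] < c%:E <
    limn_esup (ldp_rate T nu F))%E.
  exact: exists_between_EFin.
have : (c%:E <= ereal_sup [set h | exists rho : probability (borel X) R,
    (F `&` M1_inv T) rho /\
    h = (@ks_entropy _ (borel X) R T rho + (\int[rho]_x phi x)%:E)%E])%E.
  apply/lee_addgt0Pr => e e0; rewrite -leeBlDr// -EFinB.
  have [rho [Frho invrho h]] := upper_rate cu e0.
  by apply: (le_trans h); apply: ereal_sup_ubound; exists rho.
by rewrite leNgt supc.
Qed.

End upper.

(** * Regularity and uniformity *)

Section regularity.
Context {R : realType} (X : pointedMetricType R) (Xcompact : compact [set: X]).

Lemma closed_exhaustion (U : set X) : open U -> exists K : nat -> set X,
  [/\ forall n, closed (K n), {homo K : n m / (n <= m)%N >-> n `<=` m} &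
    \bigcup_n K n = U].
Proof.
move=> oU; pose K n := \bigcap_(y in ~` U) [set x | n.+1%:R^-1 <= mdist y x].
exists K; split.
- move=> n; apply: closed_bigI => y _.
  rewrite -[X in closed X]/((mdist y : X -> R) @^-1` [set s | n.+1%:R^-1 <= s]).
  by apply: closed_comp => [z _|]; [exact: continuous_mdist|exact: closed_ge].
- move=> n m nm x Knx y Uy; apply: le_trans (Knx y Uy).
  by rewrite lef_pV2 ?posrE ?ltr0n// ler_nat.
- apply/seteqP; split=> [x [n _ Knx]|x Ux].
    apply: contrapT => nUx; have := Knx x nUx; rewrite /= mdistxx.
    by rewrite leNgt invr_gt0 ltr0n.
  have : nbhs x U by exact: open_nbhs_nbhs.
  rewrite -nbhs_ballE => -[r /= r0 xrU].
  exists (Num.Def.truncn r^-1) => // y nUy /=.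
  have : r <= mdist y x.
    by rewrite leNgt metric_sym; apply/negP => xy; apply: nUy; apply: xrU; rewrite ballEmdist.
  apply: le_trans; rewrite -[leRHS]invrK lef_pV2 ?posrE ?invr_gt0 ?ltr0n//.
  exact: ltW (truncnS_gt _).
Qed.

Variable rho : probability (borel X) R.

(** Continuity from below along [closed_exhaustion]. This is what identifies the regular extension
    of [rho] with [rho]. *)
Lemma open_content_prob (U : set X) : open U ->
  open_content (prob rho : set (borel X) -> R) U = rho U.
Proof.
move=> oU; have [K [cK ndK KU]] := closed_exhaustion oU.
have mU := measurable_open oU.
apply/eqP; rewrite eq_le; apply/andP; split.
  apply: ge_ereal_sup => _ [C [cC CU] <-].
  by rewrite -(probE rho (measurable_closed cC)); apply: le_measure => //;
    rewrite inE //; exact: measurable_closed.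
have mK n : measurable (K n : set (borel X)) by exact: measurable_closed.
have : rho (K n) @[n --> \oo] --> rho (\bigcup_n K n).
  apply: nondecreasing_cvg_mu => //; first by rewrite KU.
  by move=> n m nm; apply/subsetPset; exact: ndK.
rewrite KU => cKU; rewrite -(cvg_lim _ cKU)//.
apply: lime_le; first by apply/cvg_ex; exists (rho U).
apply: nearW => n; rewrite probE//; apply: ereal_sup_ubound.
by exists (K n) => //; split => //; rewrite -KU; exact: bigcup_sup.
Qed.

(** The regular extension of [rho] agrees with [rho] on open sets, hence on Borel sets. Its outer
    approximation by open sets is taken at the complement of [A]. *)
Lemma inner_regular (A : set (borel X)) (e : R) : measurable A -> 0 < e ->
  exists K : set X, [/\ closed K, K `<=` A & prob rho (A `\` K) <= e].
Proof.
move=> mA e0.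
have [|||mu [muO _ muadh]] := @exists_regular_extension R X Xcompact (prob rho).
- by move=> B _; exact: prob_ge0.
- exact: prob_setT.
- move=> B C mB mC BC; apply: EFin_inj; rewrite EFinD -!probE//; last exact: measurableU.
  by rewrite measureU.
have muE (B : set (borel X)) : measurable B -> mu B = rho B.
  move=> mB; apply: (@measure_unique _ R (borel X) open (fun=> setT)) => //.
  - by move=> U V; exact: openI.
  - by move=> _; exact: openT.
  - by rewrite bigcup_const.
  - by move=> U oU; exact: (etrans (muO U oU) (open_content_prob oU)).
  - by move=> _; apply: le_lt_trans (probability_le1 _ _) _; rewrite ?ltry.
have mCA : measurable (~` A) by exact: measurableC.
have [U [oU AU hU]] := muadh (~` A) e e0.
have mU := measurable_open oU.
exists (~` U); split; first exact: open_closedC.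
  by move=> x nUx; apply: contrapT => /AU.
move: hU; rewrite !muE// !probE// -EFinD lee_fin prob_setC// => hU.
have AUE : prob rho U = prob rho (~` A) + prob rho (A `\` ~` U).
  apply: EFin_inj; rewrite EFinD -!probE//; last by rewrite setDE setCK; exact: measurableI.
  rewrite -measureU//; last 2 first.
  - by rewrite setDE setCK; exact: measurableI.
  - by rewrite setDE setCK setIA setICl set0I.
  congr (rho _); rewrite setDE setCK; apply/seteqP; split=> [x Ux|x [/AU//|[]//]].
  by have [Ax|nAx] := pselect (A x); [right|left].
rewrite prob_setC// in AUE; lra.
Qed.

End regularity.

Section uniformity.
Context {R : realType} (X : pointedMetricType R) (Xcompact : compact [set: X]).

(** Stated near 0 from the right, so that finitely many such conditions on a radius can be met
    together. *)
Lemma closed_separated (K L : set X) : closed K -> closed L -> K `&` L = set0 ->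
  \forall e \near (0:R)^'+, forall x y, K x -> L y -> e < mdist x y.
Proof.
move=> cK cL KL.
have cptK : compact K by exact: (subclosed_compact cK Xcompact).
have := (compact_near_coveringP K).1 cptK R ((0:R)^'+)
  (fun e x => forall y, L y -> e < mdist x y) _.
move=> H; suff /H : forall x, K x -> \forall x' \near x & e \near (0:R)^'+,
    forall y, L y -> e < mdist x' y.
  by apply: filterS => e h x y Kx; exact: h.
move=> x Kx.
have : nbhs x (~` L).
  apply: open_nbhs_nbhs; split; first exact: closed_openC.
  by move=> Lx; have : (K `&` L) x by []; rewrite KL.
rewrite -nbhs_ballE => -[r /= r0 xrL].
have r20 : 0 < r / 2 by rewrite divr_gt0.
exists (ball x (r / 2), [set e | e < r / 2]).
  by split; [exact: nbhsx_ballx|exact: nbhs_right_lt].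
move=> [x' e] /= [xx' er] y Ly.
have : r <= mdist x y.
  by rewrite leNgt; apply/negP => xy; apply: (xrL y) => //; rewrite ballEmdist.
rewrite ballEmdist /= in xx'.
have := metric_triangle x x' y; lra.
Qed.

Lemma continuous_uniform (f : X -> R) (g : R) : continuous f -> 0 < g ->
  \forall e \near (0:R)^'+, forall x y, mdist x y <= e -> `|f x - f y| <= g.
Proof.
move=> cf g0.
have := (compact_near_coveringP [set: X]).1 Xcompact R ((0:R)^'+)
  (fun e x => forall y, mdist x y <= e -> `|f x - f y| <= g) _.
move=> H; suff /H : forall x, [set: X] x -> \forall x' \near x & e \near (0:R)^'+,
    forall y, mdist x' y <= e -> `|f x' - f y| <= g.
  by apply: filterS => e h x y; exact: h.
move=> x _.
have g20 : 0 < g / 2 by rewrite divr_gt0.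
have /nbhs_ballP[r /= r0 xr] : \forall y \near x, `|f x - f y| <= g / 2.
  by move/cvgrPdist_le : (cf x); exact.
have r20 : 0 < r / 2 by rewrite divr_gt0.
exists (ball x (r / 2), [set e | e < r / 2]).
  by split; [exact: nbhsx_ballx|exact: nbhs_right_lt].
move=> [x' e] /= [xx' er] y x'y.
have h1 : `|f x - f x'| <= g / 2.
  apply: xr; rewrite ballEmdist /=; rewrite ballEmdist /= in xx'; lra.
have h2 : `|f x - f y| <= g / 2.
  apply: xr; rewrite ballEmdist /=; rewrite ballEmdist /= in xx'.
  have := metric_triangle x x' y; lra.
rewrite ler_norml; move: h1 h2; rewrite !ler_norml; lra.
Qed.

Lemma M1_basis (G : set (M1 X)) (rho : probability (borel X) R) : open G -> G rho ->
  exists (fs : seq (Cont X)) (g : R), 0 < g /\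
    forall mu : probability (borel X) R,
      (forall f, List.In f fs ->
        `|\int[mu]_x (sval f x) - \int[rho]_x (sval f x)| < g) -> G mu.
Proof.
move=> oG Grho.
(* The basic neighbourhoods generate a filter; that it converges to [rho] can be tested on integrals
   by [cvg_M1], and G belongs to it as a neighbourhood of [rho]. *)
pose B : set_system (M1 X) := [set P | exists (fs : seq (Cont X)) (g : R), 0 < g /\
  forall mu : probability (borel X) R,
      (forall f, List.In f fs ->
        `|\int[mu]_x (sval f x) - \int[rho]_x (sval f x)| < g) -> P mu].
have FB : Filter B.
  split.
  - by exists [::], 1.
  - move=> P Q [fs [g [g0 H]]] [fs' [g' [g'0 H']]].
    exists (fs ++ fs'), (Num.min g g'); split; first by rewrite lt_min g0.
    move=> mu h; split.
      apply: H => f ffs; apply: lt_le_trans (h f _) _; last by rewrite ge_min lexx.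
      by apply/List.in_or_app; left.
    apply: H' => f ffs; apply: lt_le_trans (h f _) _; last by rewrite ge_min lexx orbT.
    by apply/List.in_or_app; right.
  - by move=> P Q PQ [fs [g [g0 H]]]; exists fs, g; split=> // mu /H; exact: PQ.
have : B --> (rho : M1 X).
  apply: cvg_M1 => f; apply/cvgrPdist_lt => e e0.
  by exists [:: f], e; split=> // mu h; rewrite distrC; apply: h; left.
by apply; exact: open_nbhs_nbhs.
Qed.

End uniformity.

(** * A weak law of large numbers for ergodic measures *)

(** The threshold sums of [f] and [g] coincide, and each mean is within [c / N] of what they
    predict. *)
Lemma mean_eq_levels d d' (Y : measurableType d) (Z : measurableType d') (R : realType)
    (mu : probability Y R) (nu : probability Z R) (f : Y -> R) (g : Z -> R) :
  bounded_mfun f -> bounded_mfun g ->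
  (forall t, prob mu [set x | t <= f x] = prob nu [set x | t <= g x]) ->
  \int[mu]_x f x = \int[nu]_x g x.
Proof.
move=> [mf [M fM]] [mg [M' gM]] fg.
have M0 : 0 <= M by rewrite (le_trans _ (fM point)).
have M'0 : 0 <= M' by rewrite (le_trans _ (gM point)).
pose K := M + M'.
set c := 2 * K + 2; set a := - K - 1.
have fac x : a <= f x <= a + c by have := fM x; rewrite ler_norml /a /c /K; lra.
have gac x : a <= g x <= a + c by have := gM x; rewrite ler_norml /a /c /K; lra.
have c0 : 0 < c by rewrite /c /K; lra.
apply/eqP; rewrite -subr_eq0 -normr_le0; apply/ler_addgt0Pl => e e0.
rewrite addr0.
pose N := (Num.Def.truncn (c / e)).+1.
have NR : 0 < N%:R :> R by rewrite ltr0n.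
have cN : c / N%:R <= e.
  by rewrite ler_pdivrMr// mulrC -ler_pdivrMr// ltW// truncnS_gt.
have := mean_thresholds mu mf (ltn0Sn _ : (0 < N)%N) c0 fac.
have := mean_thresholds nu mg (ltn0Sn _ : (0 < N)%N) c0 gac.
have -> : \sum_(i < N) prob mu (threshold_set f a c N i) =
    \sum_(i < N) prob nu (threshold_set g a c N i).
  by apply: eq_bigr => i _; exact: fg.
rewrite ler_norml; lra.
Qed.

Section weak_lln.
Context d (Y : measurableType d) (R : realType) (rho : probability Y R).
Context (T : Y -> Y) (mT : measurable_fun [set: Y] T).

Lemma bounded_mfun_comp f : bounded_mfun (f : Y -> R) -> bounded_mfun (fun x => f (T x)).
Proof.
move=> [mf [M fM]]; split; last by exists M.
exact: (measurableT_comp mf mT).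
Qed.

Lemma mean_invariant f : invariant_measure T rho -> bounded_mfun (f : Y -> R) ->
  \int[rho]_x f (T x) = \int[rho]_x f x.
Proof.
move=> invT bf; apply: mean_eq_levels => //; first exact: bounded_mfun_comp.
move=> t; rewrite /prob -[in RHS]invT//.
have [mf _] := bf.
have -> : [set x | t <= f x] = f @^-1` `[t, +oo[%classic.
  by apply/seteqP; split=> x /=; rewrite in_itv/= andbT.
rewrite -[X in measurable X]setTI; exact: mf.
Qed.

Variables (f : Y -> R) (bf : bounded_mfun f).

(* The maximum of 0 and of the Birkhoff sums of f of length at most N. *)
Fixpoint max_sum (N : nat) (x : Y) : R :=
  if N is N'.+1 then Num.max 0 (f x + max_sum N' (T x)) else 0.

Lemma max_sum_ge0 N x : 0 <= max_sum N x.
Proof. by case: N => [|N] //=; rewrite le_max lexx. Qed.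

Lemma le_max_sumS N x : max_sum N x <= max_sum N.+1 x.
Proof.
elim: N x => [|N ih] x; first exact: max_sum_ge0.
rewrite [leLHS]/= [leRHS]/=; rewrite ge_max le_max lexx/= le_max.
by apply/orP; right; rewrite lerD2l; exact: ih.
Qed.

Lemma le_max_sum N M x : (N <= M)%N -> max_sum N x <= max_sum M x.
Proof.
move=> /subnKC <-; elim: (M - N)%N => [|k ih]; first by rewrite addn0.
by rewrite addnS (le_trans ih)// le_max_sumS.
Qed.

Lemma sum_le_max_sum n x : \sum_(k < n) f (iter k T x) <= max_sum n x.
Proof.
elim: n x => [|n ih] x; first by rewrite big_ord0.
rewrite big_ord_recl /= le_max; apply/orP; right; rewrite lerD2l.
apply: le_trans (ih (T x)); apply: ler_sum => k _.
by rewrite -iterSr.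
Qed.

Lemma bounded_max_sum N : bounded_mfun (max_sum N).
Proof.
elim: N => [|N [mN [B NB]]]; first exact: bounded_mfun_cst.
have [mf [M fM]] := bf.
split.
  rewrite (_ : max_sum N.+1 = (cst 0) \max (fun x => f x + max_sum N (T x)))//.
  apply: measurable_maxr; first exact: measurable_cst.
  by apply: measurable_funD => //; exact: (measurableT_comp mN mT).
exists (M + B) => x; rewrite ger0_norm ?max_sum_ge0//=.
have h1 := fM x; have h2 := NB (T x).
rewrite ge_max; apply/andP; split; first by rewrite addr_ge0// (le_trans _ h1, le_trans _ h2).
by rewrite lerD// (le_trans (ler_norm _)).
Qed.

Lemma measurable_max_sum_gt N (C : R) : measurable [set x | C < max_sum N x].
Proof.
have [mN _] := bounded_max_sum N.
have -> : [set x | C < max_sum N x] = max_sum N @^-1` `]C, +oo[%classic.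
  by apply/seteqP; split=> x /=; rewrite in_itv/= andbT.
rewrite -[X in measurable X]setTI; exact: mN.
Qed.

(* Garsia's argument: f >= M - M \o T on [M > 0], and M and M \o T have the
   same mean. *)
Lemma maximal_ergodic N : invariant_measure T rho ->
  0 <= \int[rho]_x (f x * \1_[set y | 0 < max_sum N.+1 y] x).
Proof.
move=> invT.
set M := max_sum N.+1.
have bM : bounded_mfun M by exact: bounded_max_sum.
have bMT := bounded_mfun_comp bM.
have bN : bounded_mfun (fun x => -1 * M (T x)) by exact: bounded_mfunZ.
have mM := measurable_max_sum_gt N.+1 0.
have bf1 : bounded_mfun (fun x => f x * \1_[set y | 0 < M y] x).
  have [mf [B fB]] := bf; split.
    by apply: measurable_funM => //; exact: measurable_indic.
  exists B => x; rewrite normrM indicE.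
  apply: le_trans (fB x); rewrite ler_piMr//.
  by case: (_ \in _); rewrite /= ?normr1 ?normr0.
have : \int[rho]_x (M x + -1 * M (T x)) <= \int[rho]_x (f x * \1_[set y | 0 < M y] x).
  apply: le_mean => //; first exact: bounded_mfunD.
  move=> x; rewrite indicE.
  have := max_sum_ge0 N.+1 x; rewrite -/M le_eqVlt => /predU1P[M0|Mpos].
    rewrite memNset ?mulr0//= -?M0 ?ltxx//.
    have := max_sum_ge0 N.+1 (T x); rewrite -/M; lra.
  rewrite mem_set// mulr1.
  have : M x = f x + max_sum N (T x).
    move: Mpos; rewrite /M /= lt_max ltxx/= => h; apply/max_idPr; exact: ltW.
  have := le_max_sumS N (T x); rewrite -/M; lra.
by rewrite meanD// meanZ// mean_invariant//; apply: le_trans; rewrite mulN1r subrr.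
Qed.

Hypothesis ergT : ergodic_measure T rho.

Let unbounded_set := [set x | forall C : nat, exists N, C%:R < max_sum N x].

Let exceed (C : nat) : set Y := \bigcup_N [set x | C%:R < max_sum N x].

Let measurable_exceed C : measurable (exceed C).
Proof. by apply: bigcupT_measurable => N; exact: measurable_max_sum_gt. Qed.

Let unbounded_setE : unbounded_set = \bigcap_C exceed C.
Proof.
apply/seteqP; split=> [x h C _|x h C].
  by have [N hN] := h C; exists N.
by have [N _ hN] := h C I; exists N.
Qed.

(** The recursion of [max_sum] ties its supremum at [x] to that at [T x] up to the bound [B] of [f],
    so both are finite or both infinite. This yields the exact equality of sets that
    [ergodic_measure] tests. *)
Let unbounded_invariant : T @^-1` unbounded_set = unbounded_set.
Proof.
have [mf [B fB]] := bf.
have B0 : 0 <= B by rewrite (le_trans _ (fB point)).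
have bnd x := fB x.
pose K := (Num.Def.truncn B).+1.
have BK : B < K%:R by exact: truncnS_gt.
apply/seteqP; split=> x /= h C.
  have [N hN] := h (C + K)%N; exists N.+1 => /=.
  rewrite lt_max; apply/orP; right.
  have := bnd x; rewrite ler_norml natrD in hN *; lra.
have [N hN] := h (C + K)%N; exists N.
have := le_max_sumS N x => /(lt_le_trans hN) /=.
rewrite lt_max natrD => /orP[|].
  by have := ler0n R C; have := ler0n R K; lra.
have := bnd x; rewrite ler_norml; lra.
Qed.

(** By ergodicity the set has measure 0 or 1. With measure 1, the sets where [max_sum] is positive
    would increase to full measure, and the maximal inequality would give a nonnegative mean. *)
Lemma unbounded_set_null : \int[rho]_x f x < 0 -> prob rho unbounded_set = 0.
Proof.
move=> f_neg; have [invT erg] := ergT.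
have mE : measurable unbounded_set by rewrite unbounded_setE; exact: bigcapT_measurable.
have [E0|E1] := erg _ mE unbounded_invariant; first by rewrite /prob E0.
exfalso; move: f_neg; apply/negP; rewrite -leNgt.
have [mf [B fB]] := bf.
have B0 : 0 <= B by rewrite (le_trans _ (fB point)).
pose P N : set Y := [set x | 0 < max_sum N x].
have mP N : measurable (P N) by exact: measurable_max_sum_gt.
have ndP : {homo P : n m / (n <= m)%N >-> n `<=` m}.
  by move=> n m nm x /= h; apply: lt_le_trans h _; exact: le_max_sum.
have UP : prob rho (\bigcup_N P N) = 1.
  apply/eqP; rewrite eq_le prob_le1/=; last exact: bigcupT_measurable.
  have -> : 1 = prob rho unbounded_set by rewrite /prob E1.
  apply: le_prob => //; first exact: bigcupT_measurable.
  by move=> x /(_ 0%N)[N hN]; exists N.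
have cP : prob rho (P N) @[N --> \oo] --> (1 : R).
  have h : rho (P n) @[n --> \oo] --> rho (\bigcup_n P n).
    apply: nondecreasing_cvg_mu => //; first exact: bigcupT_measurable.
    by move=> n m nm; apply/subsetPset; exact: ndP.
  rewrite -UP /prob; apply: fine_cvg; rewrite fineK//.
  by rewrite fin_num_measure//; exact: bigcupT_measurable.
(* Off [P N.+1] the function is at least [- B], so extending the maximal inequality to the whole
   space loses at most [B] times the mass of the complement. *)
have lower N : - (B * (1 - prob rho (P N.+1))) <= \int[rho]_x f x.
  have bI : bounded_mfun (fun x => f x * \1_(P N.+1) x).
    split; first by apply: measurable_funM => //; exact: measurable_indic.
    exists B => x; rewrite normrM indicE.
    apply: le_trans (fB x); rewrite ler_piMr//.
    by case: (_ \in _); rewrite /= ?normr1 ?normr0.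
  have bC : bounded_mfun (fun x => - B * \1_(~` P N.+1) x : R).
    by apply: bounded_mfunZ; apply: bounded_mfun_indic; exact: measurableC.
  have : \int[rho]_x (f x * \1_(P N.+1) x + - B * \1_(~` P N.+1) x) <= \int[rho]_x f x.
    apply: le_mean => //; first exact: bounded_mfunD.
    move=> x; rewrite !indicE; have [Px|nPx] := pselect (P N.+1 x).
      by rewrite mem_set// memNset//= ?mulr1 ?mulr0 ?addr0//; apply.
    rewrite memNset// mem_set//= mulr0 mulr1 add0r.
    by have := fB x; rewrite ler_norml => /andP[].
  rewrite meanD// meanZ; last by apply: bounded_mfun_indic; exact: measurableC.
  rewrite mean_indic; last exact: measurableC.
  rewrite prob_setC//; have := maximal_ergodic N invT; rewrite -/(P N.+1) mulNr; lra.
have : - (B * (1 - prob rho (P N.+1))) @[N --> \oo] --> - (B * (1 - 1)).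
  apply: cvgN; apply: cvgM; first exact: cvg_cst.
  apply: cvgB; first exact: cvg_cst.
  by rewrite (cvg_shiftS (fun N => prob rho (P N))).
rewrite subrr mulr0 oppr0 => h.
apply: (cvgr_to_le h); exact: nearW.
Qed.

(** Almost surely the maxima stay bounded in [n], so outside a set of measure below [h] they stay
    below a constant, which [g * n] eventually exceeds. *)
Lemma max_sum_in_probability (g h : R) : \int[rho]_x f x < 0 -> 0 < g -> 0 < h ->
  \forall n \near \oo, prob rho [set x | g * n%:R < max_sum n x] <= h.
Proof.
move=> f_neg g0 h0.
have cE : prob rho (exceed C) @[C --> \oo] --> prob rho unbounded_set.
  have hc : rho (exceed n) @[n --> \oo] --> rho (\bigcap_n exceed n).
    apply: nonincreasing_cvg_mu => //.
    - by rewrite -ge0_fin_numE// fin_num_measure.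
    - by exact: bigcapT_measurable.
    - move=> n m nm; apply/subsetPset => x [N _ hN]; exists N => //=.
      by apply: le_lt_trans hN; rewrite ler_nat.
  rewrite unbounded_setE /prob; apply: fine_cvg; rewrite fineK//.
  by rewrite fin_num_measure//; exact: bigcapT_measurable.
rewrite unbounded_set_null// in cE.
have [C hC] : exists C, prob rho (exceed C) < h.
  have : \forall C \near \oo, prob rho (exceed C) < h by exact: (cvgr_lt _ cE).
  by move=> [C _ /(_ C (leqnn C))]; exists C.
near=> n.
apply: le_trans (ltW hC); apply: le_prob => //; first exact: measurable_max_sum_gt.
move=> x /= hx; exists n => //=; apply: le_lt_trans hx.
rewrite -ler_pdivrMl//.
near: n; exists (Num.Def.truncn (g^-1 * C%:R)).+1 => // n /= hn.
by apply: le_trans (ltW (truncnS_gt _)) _; rewrite ler_nat.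
Unshelve. all: by end_near. Qed.

End weak_lln.

Section weak_lln_birkhoff.
Context d (Y : measurableType d) (R : realType) (rho : probability Y R).
Context (T : Y -> Y) (mT : measurable_fun [set: Y] T).
Hypothesis ergT : ergodic_measure T rho.

Lemma weak_lln_upper (f : Y -> R) (g h : R) : bounded_mfun f -> 0 < g -> 0 < h ->
  \forall n \near \oo, prob rho
    [set x | n%:R * (\int[rho]_x f x + g) < \sum_(k < n) f (iter k T x)] <= h.
Proof.
(* Subtracting the mean plus [g / 2] makes the mean negative and leaves a margin of [g / 2] per
   step. *)
move=> bf g0 h0; set c := \int[rho]_x f x + g / 2.
pose f' x := f x + - c.
have bc : bounded_mfun (fun=> - c : R) := @bounded_mfun_cst _ Y R (- c).
have bf' : bounded_mfun f' by exact: bounded_mfunD.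
have f'neg : \int[rho]_x f' x < 0 by rewrite /f' meanD// mean_cst /c; lra.
have g20 : 0 < g / 2 by rewrite divr_gt0.
have := max_sum_in_probability mT bf' ergT f'neg g20 h0.
apply: filterS => n; apply: le_trans; apply: le_prob.
- have bS : bounded_mfun (fun x => \sum_(k < n) f (iter k T x)).
    apply: bounded_mfun_sum => k; have [mf [M fM]] := bf; split; last by exists M.
    exact: (measurableT_comp mf (measurable_iter mT k)).
  have -> : [set x | n%:R * (\int[rho]_x f x + g) < \sum_(k < n) f (iter k T x)] =
    (fun x => \sum_(k < n) f (iter k T x)) @^-1`
       `]n%:R * (\int[rho]_x f x + g), +oo[%classic.
    by apply/seteqP; split=> x /=; rewrite in_itv/= andbT.
  rewrite -[X in measurable X]setTI; exact: bS.1.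
- exact: measurable_max_sum_gt.
- move=> x /= hx; apply: lt_le_trans (sum_le_max_sum _ _ _ _).
  rewrite /f' big_split/= sumr_const card_ord -[- c *+ n]mulr_natl /c; lra.
Qed.

Lemma weak_lln (f : Y -> R) (g h : R) : bounded_mfun f -> 0 < g -> 0 < h ->
  \forall n \near \oo, prob rho
    [set x | g < `|n%:R^-1 * (\sum_(k < n) f (iter k T x)) - \int[rho]_x f x|] <= h.
Proof.
move=> bf g0 h0.
have h20 : 0 < h / 2 by rewrite divr_gt0.
pose fN x := -1 * f x.
have bfN : bounded_mfun fN by exact: bounded_mfunZ.
have h1 := weak_lln_upper bf g0 h20.
have h2 := weak_lln_upper bfN g0 h20.
have mS (f' : Y -> R) n t : bounded_mfun f' ->
    measurable [set x | t < \sum_(k < n) f' (iter k T x)].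
  move=> bf'; have bS : bounded_mfun (fun x => \sum_(k < n) f' (iter k T x)).
    apply: bounded_mfun_sum => k; have [mf [M fM]] := bf'; split; last by exists M.
    exact: (measurableT_comp mf (measurable_iter mT k)).
  have -> : [set x | t < \sum_(k < n) f' (iter k T x)] =
    (fun x => \sum_(k < n) f' (iter k T x)) @^-1` `]t, +oo[%classic.
    by apply/seteqP; split=> x /=; rewrite in_itv/= andbT.
  rewrite -[X in measurable X]setTI; exact: bS.1.
near=> n.
have n0 : (0 < n)%N by near: n; exists 1%N.
have nR : 0 < n%:R :> R by rewrite ltr0n.
set A := [set x | n%:R * (\int[rho]_x f x + g) < \sum_(k < n) f (iter k T x)].
set B := [set x | n%:R * (\int[rho]_x fN x + g) < \sum_(k < n) fN (iter k T x)].
have hA : prob rho A <= h / 2 by rewrite /A; near: n; exact: h1.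
have hB : prob rho B <= h / 2 by rewrite /B; near: n; exact: h2.
rewrite (splitr h); apply: le_trans (lerD hA hB).
have -> : [set x | g < `|n%:R^-1 * (\sum_(k < n) f (iter k T x)) - \int[rho]_x f x|] =
    A `|` B.
  apply/seteqP; split=> x /=; rewrite /A /B /= /fN -mulr_sumr meanZ// ltr_normr;
    set S := \sum_(k < n) _; set m := \int[rho]_x _.
    have -> : S = n%:R * (n%:R^-1 * S) by rewrite mulVKf// gt_eqF.
    rewrite mulKf ?gt_eqF// [-1 * (n%:R * _)]mulrCA !ltr_pM2l//.
    by move=> /orP[h'|h']; [left|right]; lra.
  have -> : S = n%:R * (n%:R^-1 * S) by rewrite mulVKf// gt_eqF.
  rewrite mulKf ?gt_eqF// [-1 * (n%:R * _)]mulrCA !ltr_pM2l//.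
  by move=> [|] h'; apply/orP; [left|right]; lra.
apply: prob_setU; [exact: (mS f n _ bf)|exact: (mS fN n _ bfN)].
Unshelve. all: by end_near. Qed.

End weak_lln_birkhoff.

(** * The lower bound *)

Section katok.
Context {R : realType} (X : pointedMetricType R).
Context (T : X -> X) (Tcont : continuous T).
Context (k : nat) (a : X -> 'I_k).
Hypothesis ma : forall i, measurable (a @^-1` [set i] : set (borel X)).

Let k0 : 0 < k%:R :> R.
Proof. by rewrite ltr0n; case: (a point) => i; case: k. Qed.

(* Gibbs' inequality against half the uniform measure on words plus half the
   average over i of the product measures that follow the itinerary of x i with
   probability 1 - th + th / k per letter. *)
Lemma katok_entropy (rho : probability (borel X) R) m N (x : 'I_N -> X) (Gam : set X)
    (th D : R) :
  measurable (Gam : set (borel X)) -> (0 < N)%N -> 0 < th < 1 -> 0 <= D ->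
  (forall y, Gam y -> exists i,
    \sum_(j < m) (a (iter j T (x i)) != a (iter j T y))%:R <= D) ->
  word_entropy T a rho m <= ln 2 + ln N%:R - m%:R * ln (1 - th) +
    D * ln (k%:R / th) + prob rho (~` Gam) * (m%:R * ln k%:R).
Proof.
move=> mGam N0 /andP[th0 th1] D0 cover.
have NR : 0 < N%:R :> R by rewrite ltr0n.
have k1 : 1 <= k%:R :> R by move: k0; rewrite ltr0n ler1n.
have lnk : 0 <= ln (k%:R : R) by exact: ln_ge0.
have lnN : 0 <= ln (N%:R : R) by apply: ln_ge0; rewrite ler1n.
have ln1th : ln (1 - th) <= 0 by apply: ln_le0; lra.
have kth : 0 <= ln (k%:R / th).
  by apply: ln_ge0; rewrite ler_pdivlMr// mul1r; lra.
pose g i j (l : 'I_k) : R := (1 - th) * (l == a (iter j T (x i)))%:R + th / k%:R.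
have g0 i j l : 0 < g i j l.
  by rewrite /g ltr_wpDl ?divr_gt0// mulr_ge0//; lra.
have sg i j : \sum_l g i j l = 1.
  rewrite /g big_split/= -mulr_sumr sumr_const card_ord -[(th / _) *+ _]mulr_natr divfK ?gt_eqF//.
  rewrite (bigD1 (a (iter j T (x i))))//= eqxx big1 ?addr0 ?mulr1 ?subrK//.
  by move=> l /negbTE ->.
pose Qi i (w : {ffun 'I_m -> 'I_k}) := \prod_(j < m) g i j (w j).
have Qi0 i w : 0 < Qi i w by apply: prodr_gt0 => j _; exact: g0.
have sQi i : \sum_w Qi i w = 1.
  rewrite -(bigA_distr_bigA (fun (j : 'I_m) l => g i j l)) /=.
  by rewrite big1// => j _; exact: sg.
pose Q w := 2^-1 * k%:R^-1 ^+ m + 2^-1 * (N%:R^-1 * \sum_i Qi i w).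
have u0 : 0 < 2^-1 * k%:R^-1 ^+ m :> R by rewrite mulr_gt0 ?exprn_gt0 ?invr_gt0.
have sQi0 w : 0 <= \sum_i Qi i w by apply: sumr_ge0 => i _; exact: ltW.
have v0 w : 0 <= 2^-1 * (N%:R^-1 * \sum_i Qi i w).
  by rewrite mulr_ge0// ?mulr_ge0// ?invr_ge0.
have Q0 w : 0 < Q w by rewrite ltr_pwDl.
have sQ : \sum_w Q w <= 1.
  rewrite big_split/= sumr_const card_ffun !card_ord -mulr_sumr -mulr_sumr exchange_big/=.
  rewrite (eq_bigr (fun=> 1)) ?sumr_const ?card_ord; last by move=> i _; exact: sQi.
  rewrite -[_ *+ (k ^ m)%N]mulr_natr natrX -mulrA -exprMn mulVf ?gt_eqF// expr1n.
  rewrite mulVf ?gt_eqF//; lra.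
pose p := @word_prob R X T k a rho m.
have p0 w : 0 <= p w by exact: prob_ge0.
have p1 : \sum_w p w = 1 by exact: (sum_word_prob Tcont ma).
apply: (le_trans (gibbs_inequality p0 p1 (fun w => ltW (Q0 w)) sQ (fun w _ => Q0 w))).
pose B := ln 2 + ln N%:R - m%:R * ln (1 - th) + D * ln (k%:R / th).
pose hit (w : {ffun 'I_m -> 'I_k}) := `[< exists y, Gam y /\ word_at 0 m (itinerary a T y) = w >].
(* A word not seen in [Gam] is paid by the uniform half of [Q], at cost [ln 2 + m ln k]; the other
   terms of [B] are nonnegative. *)
have lnQ w : - ln (Q w) <= B + (~~ hit w)%:R * (m%:R * ln k%:R).
  have [hw|nw] := boolP (hit w); last first.
    have : ln (2^-1 * k%:R^-1 ^+ m) <= ln (Q w).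
      by rewrite ler_ln ?posrE// lerDl.
    rewrite lnM ?posrE ?exprn_gt0 ?invr_gt0// lnV ?posrE//.
    rewrite exprVn lnV ?posrE ?exprn_gt0// lnXn// -[ln k%:R *+ m]mulr_natl /B /=.
    have := mulr_ge0 D0 kth; have := mulr_ge0 (ler0n R m) (_ : 0 <= - ln (1 - th)).
    rewrite oppr_ge0 mulrN mul1r => /(_ ln1th); lra.
  have [y [Gy wy]] := asboolP _ hw.
  have [i hi] := cover y Gy.
  rewrite mul0r addr0.
  (* One factor [1 - th] for every letter and a further [th / k] for each of the at most [D]
     mismatches; keeping [1 - th] at a mismatch too only lowers the bound. *)
  have hQi : expR (m%:R * ln (1 - th) - D * ln (k%:R / th)) <= Qi i w.
    apply: (@le_trans _ _ (expR (\sum_(j < m) (ln (1 - th) -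
        (a (iter j T (x i)) != a (iter j T y))%:R * ln (k%:R / th))))).
      rewrite ler_expR sumrB sumr_const card_ord -[ln (1 - th) *+ m]mulr_natl lerD2l lerN2.
      by rewrite -mulr_suml ler_wpM2r.
    rewrite expR_sum; apply: ler_prod => j _; rewrite expR_ge0/=.
    have wj : w j = a (iter j T y) by rewrite -wy ffunE.
    rewrite /g wj eq_sym; case: eqP => /= _.
      rewrite mul0r subr0 lnK ?posrE; last lra.
      by rewrite mulr1 lerDl divr_ge0// ltW.
    rewrite mulr0 add0r mul1r expRD expRN lnK ?posrE ?subr_gt0// lnK ?posrE ?divr_gt0//.
    by rewrite invf_div ler_piMl ?divr_ge0 ?ltW//; lra.
  have hQ : 2^-1 * (N%:R^-1 * Qi i w) <= Q w.
    apply: le_trans (_ : _ <= 2^-1 * (N%:R^-1 * \sum_i Qi i w)) _; last first.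
      by rewrite /Q lerDr ltW.
    rewrite ler_pM2l// ler_pM2l ?invr_gt0// (bigD1 i)//= lerDl sumr_ge0// => i' _.
    exact: ltW.
  have hQ2 : 2^-1 * (N%:R^-1 * expR (m%:R * ln (1 - th) - D * ln (k%:R / th))) <= Q w.
    by apply: le_trans hQ; rewrite ler_pM2l// ler_pM2l ?invr_gt0.
  have : ln (2^-1 * (N%:R^-1 * expR (m%:R * ln (1 - th) - D * ln (k%:R / th)))) <= ln (Q w).
    by rewrite ler_ln ?posrE// !mulr_gt0 ?invr_gt0 ?expR_gt0.
  rewrite lnM ?posrE ?invr_gt0 ?mulr_gt0 ?invr_gt0 ?expR_gt0//.
  rewrite lnM ?posrE ?invr_gt0 ?expR_gt0// expRK !lnV ?posrE// /B; lra.
apply: (@le_trans _ _ (\sum_w p w * (B + (~~ hit w)%:R * (m%:R * ln k%:R)))).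
  rewrite -sumrN; apply: ler_sum => w _; rewrite -mulrN; exact: ler_wpM2l.
under eq_bigr do rewrite mulrDr.
rewrite big_split/= -mulr_suml p1 mul1r lerD2l.
under eq_bigr do rewrite mulrA.
rewrite -mulr_suml ler_wpM2r ?mulr_ge0//.
have -> : \sum_w p w * (~~ hit w)%:R = \sum_(w | ~~ hit w) p w.
  rewrite [RHS]big_mkcond/=; apply: eq_bigr => w _.
  by case: (hit w); rewrite /= ?mulr0 ?mulr1.
have mword (w : {ffun 'I_m -> 'I_k}) :
    measurable ([set x | word_at 0 m (itinerary a T x) = w] : set (borel X)).
  apply: (@measurable_word _ (borel X)) => //; exact: continuous_self_measurable.
rewrite /p /word_prob -(@prob_fibers _ (borel X) _ rho _
  (fun y => word_at 0 m (itinerary a T y)) (fun w => ~~ hit w))//.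
apply: le_prob; [|exact: measurableC|].
  exact: (@measurable_fibers _ (borel X) _
    (fun y => word_at 0 m (itinerary a T y)) (fun w => ~~ hit w)).
by move=> y /= nh Gy; move/negP: nh; apply; apply/asboolP; exists y.
Qed.

End katok.

(** Markov's inequality: by invariance the mean number of visits is at most [m h^2], against the
    threshold [h m]. *)
Lemma markov_frequency d (Y : measurableType d) (R : realType) (rho : probability Y R)
    (T : Y -> Y) (B : set Y) (h : R) m :
  measurable_fun [set: Y] T -> invariant_measure T rho -> measurable B -> 0 < h ->
  prob rho B <= h ^+ 2 -> (0 < m)%N ->
  measurable [set x | h * m%:R < \sum_(j < m) (\1_B (iter j T x) : R)] /\
  prob rho [set x | h * m%:R < \sum_(j < m) (\1_B (iter j T x) : R)] <= h.
Proof.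
move=> mT invT mB h0 hB m0; have mR : 0 < m%:R :> R by rewrite ltr0n.
have mTB j : measurable (iter j T @^-1` B).
  by rewrite -[X in measurable X]setTI; exact: measurable_iter.
have iE j x : \1_B (iter j T x) = \1_(iter j T @^-1` B) x :> R.
  by rewrite !indicE; congr ((nat_of_bool _)%:R); apply/idP/idP; rewrite !inE.
have bS : bounded_mfun (fun x => \sum_(j < m) (\1_B (iter j T x) : R)).
  apply: bounded_mfun_sum => j; under eq_fun do rewrite iE.
  exact: bounded_mfun_indic.
set S := [set x | _].
have mS : measurable S.
  have -> : S = (fun x => \sum_(j < m) (\1_B (iter j T x) : R)) @^-1` `]h * m%:R, +oo[%classic.
    by apply/seteqP; split=> x /=; rewrite in_itv/= andbT.
  rewrite -[X in measurable X]setTI; exact: bS.1.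
split=> //.
have : \int[rho]_x (h * m%:R * \1_S x) <= \int[rho]_x (\sum_(j < m) (\1_B (iter j T x) : R)).
  apply: le_mean => //; first by apply: bounded_mfunZ; exact: bounded_mfun_indic.
  move=> x; rewrite indicE; have [Sx|nSx] := pselect (S x).
    by rewrite mem_set// mulr1 ltW.
  by rewrite memNset// mulr0 sumr_ge0// => j _; rewrite indicE.
rewrite meanZ; last exact: bounded_mfun_indic.
rewrite mean_indic// mean_sum; last first.
  by move=> j; under eq_fun do rewrite iE; exact: bounded_mfun_indic.
rewrite (eq_bigr (fun=> prob rho B)); last first.
  move=> j _; under eq_Rintegral do rewrite iE.
  by rewrite mean_indic// prob_preimage_iter.
rewrite sumr_const card_ord -[prob rho B *+ m]mulr_natl => hS.
have : h * m%:R * prob rho S <= h * m%:R * h.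
  by apply: (le_trans hS); rewrite [h * _]mulrC -mulrA ler_pM2l// -expr2.
by rewrite ler_pM2l// mulr_gt0.
Qed.

(** * Counting disjoint Gibbs balls around typical points *)

Section lower.
Context {R : realType} (X : pointedMetricType R) (Xcompact : compact [set: X]).
Context (T : X -> X) (Tcont : continuous T).
Context (phi : X -> R) (phicont : continuous phi).
Context (nu : probability (borel X) R) (nugibbs : weak_gibbs T phi nu).
Context (G : set (M1 X)) (Gopen : open G).
Context (rho : probability (borel X) R) (rho_ergodic : @ergodic_measure _ (borel X) R T rho).
Hypothesis Grho : G rho.

Let measT : measurable_fun [set: borel X] (T : borel X -> borel X).
Proof. exact: continuous_self_measurable. Qed.

Lemma dyn_ball_birkhoff (f : X -> R) (e g : R) m x y : (0 < m)%N ->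
  (forall u v, mdist u v <= e -> `|f u - f v| <= g) -> dyn_ball T m x e y ->
  `|m%:R^-1 * birkhoff_sum T f m x - m%:R^-1 * birkhoff_sum T f m y| <= g.
Proof.
move=> m0 fg xy; have mR : 0 < m%:R :> R by rewrite ltr0n.
rewrite -mulrBr normrM ger0_norm ?invr_ge0// ler_pdivrMl// -sumrB.
apply: le_trans (ler_norm_sum _ _ _) _.
rewrite mulr_natl -[in leRHS](card_ord m) -sumr_const; apply: ler_sum => j _.
by apply: fg; exact: xy.
Qed.

Lemma open_empirical_preimage m : (0 < m)%N ->
  open [set x | G (@empirical _ (borel X) R T m x)].
Proof.
move=> m0; apply: (@open_comp _ _ (fun x => @empirical _ (borel X) R T m x : M1 X)) => //.
by move=> x _; exact: continuous_empirical.
Qed.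

Lemma typical_points (fs : seq (X -> R)) (B : set (borel X)) (g h : R) :
  (forall f, List.In f fs -> continuous f) -> measurable B -> prob rho B <= h ^+ 2 ->
  0 < g -> 0 < h ->
  \forall m \near \oo, exists Gam : set (borel X), [/\ measurable Gam,
    prob rho (~` Gam) <= h + h,
    forall x, Gam x -> forall f, List.In f fs ->
      `|m%:R^-1 * birkhoff_sum T f m x - \int[rho]_y f y| <= g &
    forall x, Gam x -> \sum_(j < m) (\1_B (iter j T x) : R) <= h * m%:R].
Proof.
move=> cfs mB hB g0 h0.
have invT : @invariant_measure _ (borel X) R T rho by case: rho_ergodic.
suff lln (h' : R) : 0 < h' -> \forall m \near \oo, exists Gam : set (borel X), [/\ measurable Gam,
    prob rho (~` Gam) <= h' &
    forall x, Gam x -> forall f, List.In f fs ->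
      `|m%:R^-1 * birkhoff_sum T f m x - \int[rho]_y f y| <= g].
  have := lln h h0; apply: filter_app; near=> m => -[Gam [mGam hGam fGam]].
  have m0 : (0 < m)%N by near: m; exists 1%N.
  have [mS hS] := markov_frequency measT invT mB h0 hB m0.
  set S := [set x | _] in mS hS.
  exists (Gam `&` ~` S); split.
  - by apply: measurableI => //; exact: measurableC.
  - rewrite setCI setCK.
    by apply: le_trans (prob_setU _ _ _) (lerD hGam hS) => //; exact: measurableC.
  - by move=> x [/fGam].
  - by move=> x [_ nS]; rewrite leNgt; apply/negP.
(* Each test function takes half of the exceptional mass still allowed. *)
elim: fs cfs => [|f fs ih] cfs in h' * => h'0.
  apply: nearW => m; exists setT; split=> //.
  by rewrite setCT prob_set0 ltW.
have h'20 : 0 < h' / 2 by rewrite divr_gt0.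
have cf : continuous f by apply: cfs; left.
have bf := continuous_bounded_mfun Xcompact cf.
have := weak_lln measT rho_ergodic bf g0 h'20.
have := ih _ (h' / 2) h'20; move=> /(_ (fun f' h => cfs f' (or_intror h))).
apply: filter_app2; near=> m => -[Gam [mGam hGam fGam]].
set S := [set x | _] => hS.
have mS : measurable (S : set (borel X)).
  have -> : S = ((fun x => m%:R^-1 * birkhoff_sum T f m x) @^-1`
      [set t | g < `|t - \int[rho]_y f y|]) by [].
  apply: measurable_open; apply: open_comp => [x _|].
    by apply: cvgM; [exact: cvg_cst|exact: continuous_birkhoff_sum].
  rewrite (_ : [set t | _] = (fun t => `|t - \int[rho]_y f y|) @^-1` [set t | g < t])//.
  apply: open_comp => [t _|]; last exact: open_gt.
  by apply: cvg_norm; apply: cvgB; [exact: cvg_id|exact: cvg_cst].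
exists (Gam `&` ~` S); split.
- by apply: measurableI => //; exact: measurableC.
- rewrite setCI setCK (splitr h').
  by apply: le_trans (prob_setU _ _ _) (lerD hGam hS) => //; exact: measurableC.
- move=> x [Gx nSx] f' [<-|]; last exact: fGam.
  by rewrite leNgt; apply/negP.
Unshelve. all: by end_near. Qed.

Variables (k : nat) (a : X -> 'I_k).
Hypothesis ma : forall i, measurable (a @^-1` [set i] : set (borel X)).

(** Each cell is shrunk to a closed set, losing mass at most [h / k]. Distinct closed cells are at
    positive distance, so off the lost part [B] close points share their letter. *)
Lemma closed_letters (h : R) : 0 < h -> exists (B : set (borel X)) (e0 : R),
  [/\ measurable B, prob rho B <= h, 0 < e0 &
    forall e, 0 < e <= e0 -> forall x y, ~ B x -> ~ B y -> mdist x y <= e -> a x = a y].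
Proof.
move=> h0.
have k0 : (0 < k)%N by case: (a point) => i; case: k.
have kR : 0 < k%:R :> R by rewrite ltr0n.
have hk : 0 < h / k%:R by rewrite divr_gt0.
have [K KP] := choice (fun i => inner_regular Xcompact rho (ma i) hk).
have cK i : closed (K i) by case: (KP i).
have mD i : measurable (a @^-1` [set i] `\` K i : set (borel X)).
  by apply: measurableD => //; exact: measurable_closed.
exists (\bigcup_i (a @^-1` [set i] `\` K i)).
have nearsep : \forall e \near (0:R)^'+, forall (i j : 'I_k) x y, i != j ->
    K i x -> K j y -> e < mdist x y.
  apply: filter_forall => i; apply: filter_forall => j.
  have [->|ij] := eqVneq i j; first exact: nearW.
  have := closed_separated Xcompact (cK i) (cK j).
  move=> /(_ _); have Kij : K i `&` K j = set0.
    apply/seteqP; split=> // x [Kix Kjx]; have [_ Ki _] := KP i; have [_ Kj _] := KP j.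
    by move: ij; rewrite -(Ki x Kix) -(Kj x Kjx) eqxx.
  by move=> /(_ Kij); apply: filterS => e he x y _; exact: he.
near (0:R)^'+ => e0.
exists e0; split.
- exact: fin_bigcup_measurable.
- apply: le_trans (prob_bigcup_le _ mD) _.
  have -> : h = \sum_(i < k) h / k%:R.
    by rewrite sumr_const card_ord -[RHS]mulr_natr divfK// gt_eqF.
  by apply: ler_sum => i _; case: (KP i).
- by [].
- move=> e /andP[e_gt0 ee0] x y nBx nBy xy.
  have Kx : K (a x) x by apply: contrapT => nK; apply: nBx; exists (a x).
  have Ky : K (a y) y by apply: contrapT => nK; apply: nBy; exists (a y).
  apply/eqP; apply: contrapT => /negP axy.
  have : forall (i j : 'I_k) x y, i != j -> K i x -> K j y -> e0 < mdist x y.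
    by near: e0.
  move=> /(_ _ _ _ _ axy Kx Ky); rewrite ltNge => /negP; apply.
  exact: le_trans ee0.
Unshelve. all: by end_near. Qed.

(** Counting the points loses [3 g]: one [g] for [ln 2], one for the noise [th], one for mismatches
    and atypical points together. The measure of a ball loses one [g] by the Gibbs bound and one by
    the Birkhoff average of [phi]. The constant 6 leaves a margin. *)
Lemma lower_rate (l g : R) : (forall q, (0 < q)%N -> l <= q%:R^-1 * word_entropy T a rho q) ->
  0 < g ->
  \forall m \near \oo, ((l + \int[rho]_x phi x - 6 * g)%:E <= ldp_rate T nu G m)%E.
Proof.
move=> hl g0.
have k0 : (0 < k)%N by case: (a point) => i; case: k.
have kR : 0 < k%:R :> R by rewrite ltr0n.
have k1 : 1 <= k%:R :> R by rewrite ler1n.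
have lnk : 0 <= ln (k%:R : R) by exact: ln_ge0.
have [fs [g' [g'0 Gfs]]] := M1_basis Gopen Grho.
(* With this noise, following an itinerary exactly costs [g] per letter. *)
pose th : R := 1 - expR (- g).
have eg : expR (- g) < 1 by rewrite expR_lt1 oppr_lt0.
have th0 : 0 < th by rewrite subr_gt0.
have th1 : th < 1 by rewrite ltrBlDr ltrDl expR_gt0.
have lnth : ln (1 - th) = - g by rewrite /th opprB addrC subrK expRK.
have kth : 0 <= ln (k%:R / th) by apply: ln_ge0; rewrite ler_pdivlMr// mul1r; lra.
(* The coefficients of [h m] in [katok_entropy], for [2 h m] mismatches and an atypical set of mass
   [2 h]; the 4 keeps [C] positive. *)
pose C := 2 * ln (k%:R / th) + 2 * ln (k%:R : R) + 4.
have C4 : 4 <= C by rewrite /C; lra.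
have C0 : 0 < C by lra.
(* [g / C] bounds these terms by [m g]; [1 / 8] keeps the mass of the complement of [Gam] below 1,
   so that [Gam] is nonempty. *)
pose h : R := Num.min (g / C) (1 / 8).
have h0 : 0 < h by rewrite lt_min !divr_gt0.
have h8 : h <= 1 / 8 by rewrite ge_min lexx orbT.
have hC : h * C <= g by rewrite -ler_pdivlMr// ge_min lexx.
(* The square is what [markov_frequency] asks for. *)
have hh : 0 < h ^+ 2 by rewrite exprn_gt0.
have [B [e0 [mB hB e00 sepB]]] := closed_letters hh.
have [e1 e10 gibbs] := weak_gibbs_bounds Xcompact Tcont phicont nugibbs g0.
(* A point of a ball is off by [g1] from its centre and the centre by [g1] from [rho]: in total less
   than [g'], so the ball stays in G. *)
pose g1 := Num.min (g' / 4) g.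
have g10 : 0 < g1 by rewrite lt_min g0 divr_gt0.
have g1g : g1 <= g by rewrite ge_min lexx orbT.
have g1g' : g1 <= g' / 4 by rewrite ge_min lexx.
have nearunif : \forall e \near (0:R)^'+, forall f : Cont X, List.In f fs ->
    forall x y, mdist x y <= e -> `|sval f x - sval f y| <= g1.
  elim: (fs) => [|f fs' ih]; first by apply: nearW.
  have cu := continuous_uniform Xcompact (svalP f) g10.
  near=> e => f' [<-|]; first by near: e.
  by move: f'; near: e.
have e020 : 0 < e0 / 2 by rewrite divr_gt0.
near (0:R)^'+ => e.
have eu : forall f : Cont X, List.In f fs ->
    forall x y, mdist x y <= e -> `|sval f x - sval f y| <= g1 by near: e.
have e_gt0 : 0 < e by [].
have ee1 : e <= e1 by near: e; exact: nbhs_right_le.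
(* Points separated at scale [2 e] have disjoint balls of radius [e], so the letters must be
   controlled at scale [2 e]. *)
have ee0 : 2 * e <= e0.
  suff : e <= e0 / 2 by lra.
  by near: e; exact: nbhs_right_le.
have e20 : 0 < 2 * e by lra.
have ee1' : 0 < e <= e1 by rewrite e_gt0.
have [N gibbsN] := gibbs e ee1'.
have ctests f : List.In f (phi :: [seq sval f | f <- fs]) -> continuous f.
  by move=> [<-//|/List.in_map_iff[f' [<- _]]]; exact: (svalP f').
have := typical_points ctests mB hB g10 h0.
apply: filter_app; near=> m => -[Gam [mGam hGam tests visits]].
have m0 : (0 < m)%N by near: m; exists 1%N.
have mR : 0 < m%:R :> R by rewrite ltr0n.
have Nm : (N <= m)%N by near: m; exists N.
have ln2m : ln 2 <= m%:R * g.
  rewrite -ler_pdivrMr//; near: m; exists (Num.Def.truncn (ln 2 / g)).+1 => // n /= hn.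
  by apply: le_trans (ltW (truncnS_gt _)) _; rewrite ler_nat.
have [n [x [xG sep cov]]] := exists_separated_set Xcompact Tcont Gam m e20.
have n0 : (0 < n)%N.
  rewrite lt0n; apply/eqP => n0; move: x xG sep cov; rewrite n0 => x _ _ cov.
  have : prob rho (~` Gam) = 1.
    rewrite (_ : ~` Gam = setT) ?prob_setT//; apply/seteqP; split=> // y _ /cov[[]//].
  lra.
have nR : 0 < n%:R :> R by rewrite ltr0n.
have D0 : 0 <= 2 * (h * m%:R) by rewrite mulr_ge0// mulr_ge0// ltW.
(* Letters differ only when one of the two orbits is in [B], and each visits [B] at most [h m]
   times. *)
have hamming y : Gam y -> exists i,
    \sum_(j < m) (a (iter j T (x i)) != a (iter j T y))%:R <= 2 * (h * m%:R).
  move=> Gy; have [i xy] := cov y Gy; exists i.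
  have hv1 := visits _ (xG i); have hv2 := visits _ Gy.
  apply: (@le_trans _ _ (\sum_(j < m) (\1_B (iter j T (x i)) + \1_B (iter j T y) : R))).
    apply: ler_sum => j _; rewrite !indicE.
    have [Bx|nBx] := pselect (B (iter j T (x i))).
      rewrite mem_set//=; case: (_ != _); case: (_ \in _); rewrite /=; lra.
    have [By|nBy] := pselect (B (iter j T y)).
      rewrite (mem_set By)/=; case: (_ != _); case: (_ \in _); rewrite /=; lra.
    rewrite !memNset// (_ : a (iter j T (x i)) = a (iter j T y)) ?eqxx ?addr0//.
    by apply: (sepB (2 * e)) => //; [rewrite e20|exact: xy].
  by rewrite big_split/=; lra.
have th01 : 0 < th < 1 by rewrite th0.
have := katok_entropy Tcont ma rho mGam n0 th01 D0 hamming.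
rewrite lnth.
(* The bound on [l] is used at the single time [q = m]. *)
have hlm : m%:R * l <= word_entropy T a rho m by rewrite -ler_pdivlMl//; exact: hl.
have hP : prob rho (~` Gam) * (m%:R * ln k%:R) <= (h + h) * (m%:R * ln k%:R).
  by rewrite ler_wpM2r// mulr_ge0.
have hm : m%:R * (h * C) <= m%:R * g by rewrite ler_pM2l.
have h4 : 0 <= m%:R * h by rewrite mulr_ge0// ltW.
move=> hkatok.
have lnn : m%:R * (l - 3 * g) <= ln n%:R.
  move: hkatok hlm hP hm h4 ln2m; rewrite /C; set u := ln (k%:R / th); set v := ln k%:R; lra.
apply: ldp_rate_ge => //.
  by apply: measurable_open; exact: open_empirical_preimage.
have mball i : measurable (dyn_ball T m (x i) e : set (borel X)).
  by apply: measurable_closed; exact: closed_dyn_ball.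
have ballG i : dyn_ball T m (x i) e `<=` [set y | G (@empirical _ (borel X) R T m y)].
  move=> y xy /=; apply: Gfs => f ffs.
  have cf : continuous (sval f) := svalP f.
  rewrite integral_empirical//.
  have h1 := dyn_ball_birkhoff m0 (eu f ffs) xy.
  have h2 : `|m%:R^-1 * birkhoff_sum T (sval f) m (x i) - \int[rho]_z sval f z| <= g1.
    by apply: tests => //; right; apply/List.in_map_iff; exists f.
  move: h1 h2; rewrite !ler_norml ltr_norml; lra.
apply: (@le_trans _ _ (\sum_i prob nu (dyn_ball T m (x i) e))); last first.
  apply: sum_prob_le => //.
    by apply: measurable_open; exact: open_empirical_preimage.
  move=> i j ij; apply/seteqP; split=> // y [xi xj]; apply: (sep i j ij) => q qm.
  have := metric_triangle (iter q T (x i)) (iter q T y) (iter q T (x j)).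
  have := xi q qm; have := xj q qm; rewrite (metric_sym (iter q T (x j))); lra.
apply: (@le_trans _ _ (\sum_(i < n) expR (m%:R * (\int[rho]_y phi y - 2 * g)))).
  rewrite sumr_const card_ord -[leRHS]mulr_natl -[n%:R in leRHS]lnK ?posrE// -expRD ler_expR.
  by have := mulr_ge0 (ltW mR) (ltW g0); lra.
apply: ler_sum => i _; have /andP[+ _] := gibbsN m Nm (x i); apply: le_trans.
rewrite ler_expR.
have : `|m%:R^-1 * birkhoff_sum T phi m (x i) - \int[rho]_z phi z| <= g1.
  by apply: tests => //; left.
rewrite ler_norml => /andP[h1 _].
have h2 : \int[rho]_y phi y - g <= m%:R^-1 * birkhoff_sum T phi m (x i) by lra.
move: h2; rewrite ler_pdivlMl// mulrBr; lra.
Unshelve. all: by end_near. Qed.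

End lower.

Lemma lower_bound {R : realType} (X : pointedMetricType R) (Xcompact : compact [set: X])
    (T : X -> X) (Tcont : continuous T) (phi : X -> R) (phicont : continuous phi)
    (nu : probability (borel X) R) (nugibbs : weak_gibbs T phi nu)
    (G : set (M1 X)) (Gopen : open G) (rho : probability (borel X) R) :
  @ergodic_measure _ (borel X) R T rho -> G rho ->
  (@ks_entropy _ (borel X) R T rho + (\int[rho]_x phi x)%:E <=
    limn_einf (ldp_rate T nu G))%E.
Proof.
move=> rho_ergodic Grho; set L := limn_einf _.
rewrite -leeBrDr//; apply: ge_ereal_sup => _ [k [A [partA ->]]].
rewrite leeBrDr//.
have measT := continuous_self_measurable Tcont.
have [invT _] := rho_ergodic.
have [l [-> _ hl]] := partition_entropy_cvg measT invT partA.
have [a aE] := partition_letter partA.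
have ma i : measurable (a @^-1` [set i] : set (borel X)) by rewrite -aE; case: partA.
have {}aE : A = (fun i => a @^-1` [set i]) by apply/funext.
apply/lee_addgt0Pr => e e0.
rewrite -EFinD -leeBlDr// -EFinB.
have e60 : 0 < e / 6 by rewrite divr_gt0.
apply: limn_einf_ge.
have hl' q : (0 < q)%N -> l <= q%:R^-1 * word_entropy T a rho q.
  by move=> q0; rewrite -join_entropy_fibers -aE; exact: hl.
have := lower_rate Xcompact Tcont phicont nugibbs Gopen rho_ergodic Grho ma hl' e60.
by apply: filterS => m; rewrite mulrCA divff ?mulr1.
Qed.

Theorem theorem1 (R : realType) (X : pointedMetricType R)
    (Xcompact : compact [set: X])
    (T : X -> X) (Tcont : continuous T) (Tonto : range T = [set: X])
    (phi : X -> R) (phicont : continuous phi)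
    (nu : probability (borel X) R) (nugibbs : weak_gibbs T phi nu) :
  (forall G : set (M1 X), open G ->
     forall rho : probability (borel X) R,
       @ergodic_measure _ (borel X) R T rho -> G rho ->
       (limn_einf (ldp_rate T nu G)
          >= @ks_entropy _ (borel X) R T rho + (\int[rho]_x phi x)%:E)%E)
  /\
  (forall F : set (M1 X), convex_measures F -> closed F ->
     (limn_esup (ldp_rate T nu F)
        <= ereal_sup [set h | exists rho : probability (borel X) R,
             (F `&` M1_inv T) rho /\
             h = @ks_entropy _ (borel X) R T rho
                   + (\int[rho]_x phi x)%:E])%E).
Proof.
split=> [G Gopen rho rho_ergodic Grho|F Fconvex Fclosed].
  exact: lower_bound.
exact: upper_bound.
Qed.
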